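(* Let $m\in\mathbb{N}$, let $f$ be a canonical function, and suppose that the bounded density shift $X_f$ satisfies $X_f\subset\{0,1,\dots,m\}^{\mathbb{Z}}$. Let $\alpha_f$ be its limiting gradient. If $\alpha_f>\sum_{i=1}^{m}\frac{i}{i+1}$, then $X_f$ is intrinsically ergodic.
   Context: A function $f:\mathbb{N}_0\to[0,\infty)$ is canonical if $f(0)=0$, $f(k+1)\ge f(k)$ for all $k\ge 0$, and $f(k+n)\le f(k)+f(n)$ for all $k,n\in\mathbb{N}$. The bounded density shift associated to a canonical function $f$ is $$X_f=\Big\{x\in(\mathbb{N}_0)^{\mathbb{Z}}:\ \forall p\in\mathbb{N},\ \forall i\in\mathbb{Z},\ \sum_{r=i}^{i+p-1}x_r\le f(p)\Big\},$$ which is a subshift (closed, shift-invariant set) over the alphabet $\{0,1,\dots,\lfloor f(1)\rfloor\}$, with the shift map $\sigma$ given by $(\sigma x)_i=x_{i+1}$. The limiting gradient of $X_f$ is $\alpha_f=\lim_{n\to\infty} f(n)/n$ (the limit exists and equals the infimum, by subadditivity). A measure of maximal entropy of a subshift $X$ is a $\sigma$-invariant Borel probability measure $\mu$ on $X$ whose entropy $h_\mu(X)$ equals the topological entropy $h_{top}(X)$. A subshift is intrinsically ergodic if it has exactly one measure of maximal entropy. *)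

(* Defs.v *)
From HB Require Import structures.
From mathcomp Require Import all_boot all_order all_algebra.
From mathcomp Require Import finmap.
From mathcomp Require Import all_classical all_reals all_analysis.
Set Implicit Arguments.
Unset Strict Implicit.
Unset Printing Implicit Defensive.
Import Order.TTheory GRing.Theory Num.Theory.
Import numFieldNormedType.Exports.
Local Open Scope classical_set_scope.
Local Open Scope fset_scope.
Local Open Scope ring_scope.

(* Bi-infinite sequences over the discrete alphabet nat, with the product
   topology.  Every subshift below is a subset of this ambient space. *)
Definition config := prod_topology (fun _ : int => nat).

Definition borel_config := g_sigma_algebraType (@open config).

Definition shift_map (x : config) : config := fun i => x (i + 1).

(* [word_at x i n] is the word x_i x_(i+1) ... x_(i+n-1). *)
Definition word_at (x : config) (i : int) (n : nat) : n.-tuple nat :=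
  [tuple x (i + (val j)%:Z) | j < n].

Definition language (X : set config) (n : nat) : set (n.-tuple nat) :=
  [set w | exists2 x, X x & exists i, word_at x i n = w].
Arguments language : clear implicits.

Definition cylinder (n : nat) (w : n.-tuple nat) : set borel_config :=
  [set x | word_at x 0 n = w].

(* The alphabet of a subshift is finite, so [language X n] is a finite set and
   [fset_set] and the finitely supported sum below see all of it. Terms of index
   n = 0 (division by 0) do not affect the limits. *)
Definition htop (R : realType) (X : set config) : R :=
  limn (fun n => ln (#|` fset_set (language X n)|%:R) / n%:R).

(* Words w with mu [w] = 0 contribute 0. *)
Definition entropy (R : realType) (X : set config)
    (mu : probability borel_config R) : R :=
  limn (fun n =>
    (\sum_(w \in language X n)
       - (fine (mu (cylinder w)) * ln (fine (mu (cylinder w))))) / n%:R).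

(* A Borel measure on the closed set X is identified with a Borel measure on
   [config] giving full mass to X. *)
Definition invariant_measure (R : realType) (X : set config)
    (mu : probability borel_config R) : Prop :=
  mu X = 1%E /\
  forall A : set borel_config, measurable A -> mu (shift_map @^-1` A) = mu A.

Definition is_mme (R : realType) (X : set config)
    (mu : probability borel_config R) : Prop :=
  invariant_measure X mu /\ entropy X mu = htop R X.

(* Uniqueness is stated on measurable sets: the library's measures are functions
   on all sets, whose values at non-measurable sets carry no meaning. *)
Definition intrinsically_ergodic (R : realType) (X : set config) : Prop :=
  exists2 mu : probability borel_config R, is_mme X mu &
    forall nu : probability borel_config R, is_mme X nu ->
      forall A : set borel_config, measurable A -> nu A = mu A.

Definition canonical_function (R : realType) (f : nat -> R) : Prop :=
  [/\ forall k, 0 <= f k,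
      f 0%N = 0,
      forall k, f k <= f k.+1
    & forall k n, f (k + n)%N <= f k + f n].

Definition bounded_density_shift (R : realType) (f : nat -> R) : set config :=
  [set x : config | forall (p : nat) (i : int), (0 < p)%N ->
     (\sum_(0 <= r < p) x (i + r%:Z)%R)%:R <= f p].

Definition limiting_gradient (R : realType) (f : nat -> R) : R :=
  limn (fun n => f n / n%:R).

(* Main.v *)
Require Import Defs.
From HB Require Import structures.
From mathcomp Require Import all_boot all_order all_algebra.
From mathcomp Require Import all_classical all_reals all_analysis.
From mathcomp Require Import ring lra zify.
Set Implicit Arguments.
Unset Strict Implicit.
Unset Printing Implicit Defensive.
Import Order.TTheory GRing.Theory Num.Theory.
Import numFieldNormedType.Exports.
Local Open Scope classical_set_scope.
Local Open Scope ring_scope.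

(** A word belongs to the language of the shift when all its factors satisfy the
    density bound; [lam] is the exponential growth rate of the language, so that
    [ln lam] is the topological entropy. Uniqueness comes from a hidden renewal
    structure.

    A cut of a word is a position such that no factor that ends or begins there has
    density above [alpha]. As [alpha * k <= f k], the two parts of a word
    with a cut can be recombined freely with those of other words ([lang_cat]). The
    numbers of words between cuts therefore satisfy a renewal equation, provided that
    cuts are frequent: the heart of the proof is [nocut_rare], which says that the
    words of length [n] without an interior cut are exponentially fewer than
    [lam ^+ n]. The assumption on [alpha] is used there, in three steps.
    - Words of density above the sum of the [i / (i + 1)] are exponentially rare
      in any set of words that is stable under lowering letters
      ([high_density_rare]). Each word sends weights to the words below it, by a
      product kernel for which every word receives a total weight of 1 but dense
      words send out an exponentially large one.
    - Choose [beta] between this sum and [alpha]. Words with many positions from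
      which some factor rises above the line of slope [beta] and height [T] are rare
      ([tall_rare]).
    - At any other position, seen from both sides, replacing a block of letters by
      zeros creates a cut. In a word without cuts, the blocks that were replaced are
      visible afterwards as the places where a block of zeros makes a cut. Every such
      word thus gives rise to exponentially many different words of the language.

    The renewal theorem of Erdos, Feller and Pollard ([renewal_theorem]) then gives
    the convergence of the normalized numbers of words ([renewal_limits]), in
    particular a bound [C * lam ^+ n] on the size of the language, and the
    asymptotic independence of what happens at distant places. By a second moment
    computation, the frequency of any fixed word [s] is close to a constant in all
    but a small proportion of the long words ([frequency_concentration]). An
    invariant measure of maximal entropy gives little mass to a small proportion of
    the words, by the Gibbs inequality ([max_entropy_small]), so that the measure
    of the cylinder of [s] has to be this constant ([maximal_unique]).

    For existence, take a limit of empirical frequencies of factors in the words of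
    the language. Each word of length [n] gets a probability at most
    [C ^+ 2 / lam ^+ n], which forces the entropy to be maximal ([maximal_exists]).

    These arguments deal with the probabilities of words only. They are transferred to
    Borel measures by the facts that cylinders generate the Borel sets and determine a
    measure ([cyl_measure_unique]), and that consistent word probabilities come from
    a measure, obtained from the uniform law on an interval ([process_measure]). *)

(** * Words over a finite alphabet *)

Section Words.
Variable m : nat.

Definition letters : seq nat := iota 0 m.+1.
Arguments letters : simpl never.

Lemma mem_letters c : (c \in letters) = (c <= m)%N.
Proof. by rewrite mem_iota add0n ltnS. Qed.

Fixpoint words n : seq (seq nat) :=
  if n is n'.+1 then [seq c :: u | c <- letters, u <- words n'] else [:: [::]].

Lemma mem_words n u :
  (u \in words n) = (size u == n) && all (fun c => c <= m)%N u.
Proof.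
elim: n u => [|n IH] u; first by case: u.
apply/allpairsP/idP => [[[a b] /= [ha hb ->]]|].
  move: hb; rewrite IH /= eqSS => /andP[-> ->]; rewrite andbT /=.
  by move: ha; rewrite mem_letters.
case: u => [//|c u]; rewrite /= eqSS => /and3P[hs hc hu]; exists (c, u); split => //=.
  by rewrite mem_letters.
by rewrite IH hs hu.
Qed.

Lemma size_words n u : u \in words n -> size u = n.
Proof. by rewrite mem_words => /andP[/eqP]. Qed.

Lemma uniq_words n : uniq (words n).
Proof.
elim: n => [//|n IH]; apply: allpairs_uniq => //; first exact: iota_uniq.
by move=> [a b] [c d] _ _ /= [-> ->].
Qed.

Variable R : realType.
Implicit Types (F : seq nat -> R).

Lemma big_wordsS n F :
  \sum_(u <- words n.+1) F u = \sum_(c <- letters) \sum_(u <- words n) F (c :: u).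
Proof.
by rewrite -[words n.+1]/([seq c :: u | c <- letters, u <- words n]) big_allpairs_dep.
Qed.

Lemma big_words0 F : \sum_(u <- words 0) F u = F [::].
Proof. by rewrite /= big_seq1. Qed.

Lemma big_words_cat i j F :
  \sum_(u <- words (i + j)) F u =
  \sum_(x <- words i) \sum_(y <- words j) F (x ++ y).
Proof.
elim: i F => [|i IH] F; first by rewrite big_words0.
rewrite addSn !big_wordsS; apply: eq_bigr => c _.
exact: (IH (fun u => F (c :: u))).
Qed.

Lemma big_words1 F : \sum_(u <- words 1) F u = \sum_(c <- letters) F [:: c].
Proof. by rewrite big_wordsS; apply: eq_bigr => c _; rewrite big_words0. Qed.

Lemma big_words_rcons n F :
  \sum_(u <- words n.+1) F u = \sum_(u <- words n) \sum_(c <- letters) F (rcons u c).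
Proof.
rewrite -addn1 big_words_cat; apply: eq_bigr => x _; rewrite big_words1.
by apply: eq_bigr => c _; rewrite cats1.
Qed.

Lemma big_words_rev n F : \sum_(u <- words n) F (rev u) = \sum_(u <- words n) F u.
Proof.
have hp : perm_eq (words n) (map rev (words n)); last by rewrite [RHS](perm_big _ hp) big_map.
apply: uniq_perm; rewrite ?uniq_words ?map_inj_uniq ?uniq_words //; first exact: (can_inj revK).
move=> u; apply/idP/mapP => [hu|[v hv ->]].
  by exists (rev u); rewrite ?revK // mem_words size_rev all_rev -mem_words.
by move: hv; rewrite !mem_words size_rev all_rev.
Qed.

Definition count_words n (P : pred (seq nat)) : R := \sum_(u <- words n) (P u)%:R.

Lemma count_words_ge0 n P : 0 <= count_words n P.
Proof. by apply: sumr_ge0 => u _; rewrite ler0n. Qed.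

Lemma le_count_words n (P Q : pred (seq nat)) :
  (forall u, u \in words n -> P u -> Q u) -> count_words n P <= count_words n Q.
Proof.
move=> h; rewrite /count_words !big_seq; apply: ler_sum => u hu.
by have := h u hu; case: (P u) => [->|_] //; rewrite ler0n.
Qed.

Lemma eq_count_words n (P Q : pred (seq nat)) :
  (forall u, u \in words n -> P u = Q u) -> count_words n P = count_words n Q.
Proof. by move=> h; rewrite /count_words !big_seq; apply: eq_bigr => u /h ->. Qed.

Lemma count_words_cat i j (P Q Q' : pred (seq nat)) :
  (forall x y, x \in words i -> y \in words j -> P (x ++ y) = Q x && Q' y) ->
  count_words (i + j) P = count_words i Q * count_words j Q'.
Proof.
move=> h; rewrite /count_words big_words_cat mulr_suml.
rewrite [LHS]big_seq [RHS]big_seq.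
apply: eq_bigr => x hx; rewrite mulr_sumr !big_seq; apply: eq_bigr => y hy.
by rewrite h // -natrM mulnb.
Qed.

Lemma le_count_words_cat i j (P Q Q' : pred (seq nat)) :
  (forall x y, x \in words i -> y \in words j -> P (x ++ y) -> Q x && Q' y) ->
  count_words (i + j) P <= count_words i Q * count_words j Q'.
Proof.
move=> h; rewrite -(@count_words_cat _ _ (fun u => Q (take i u) && Q' (drop i u))).
  apply: le_count_words => u; rewrite mem_words => /andP[/eqP hs hu].
  rewrite -{1}(cat_take_drop i u) => /h; apply.
    rewrite mem_words size_takel ?hs ?leq_addr // eqxx.
    by apply/allP => c /mem_take /(allP hu).
  rewrite mem_words size_drop hs addKn eqxx.
  by apply/allP => c /mem_drop /(allP hu).
by move=> x y /size_words hx _; rewrite take_size_cat // drop_size_cat.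
Qed.

End Words.

(** * Density constraints on finite words *)

Section SeqComplements.
Implicit Types u v : seq nat.

Lemma takeD_cat k u v : take k (u ++ v) = take k u ++ take (k - size u) v.
Proof.
rewrite take_cat; case: ltnP => h; first by rewrite (eqP (ltnW h : _ - _ == 0)%N) take0 cats0.
by rewrite [take k u]take_oversize.
Qed.

Lemma dropD_cat k u v : drop k (u ++ v) = drop k u ++ drop (k - size u) v.
Proof.
rewrite drop_cat; case: ltnP => h; first by rewrite (eqP (ltnW h : _ - _ == 0)%N) drop0.
by rewrite [drop k u]drop_oversize.
Qed.

Definition below u v := all2 (fun a b => a <= b)%N u v.

Lemma sumn_below u v : below u v -> (sumn u <= sumn v)%N.
Proof. by elim: u v => [|a u IH] [|b v] //= /andP[h /IH]; exact: leq_add. Qed.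

Lemma below_size u v : below u v -> size u = size v.
Proof. by elim: u v => [|a u IH] [|b v] //= /andP[_ /IH ->]. Qed.

Lemma below_take k u v : below u v -> below (take k u) (take k v).
Proof. by elim: u v k => [|a u IH] [|b v] [|k] //= /andP[-> /IH]; exact. Qed.

Lemma below_drop k u v : below u v -> below (drop k u) (drop k v).
Proof. by elim: u v k => [|a u IH] [|b v] [|k] //= /andP[_]; exact: IH. Qed.

Lemma below_cat u v u' v' : size u = size u' ->
  below (u ++ v) (u' ++ v') = below u u' && below v v'.
Proof. by elim: u u' => [|a u IH] [|b u'] //= [/IH ->]; rewrite andbA. Qed.

Lemma below_rev u v : below (rev u) (rev v) = below u v.
Proof.
elim: u v => [|a u IH] [|b v] //=; rewrite ?rev_cons ?[rev [::]]/=.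
- by rewrite -cats1; case: (rev v).
- by rewrite -cats1; case: (rev u).
have [e|e] := eqVneq (size u) (size v).
  by rewrite -!cats1 below_cat ?size_rev //= IH andbT andbC.
by apply/idP/idP; [move/below_size; rewrite !size_rcons !size_rev => -[h]|case/andP=> _ /below_size h]; rewrite h eqxx in e.
Qed.

Lemma take_rev k u : take k (rev u) = rev (drop (size u - k) u).
Proof.
have [h|h] := leqP k (size u); last first.
  by rewrite (eqP (ltnW h : _ - _ == 0)%N) drop0 take_oversize // size_rev ltnW.
rewrite -{1}(cat_take_drop (size u - k) u) rev_cat takel_cat; last first.
  by rewrite size_rev size_drop subKn.
by rewrite take_oversize // size_rev size_drop subKn.
Qed.

Lemma drop_rev k u : drop k (rev u) = rev (take (size u - k) u).
Proof.
have [h|h] := leqP k (size u); last first.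
  by rewrite (eqP (ltnW h : _ - _ == 0)%N) take0 drop_oversize // size_rev ltnW.
rewrite -{1}(cat_take_drop (size u - k) u) rev_cat.
by rewrite drop_size_cat // size_rev size_drop subKn.
Qed.

Lemma sumn_take_le k u : (sumn (take k u) <= sumn u)%N.
Proof. by rewrite -{2}(cat_take_drop k u) sumn_cat leq_addr. Qed.

End SeqComplements.

Section Prefixes.
Variable R : realType.
Implicit Types (g : nat -> R) (u v : seq nat).

Definition prefix_bounded g u :=
  all (fun k => (sumn (take k u))%:R <= g k) (iota 0 (size u).+1).

Definition suffix_bounded g u := prefix_bounded g (rev u).

(** The bound is tested up to the length of the word only, which keeps it decidable;
    monotonicity covers the larger indices. *)
Lemma prefix_boundedP g u : {homo g : i j / (i <= j)%N >-> i <= j} ->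
  reflect (forall k, (sumn (take k u))%:R <= g k) (prefix_bounded g u).
Proof.
move=> gmono; apply: (iffP allP) => [h k|h k _]; last exact: h.
have [hk|hk] := leqP k (size u); first by apply: h; rewrite mem_iota.
have := h (size u); rewrite mem_iota ltnSn !take_oversize ?(ltnW hk) // => /(_ isT) h'.
exact: le_trans h' (gmono _ _ (ltnW hk)).
Qed.

Lemma prefix_bounded_below g u v : below u v -> prefix_bounded g v -> prefix_bounded g u.
Proof.
move=> huv /allP h; apply/allP => k hk; rewrite (below_size huv) in hk.
by apply: le_trans (h k hk); rewrite ler_nat; apply: sumn_below; exact: below_take.
Qed.

Lemma suffix_bounded_below g u v : below u v -> suffix_bounded g v -> suffix_bounded g u.
Proof. by rewrite -below_rev; exact: prefix_bounded_below. Qed.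

Lemma prefix_bounded_take g u k : prefix_bounded g u -> prefix_bounded g (take k u).
Proof.
move=> /allP h; apply/allP => j; rewrite mem_iota add0n /= ltnS size_take_min leq_min => /andP[hj hj'].
by rewrite take_takel //; apply: h; rewrite mem_iota add0n ltnS.
Qed.

Definition line (b T : R) (k : nat) := b * k%:R + T.

Lemma line_homo b T : 0 <= b -> {homo line b T : i j / (i <= j)%N >-> i <= j}.
Proof. by move=> hb i j hij; rewrite lerD2r ler_wpM2l // ler_nat. Qed.

(** The line of slope [b] that bounds [v] starts, once [u] has been read, below the
    line that bounds [u], because [u] has density at most [b]. *)
Lemma prefix_bounded_cat b T u v : 0 <= b -> 0 <= T ->
  prefix_bounded (line b T) u -> prefix_bounded (line b 0) v -> (sumn u)%:R <= b * (size u)%:R ->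
  prefix_bounded (line b T) (u ++ v).
Proof.
move=> hb hT /(prefix_boundedP _ (line_homo _ hb)) hu /(prefix_boundedP _ (line_homo _ hb)) hv hs.
apply/(prefix_boundedP _ (line_homo _ hb)) => k; rewrite takeD_cat sumn_cat natrD.
have [hk|hk] := leqP k (size u).
  by rewrite (eqP (hk : _ - _ == 0)%N) take0 addr0.
rewrite take_oversize ?(ltnW hk) //; have := hv (k - size u)%N.
by rewrite /line natrB ?(ltnW hk) // => h; lra.
Qed.

End Prefixes.

(** * The language of the shift and its cuts *)

Section Language.
Variables (R : realType) (f : nat -> R).
Hypothesis f_homo : {homo f : i j / (i <= j)%N >-> i <= j}.
Hypothesis f_ge0 : forall k, 0 <= f k.
Implicit Types u v : seq nat.

(** The constraint is tested on the prefixes of the suffixes of [u], so that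
    membership in the language is a boolean. *)
Definition lang u := all (fun i => prefix_bounded f (drop i u)) (iota 0 (size u).+1).

Lemma langP u : reflect (forall i k, (sumn (take k (drop i u)))%:R <= f k) (lang u).
Proof.
apply: (iffP allP) => [h i k|h i _]; last by apply/prefix_boundedP.
have [hi|hi] := leqP i (size u).
  by move: k; apply/(prefix_boundedP _ f_homo); apply: h; rewrite mem_iota.
by rewrite drop_oversize ?(ltnW hi) //= f_ge0.
Qed.

(** Sums are only bounded from above, so that lowering letters never leaves the
    language: the counting arguments below rest on this. *)
Lemma lang_below u v : below u v -> lang v -> lang u.
Proof.
move=> huv /langP h; apply/langP => i k; apply: le_trans (h i k).
by rewrite ler_nat; apply: sumn_below; apply: below_take; exact: below_drop.
Qed.

Lemma lang_take k u : lang u -> lang (take k u).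
Proof.
move=> /langP h; apply/langP => i j.
have [hi|hi] := leqP i k; last by rewrite drop_oversize ?f_ge0 // size_take_min; lia.
have -> : drop i (take k u) = take (k - i) (drop i u) by rewrite take_drop subnK.
by rewrite -take_min; apply: le_trans (h i (minn j (k - i))) _; apply: f_homo; rewrite geq_minl.
Qed.

Lemma lang_drop k u : lang u -> lang (drop k u).
Proof. by move=> /langP h; apply/langP => i j; rewrite drop_drop. Qed.

Lemma lang_rev u : lang (rev u) = lang u.
Proof.
suff H v : lang v -> lang (rev v) by apply/idP/idP => [/H|]; [rewrite revK|exact: H].
move=> /langP h; apply/langP => i k.
rewrite drop_rev take_rev size_take_min sumn_rev.
set l := minn _ _; set j := (l - k)%N.
have -> : drop j (take (size v - i) v) = take (size v - i - j) (drop j v).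
  by rewrite take_drop; have [hh|hh] := leqP j (size v - i); [rewrite subnK|rewrite !drop_oversize // size_take_min; lia].
apply: le_trans (h j (size v - i - j)%N) _; apply: f_homo; rewrite /j /l; lia.
Qed.

Lemma lang_catl u v : lang (u ++ v) -> lang u.
Proof. by move=> /(lang_take (size u)); rewrite take_size_cat. Qed.

Lemma lang_catr u v : lang (u ++ v) -> lang v.
Proof. by move=> /(lang_drop (size u)); rewrite drop_size_cat. Qed.

Variable alpha : R.
Hypothesis alpha_ge0 : 0 <= alpha.
Hypothesis alpha_le : forall k, alpha * k%:R <= f k.

Definition lgood u := prefix_bounded (line alpha 0) u.
Definition rgood u := suffix_bounded (line alpha 0) u.

Lemma lgoodP u : reflect (forall k, (sumn (take k u))%:R <= alpha * k%:R) (lgood u).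
Proof.
by apply: (iffP (prefix_boundedP _ (line_homo _ alpha_ge0))) => h k; have := h k; rewrite /line addr0.
Qed.

Lemma rgoodP u :
  reflect (forall k, (sumn (drop (size u - k) u))%:R <= alpha * k%:R) (rgood u).
Proof.
by apply: (iffP (lgoodP _)) => h k; have := h k; rewrite take_rev sumn_rev.
Qed.

Lemma lgood_rev u : lgood (rev u) = rgood u. Proof. by []. Qed.
Lemma lgood_take k u : lgood u -> lgood (take k u).
Proof. exact: prefix_bounded_take. Qed.

Lemma lgood_sum u : lgood u -> (sumn u)%:R <= alpha * (size u)%:R.
Proof. by move=> /lgoodP /(_ (size u)); rewrite take_size. Qed.

Lemma lgood_cat u v : lgood u -> lgood v -> lgood (u ++ v).
Proof. by move=> hu hv; apply: prefix_bounded_cat => //; exact: lgood_sum. Qed.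

Lemma lgood_catE u v : lgood v -> lgood (u ++ v) = lgood u.
Proof.
move=> hv; apply/idP/idP => [/(lgood_take (size u))|hu]; last exact: lgood_cat.
by rewrite take_size_cat.
Qed.

Lemma rgood_catE u v : rgood u -> rgood (u ++ v) = rgood v.
Proof. by rewrite -!lgood_rev rev_cat; exact: lgood_catE. Qed.

(** A factor across the junction is a suffix of [u] followed by a prefix of [v],
    both of density at most [alpha]. *)
Lemma lang_cat u v : rgood u -> lgood v -> lang u -> lang v -> lang (u ++ v).
Proof.
move=> /rgoodP hr /lgoodP hl /langP hu /langP hv; apply/langP => i k.
rewrite dropD_cat takeD_cat sumn_cat size_drop.
have [hi|hi] := leqP (size u) i.
  by rewrite (eqP (hi : size u - i == 0)%N) drop_oversize //= subn0; exact: hv.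
rewrite (eqP (ltnW hi : _ - _ == 0)%N) drop0.
have [hk|hk] := leqP k (size u - i).
  by rewrite (eqP (hk : k - _ == 0)%N) take0 addn0; exact: hu.
rewrite [take k _]take_oversize ?size_drop ?(ltnW hk) //.
apply: le_trans (alpha_le k).
have := hr (size u - i)%N; rewrite subKn ?(ltnW hi) // => h1.
have := hl (k - (size u - i))%N => h2.
by rewrite natrD; apply: le_trans (lerD h1 h2) _; rewrite -mulrDr -natrD subnKC ?(ltnW hk).
Qed.

(** A cut splits a word into two parts that can be recombined freely with the
    parts of any other word with a cut: this is the renewal structure. *)
Definition cut u i := rgood (take i u) && lgood (drop i u).

Lemma cut_catl u v i : lgood v -> (i <= size u)%N -> cut (u ++ v) i = cut u i.
Proof.
move=> hv hi; rewrite /cut takel_cat // dropD_cat.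
by rewrite (eqP (hi : i - _ == 0)%N) drop0 lgood_catE.
Qed.

Lemma cut_catr u v i : rgood u -> cut (u ++ v) (size u + i) = cut v i.
Proof.
move=> hu; rewrite /cut takeD_cat dropD_cat take_oversize ?leq_addr // drop_oversize ?leq_addr //.
by rewrite addKn /= rgood_catE.
Qed.

Lemma cut_size u v : cut (u ++ v) (size u) = rgood u && lgood v.
Proof. by rewrite /cut take_size_cat // drop_size_cat. Qed.

End Language.

(** * Subadditive sequences and the growth rate of the language *)

Section Fekete.
Variable R : realType.

(** Fekete: an index is a multiple of a nearly optimal one, up to a remainder that
    takes boundedly many values. *)
Lemma fekete (a : nat -> R) :
  (forall n, 0 <= a n) -> (forall n k, a (n + k)%N <= a n + a k) ->
  ((fun n => a n / n%:R) @ \oo --> limn (fun n => a n / n%:R)) /\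
  (forall n, limn (fun n => a n / n%:R) * n%:R <= a n).
Proof.
move=> a0 asub.
pose S := [set a n.+1 / n.+1%:R | n in setT].
have Sinf : has_inf S.
  split; first by exists (a 1%N / 1%:R), 0%N.
  by exists 0 => _ [n _ <-]; rewrite divr_ge0.
have lower n : inf S * n%:R <= a n.
  case: n => [|n]; first by rewrite mulr0.
  by rewrite -ler_pdivlMr ?ltr0n //; apply: ge_inf; [exact: Sinf.2|exists n].
have amul q n : a (q * n)%N <= q%:R * a n + a 0%N.
  elim: q => [|q IH]; first by rewrite mul0n mul0r add0r.
  by rewrite mulSn; apply: le_trans (asub _ _) _; rewrite -natr1; lra.
suff cv : (fun n => a n / n%:R) @ \oo --> inf S by rewrite (cvg_lim _ cv).
apply/cvgrPdist_le => /= e e0.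
have e20 : 0 < e / 2 by lra.
have [_ [N _ <-] hN] := @inf_adherent _ S _ e20 Sinf.
pose M := a 0%N + \sum_(r < N.+1) a r.
have M0 : 0 <= M by rewrite addr_ge0 // sumr_ge0.
have aM r : (r < N.+1)%N -> a r <= M - a 0%N.
  move=> hr; rewrite /M addrC addKr (bigD1 (Ordinal hr)) //= lerDl sumr_ge0 //.
near=> n.
have n0 : (0 < n)%N by near: n; exact: nbhs_infty_gt.
have nR : 0 < n%:R :> R by rewrite ltr0n.
have hl : inf S <= a n / n%:R by rewrite ler_pdivlMr.
rewrite distrC ger0_norm ?subr_ge0 // lerBlDl.
have hM : M <= e / 2 * n%:R.
  rewrite -ler_pdivrMl // mulrC; near: n; exact: nbhs_infty_ger.
rewrite ler_pdivrMr //.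
have han : a n <= (n %/ N.+1)%:R * a N.+1 + M.
  rewrite {1}(divn_eq n N.+1); apply: le_trans (asub _ _) _.
  have := amul (n %/ N.+1)%N N.+1; have := aM _ (ltn_pmod n (ltn0Sn N)); lra.
have hq : (n %/ N.+1)%:R * a N.+1 <= n%:R * (a N.+1 / N.+1%:R).
  rewrite mulrCA mulrC ler_wpM2l // ler_pdivlMr ?ltr0n // -natrM ler_nat; exact: leq_trunc_div.
have h3 : n%:R * (a N.+1 / N.+1%:R) <= n%:R * (inf S + e / 2) by rewrite ler_wpM2l // ltW.
have -> : (inf S + e) * n%:R = n%:R * (inf S + e / 2) + e / 2 * n%:R by field.
by apply: le_trans han _; apply: lerD => //; exact: le_trans h3.
Unshelve. all: by end_near.
Qed.

End Fekete.

Section Growth.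
Variables (R : realType) (m : nat) (f : nat -> R).
Hypothesis f_homo : {homo f : i j / (i <= j)%N >-> i <= j}.
Hypothesis f_ge0 : forall k, 0 <= f k.

Definition lang_card n : R := count_words m R n (lang f).
Local Notation L := lang_card.

(** The exponential of the topological entropy. *)
Definition growth : R := expR (limn (fun n => ln (L n) / n%:R)).
Local Notation lam := growth.

Lemma lang_nseq0 n : lang f (nseq n 0%N).
Proof.
apply/allP => i _; apply/allP => k _.
suff -> : sumn (take k (drop i (nseq n 0%N))) = 0%N by [].
apply/eqP; rewrite -leqn0; apply: leq_trans (sumn_take_le _ _) _.
by rewrite drop_nseq sumn_nseq.
Qed.

Lemma lang_card_ge1 n : 1 <= L n.
Proof.
rewrite /L /count_words (bigD1_seq (nseq n 0%N)) ?uniq_words //=; last first.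
  by rewrite mem_words size_nseq eqxx all_nseq orbT.
by rewrite lang_nseq0 lerDl sumr_ge0.
Qed.

Lemma lang_card_gt0 n : 0 < L n.
Proof. exact: lt_le_trans (lang_card_ge1 n). Qed.

Lemma lang_cardD n k : L (n + k) <= L n * L k.
Proof.
apply: le_count_words_cat => x y _ _ h.
by rewrite (lang_catl f_homo f_ge0 h) (lang_catr f_homo f_ge0 h).
Qed.

Lemma growth_cvg :
  ((fun n => ln (L n) / n%:R) @ \oo --> limn (fun n => ln (L n) / n%:R)) /\
  (forall n, limn (fun n => ln (L n) / n%:R) * n%:R <= ln (L n)).
Proof.
apply: fekete => [n|n k]; first exact: ln_ge0 (lang_card_ge1 n).
by rewrite -lnM ?posrE ?lang_card_gt0 // ler_ln ?posrE ?mulr_gt0 ?lang_card_gt0 ?lang_cardD.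
Qed.

Lemma growth_gt0 : 0 < lam. Proof. exact: expR_gt0. Qed.

Lemma growth_le n : lam ^+ n <= L n.
Proof.
rewrite -expRM_natr -[L n]lnK ?posrE ?lang_card_gt0 // ler_expR; exact: growth_cvg.2.
Qed.

Lemma growth_ge1 : 1 <= lam.
Proof.
rewrite -expR0 ler_expR; apply: limr_ge; first by apply/cvg_ex; eexists; exact: growth_cvg.1.
by apply: nearW => n; rewrite divr_ge0 // ln_ge0 // lang_card_ge1.
Qed.

(** A provisional bound: cuts will turn the factor [s ^+ n] into a constant. *)
Lemma lang_card_subexp (s : R) : 1 < s ->
  exists2 C, 0 < C & forall n, L n <= C * (lam ^+ n * s ^+ n).
Proof.
move=> s1; have s0 : 0 < s by lra.
have /cvgrPdist_le/(_ (ln s) (ln_gt0 s1)) [N _ hN] := growth_cvg.1.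
exists (1 + \sum_(r < N.+1) L r) => [|n].
  by rewrite ltr_pwDl // sumr_ge0 // => i _; exact: ltW (lang_card_gt0 _).
set S := \sum_(_ < _) _.
have S0 : 0 <= S by rewrite sumr_ge0 // => i _; exact: ltW (lang_card_gt0 _).
have ls1 : 1 <= lam ^+ n * s ^+ n.
  by rewrite -exprMn exprn_ege1 // mulr_ege1 ?growth_ge1 ?ltW.
have [hn|hn] := ltnP n N.+1.
  have : L n <= S.
    rewrite /S (bigD1 (Ordinal hn)) //= lerDl sumr_ge0 // => i _; exact: ltW (lang_card_gt0 _).
  nra.
have n0 : 0 < n%:R :> R by rewrite ltr0n; lia.
have := hN n (ltnW hn); rewrite /= ler_norml => /andP[h _].
have {}h : ln (L n) <= limn (fun n => ln (L n) / n%:R) * n%:R + ln s * n%:R.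
  by rewrite -mulrDl -ler_pdivrMr //; lra.
suff : L n <= lam ^+ n * s ^+ n by nra.
have -> : lam ^+ n * s ^+ n =
    expR (limn (fun n => ln (L n) / n%:R) * n%:R + ln s * n%:R).
  by rewrite expRD !expRM_natr lnK ?posrE.
by rewrite -[L n]lnK ?posrE ?lang_card_gt0 // ler_expR.
Qed.

End Growth.

(** * Words of high density are rare *)

Section HighDensity.
Variables (R : realType) (m : nat).
Let c (i : nat) : R := i%:R / i.+1%:R.
Let beta0 : R := \sum_(1 <= i < m.+1) c i.

Let c_ge0 i : 0 <= c i. Proof. by rewrite divr_ge0. Qed.

Lemma sum_ratio_bounds : 0 <= beta0 <= m%:R.
Proof.
rewrite sumr_ge0 //=; apply: le_trans (_ : \sum_(1 <= i < m.+1) 1 <= _).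
  by apply: ler_sum => i _; rewrite ler_pdivrMr ?ltr0n // mul1r ler_nat.
by rewrite sumr_const_nat subSS subn0.
Qed.

Variable theta : R.
Hypothesis theta_ge0 : 0 <= theta.
Hypothesis theta_le : theta * m%:R <= 1.

(** Weight sent by the letter [a] to the letter [b]. Each of the [a] smaller
    letters gets [theta * (a / (a + 1))], and what [a] keeps is chosen so that
    every letter receives a total weight of 1. *)
Definition lowering (a b : nat) : R :=
  if (b < a)%N then theta * c a
  else if a == b then 1 - theta * \sum_(a.+1 <= i < m.+1) c i else 0.

Lemma lowering_ge0 a b : 0 <= lowering a b.
Proof.
rewrite /lowering; case: ifP => _; first by rewrite mulr_ge0.
case: ifP => // _; rewrite subr_ge0; apply: le_trans theta_le.
rewrite ler_wpM2l //; have /andP[_] := sum_ratio_bounds; apply: le_trans.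
have [h|h] := leqP a.+1 m.+1; last by rewrite big_geq ?sumr_ge0 // ltnW.
by rewrite /beta0 [leRHS](big_cat_nat _ (n := a.+1)) //= lerDr sumr_ge0.
Qed.

Lemma lowering_col b : (b <= m)%N -> \sum_(a <- letters m) lowering a b = 1.
Proof.
move=> hb; rewrite /letters -[iota 0 _]/(index_iota 0 m.+1).
rewrite (big_cat_nat _ (n := b)) ?leqW //= big_nat big1 => [|i /andP[_ hi]]; last first.
  by rewrite /lowering ltnNge (ltnW hi) /= (ltn_eqF hi).
rewrite add0r big_ltn // {1}/lowering ltnn eqxx mulr_sumr -[RHS](subrK (\sum_(b.+1 <= i < m.+1) theta * c i)).
by congr (_ + _); rewrite !big_nat; apply: eq_bigr => i /andP[hi _]; rewrite /lowering hi.
Qed.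

(** The [a] smaller letters receive [a * (a / (a + 1)) = a - a / (a + 1)], up to
    the factor [theta], while [a] keeps 1 minus the ratios above it: what is
    lost is a part of the sum of all ratios. *)
Lemma lowering_row a : (a <= m)%N ->
  1 + theta * (a%:R - beta0) <= \sum_(b <- letters m) lowering a b.
Proof.
move=> ha; rewrite /letters -[iota 0 _]/(index_iota 0 m.+1).
rewrite (big_cat_nat _ (n := a)) ?leqW //= [X in _ <= _ + X]big_ltn // [X in _ <= _ + (_ + X)]big_nat.
rewrite [X in _ <= _ + (_ + X)]big1 => [|i /andP[hi _]]; last first.
  by rewrite /lowering ltnNge (ltnW hi) /= eq_sym (gtn_eqF hi).
rewrite {2}/lowering ltnn eqxx addr0 big_nat.
under eq_bigr => i /andP[_ hi] do rewrite /lowering hi.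
rewrite -big_nat sumr_const_nat subn0.
have aE : theta * c a *+ a = theta * (a%:R - c a).
  rewrite -mulr_natr -mulrA; congr (_ * _); rewrite /c -natr1; field.
  by rewrite natr1 pnatr_eq0.
rewrite aE.
suff h : c a + \sum_(a.+1 <= i < m.+1) c i <= beta0.
  have : 0 <= theta * (beta0 - (c a + \sum_(a.+1 <= i < m.+1) c i)).
    by rewrite mulr_ge0 // subr_ge0.
  by rewrite !mulrBr !mulrDr; lra.
have [->|a0] := posnP a; first by rewrite /c mul0r add0r.
by rewrite -big_ltn // /beta0 [leRHS](big_cat_nat _ (n := a)) ?leqW //= lerDr sumr_ge0.
Qed.

Fixpoint word_lowering u v : R :=
  match u, v with
  | [::], [::] => 1
  | a :: u', b :: v' => lowering a b * word_lowering u' v'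
  | _, _ => 0
  end.

Lemma word_lowering_ge0 u v : 0 <= word_lowering u v.
Proof. by elim: u v => [|a u IH] [|b v] //=; rewrite mulr_ge0 ?lowering_ge0. Qed.

Lemma word_lowering_below u v : ~~ below v u -> word_lowering u v = 0.
Proof.
elim: u v => [|a u IH] [|b v] //=; rewrite negb_and => /orP[h|/IH ->]; last by rewrite mulr0.
by rewrite /lowering; case: ltngtP h => //; rewrite mul0r.
Qed.

Lemma word_lowering_col n v : v \in words m n -> \sum_(u <- words m n) word_lowering u v = 1.
Proof.
elim: n v => [|n IH] [|b v]; rewrite mem_words //= ?big_seq1 //.
rewrite eqSS => /and3P[hs hb hv]; rewrite big_wordsS.
under eq_bigr => a _ do rewrite /= -mulr_sumr IH ?mem_words ?hs // mulr1.
exact: lowering_col.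
Qed.

Lemma word_lowering_row n u : u \in words m n ->
  \sum_(v <- words m n) word_lowering u v = \prod_(a <- u) \sum_(b <- letters m) lowering a b.
Proof.
elim: n u => [|n IH] [|a u]; rewrite mem_words //= ?big_seq1 ?big_nil //.
rewrite eqSS => /and3P[hs ha hu]; rewrite big_wordsS big_cons mulr_suml.
by apply: eq_bigr => b _; rewrite -(IH u) ?mem_words ?hs // mulr_sumr.
Qed.

(** The weight that leaves a word of a hereditary set stays in this set, where
    each word receives a total weight of at most 1. *)
Lemma weighted_count_le n (P : pred (seq nat)) :
  (forall u v, below u v -> P v -> P u) ->
  \sum_(u <- words m n) (P u)%:R * \prod_(a <- u) \sum_(b <- letters m) lowering a b
    <= count_words m R n P.
Proof.
move=> hP.
have -> : count_words m R n P =
    \sum_(u <- words m n) \sum_(v <- words m n) (P v)%:R * word_lowering u v.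
  rewrite exchange_big /= /count_words !big_seq; apply: eq_bigr => v hv.
  by rewrite -mulr_sumr word_lowering_col // mulr1.
rewrite !big_seq; apply: ler_sum => u hu.
rewrite -(word_lowering_row hu) mulr_sumr; apply: ler_sum => v _.
case hb : (below v u); last by rewrite word_lowering_below ?hb // !mulr0.
by rewrite ler_wpM2r ?word_lowering_ge0 // ler_nat; case hu' : (P u) => //; rewrite (hP _ _ hb hu').
Qed.

End HighDensity.

Lemma expR_le_1D (R : realType) (y : R) : - (1 / 2) <= y -> expR (y - 2 * y ^+ 2) <= 1 + y.
Proof.
move=> hy; have y1 : 0 < 1 + y by lra.
have h := expR_ge1Dx (- (y / (1 + y))).
have e : 1 - y / (1 + y) = (1 + y)^-1 by field; lra.
rewrite e expRN lef_pV2 ?posrE ?expR_gt0 // in h.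
apply: le_trans h; rewrite ler_expR ler_pdivlMr //; nra.
Qed.

(** Each letter [a] of a word multiplies the weight that it sends out by about
    [1 + theta * (a - b0)], where [b0] is the sum of the [i / (i + 1)]. A word of
    density above [b0] thus sends out an exponentially large weight, while the
    whole set receives at most its cardinality. *)
Lemma high_density_rare (R : realType) (m : nat) (beta : R) : (0 < m)%N ->
  \sum_(1 <= i < m.+1) (i%:R / i.+1%:R) < beta ->
  exists2 delta : R, 0 < delta &
  forall (n : nat) (P : pred (seq nat)), (forall u v, below u v -> P v -> P u) ->
    count_words m R n (fun u => P u && (beta * n%:R <= (sumn u)%:R))
      <= count_words m R n P * expR (- (delta * n%:R)).
Proof.
move=> m0; set b0 : R := \sum_(_ <= _ < _) _ => hb.
have /andP[b00 b0m] := sum_ratio_bounds R m; rewrite -/b0 in b00 b0m.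
have mR : 1 <= m%:R :> R by rewrite ler1n.
(* The first bound keeps the kernel nonnegative, the second one makes the
   quadratic error of [expR_le_1D] at most half of the linear gain. *)
pose theta : R := Num.min (1 / (2 * m%:R)) ((beta - b0) / (4 * m%:R ^+ 2)).
have t0 : 0 < theta by rewrite lt_min !divr_gt0 //; nra.
have tm : theta * m%:R <= 1 / 2.
  have h : theta <= 1 / (2 * m%:R) by rewrite ge_min lexx.
  apply: le_trans (ler_wpM2r _ h) _; first by lra.
  by rewrite (_ : 1 / (2 * m%:R) * m%:R = 1 / 2) //; field; lra.
have tm2 : theta * m%:R ^+ 2 <= (beta - b0) / 4.
  have h : theta <= (beta - b0) / (4 * m%:R ^+ 2) by rewrite ge_min lexx orbT.
  apply: le_trans (ler_wpM2r _ h) _; first by nra.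
  by rewrite [leLHS](_ : _ = (beta - b0) / 4) //; field; lra.
exists (theta * ((beta - b0) / 2)); first by rewrite mulr_gt0 //; lra.
set delta := theta * _ => n P hP.
have tle1 : theta * m%:R <= 1 by lra.
apply: le_trans (_ : (\sum_(u <- words m n)
    (P u)%:R * \prod_(a <- u) \sum_(b <- letters m) lowering m theta a b) *
    expR (- (delta * n%:R)) <= _); last first.
  by rewrite ler_wpM2r ?expR_ge0 // weighted_count_le // ltW.
rewrite /count_words mulr_suml !big_seq; apply: ler_sum => u hu.
have prod0 : 0 <= \prod_(a <- u) \sum_(b <- letters m) lowering m theta a b.
  by apply: prodr_ge0 => a _; apply: sumr_ge0 => b _; apply: lowering_ge0 => //; exact: ltW.
case: (P u) => /=; last by rewrite !mul0r.
case: (lerP (beta * n%:R) _) => [hs|_]; last by rewrite !mulr_ge0 ?expR_ge0.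
rewrite !mul1r.
rewrite expRN ler_pdivlMr ?expR_gt0 // mul1r.
apply: le_trans (_ : expR (\sum_(a <- u) (theta * (a%:R - b0) - 2 * (theta * m%:R) ^+ 2)) <= _).
  rewrite ler_expR sumrB -mulr_sumr sumrB !big_const_seq !count_predT !iter_addr_0 (size_words hu).
  have -> : \sum_(a <- u) a%:R = (sumn u)%:R :> R by rewrite sumnE natr_sum.
  rewrite -[b0 *+ n]mulr_natr -[(2 * _) *+ n]mulr_natr /delta.
  have n0 : 0 <= n%:R :> R by [].
  have : 0 <= theta * ((sumn u)%:R - beta * n%:R) by rewrite mulr_ge0 ?subr_ge0 // ltW.
  have : 0 <= theta * n%:R * ((beta - b0) / 4 - theta * m%:R ^+ 2).
    by rewrite mulr_ge0 ?subr_ge0 // mulr_ge0 // ltW.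
  move: (n%:R : R) (m%:R : R) (_%:R : R) => x y z; lra.
rewrite expR_sum !big_seq; apply: ler_prod => a ha; rewrite expR_ge0 /=.
have ham : (a <= m)%N by move: hu; rewrite mem_words => /andP[_ /allP]; apply.
apply: le_trans (lowering_row (ltW t0) ham); rewrite -/b0.
have aR : a%:R <= m%:R :> R by rewrite ler_nat.
have a0 : 0 <= a%:R :> R by [].
have h1 : - (theta * m%:R) <= theta * (a%:R - b0) by rewrite -mulrN ler_pM2l //; lra.
have h2 : theta * (a%:R - b0) <= theta * m%:R by rewrite ler_pM2l //; lra.
apply: le_trans (expR_le_1D _); last by lra.
by rewrite ler_expR lerD2l lerN2 ler_pM2l //; nra.
Qed.

(** * Tall positions are rare *)

Section Geometric.
Variable R : realType.

Lemma geometric_tail (x : R) a b : 0 <= x < 1 ->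
  \sum_(a <= j < b) x ^+ j <= x ^+ a / (1 - x).
Proof.
move=> /andP[x0 x1]; have d0 : 0 < 1 - x by lra.
have [hab|hab] := leqP a b; last by rewrite big_geq ?(ltnW hab) // divr_ge0 ?exprn_ge0 // ltW.
rewrite ler_pdivlMr // -(subnKC hab); elim: (b - a)%N => [|k IH].
  by rewrite addn0 big_geq // mul0r exprn_ge0.
suff e n : (\sum_(a <= j < a + n) x ^+ j) * (1 - x) = x ^+ a - x ^+ (a + n).
  by rewrite e gerBl exprn_ge0.
elim: n => [|n IHn]; first by rewrite addn0 big_geq // mul0r subrr.
by rewrite addnS big_nat_recr ?leq_addr //= mulrDl IHn exprS; lra.
Qed.

Lemma geometric_small (x C e : R) : 0 <= x < 1 -> 0 < e -> 0 <= C ->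
  exists N, C * x ^+ N <= e.
Proof.
move=> /andP[x0 x1] e0 C0.
have C1 : 0 < C + 1 by lra.
have cx : x ^+ n @[n --> \oo] --> 0 by apply: cvg_expr; rewrite ger0_norm.
have /cvgrPdist_le/(_ _ (divr_gt0 e0 C1)) [N _ /(_ N (leqnn _))] := cx; rewrite /= sub0r normrN normrX ger0_norm //.
rewrite ler_pdivlMr // => h; exists N.
have : 0 <= x ^+ N by rewrite exprn_ge0.
nra.
Qed.

End Geometric.

Section Tall.
Variables (R : realType) (m : nat) (f : nat -> R) (beta T : R) (N0 : nat).
Hypothesis f_homo : {homo f : i j / (i <= j)%N >-> i <= j}.
Hypothesis f_ge0 : forall k, 0 <= f k.
Hypothesis beta_ge0 : 0 <= beta.
Hypothesis TE : T = (m * N0)%:R.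

Definition tall u := ~~ prefix_bounded (line beta T) u.

Fixpoint tall_count u : nat :=
  if u is c :: u' then tall u + tall_count u' else 0.

Definition dense u := beta * (size u)%:R <= (sumn u)%:R.

Lemma tall_count_drop u j : (tall_count u <= j + tall_count (drop j u))%N.
Proof.
elim: u j => [|c u IH] [|j] //; rewrite ?drop0 ?add0n //.
by rewrite [tall_count _]/= [drop _ _]/= addSn; have := IH j; case: (tall _) => /=; lia.
Qed.

Lemma sumn_words n u : u \in words m n -> (sumn u <= m * n)%N.
Proof.
elim: n u => [|n IH] [|c u]; rewrite mem_words //= eqSS => /and3P[hs hc hu].
by rewrite mulnS leq_add // IH // mem_words hs.
Qed.

Lemma words_take n u k : u \in words m n -> take k u \in words m (minn k n).
Proof.
rewrite !mem_words size_take_min => /andP[/eqP -> /allP h]; rewrite eqxx.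
by apply/allP => c /mem_take /h.
Qed.

(** A tall position starts a long dense factor; the positions covered by it
    are charged to its length. *)
Lemma tall_count_dense n u : u \in words m n -> tall_count u = 0%N \/
  exists i j, [/\ (i + j <= n)%N, (N0 <= j)%N, dense (take j (drop i u)) &
    (tall_count u <= j + tall_count (drop (i + j) u))%N].
Proof.
elim: n u => [|n IH] [|c u] hu; try by [left | move: hu; rewrite mem_words].
have [ht|ht] := boolP (tall (c :: u)); last first.
  have hu' : u \in words m n.
    by move: hu; rewrite !mem_words /= eqSS => /and3P[-> _ ->].
  rewrite [tall_count _]/= (negbTE ht) add0n.
  have [->|[i [j [h1 h2 h3 h4]]]] := IH u hu'; first by left.
  by right; exists i.+1, j; split => //; rewrite addSn.
right; exists 0%N; move/allPn: ht => [j hj]; rewrite -ltNge /line => hT.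
rewrite mem_iota add0n ltnS /= in hj.
have sz := size_words hu; rewrite /= in sz.
have jn : (j <= n.+1)%N by rewrite -sz.
exists j; rewrite add0n; split => //.
- have := sumn_words (words_take j hu); rewrite (minn_idPl jn) => hs.
  have : T < (m * j)%:R.
    rewrite -(ler_nat R) in hs; apply: lt_le_trans hs; apply: le_lt_trans hT.
    by rewrite lerDr mulr_ge0.
  by rewrite TE ltr_nat ltn_mul2l => /andP[_ /ltnW].
- rewrite /dense size_takel ?[size _]/= ?sz //; apply: le_trans (ltW hT).
  by rewrite lerDl TE.
- exact: (tall_count_drop (c :: u)).
Qed.

Local Notation L := (lang_card m f).

Section Weighted.
Variable w : R.
Hypothesis w_ge1 : 1 <= w.

Definition tall_weight n := \sum_(u <- words m n) (lang f u)%:R * w ^+ tall_count u.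

Definition dense_card n := count_words m R n (fun u => lang f u && dense u).

Lemma tall_weight_ge0 n : 0 <= tall_weight n.
Proof. by apply: sumr_ge0 => u _; rewrite mulr_ge0 // exprn_ge0 //; exact: le_trans ler01 w_ge1. Qed.

(** A word is split at its first tall position: a word of the language, the dense
    factor that starts there, and a remainder. The weight of the dense factor is
    at most [w] to its length. *)
Lemma tall_weight_rec n :
  tall_weight n <= L n + \sum_(i < n.+1) \sum_(j < n.+1 | (N0 <= j)%N && (i + j <= n)%N)
    L i * (dense_card j * w ^+ j) * tall_weight (n - (i + j)).
Proof.
have w0 : 0 <= w by exact: le_trans ler01 w_ge1.
apply: le_trans (_ : \sum_(u <- words m n) ((lang f u)%:R +
  \sum_(i < n.+1) \sum_(j < n.+1 | (N0 <= j)%N && (i + j <= n)%N)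
   (lang f u)%:R * ((dense (take j (drop i u)))%:R * w ^+ j * w ^+ tall_count (drop (i + j) u))) <= _).
  rewrite /tall_weight !big_seq; apply: ler_sum => u hu.
  have pos (i j : 'I_n.+1) : 0 <= (lang f u)%:R * ((dense (take j (drop i u)))%:R * w ^+ j * w ^+ tall_count (drop (i + j) u)).
    by rewrite !mulr_ge0 // ?exprn_ge0.
  have [->|[i [j [h1 h2 h3 h4]]]] := tall_count_dense hu.
    by rewrite expr0 mulr1 lerDl; apply: sumr_ge0 => i _; apply: sumr_ge0.
  have hi : (i < n.+1)%N by lia.
  have hj : (j < n.+1)%N by lia.
  apply: le_trans (_ : (lang f u)%:R * ((dense (take j (drop i u)))%:R * w ^+ j * w ^+ tall_count (drop (i + j) u)) <= _).
    by rewrite h3 mul1r -exprD ler_wpM2l // ler_weXn2l.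
  rewrite ler_wpDl // (bigD1 (Ordinal hi)) //= (bigD1 (Ordinal hj)) /= ?h2 //.
  rewrite -addrA lerDl; apply: addr_ge0; apply: sumr_ge0 => k _; first exact: (pos (Ordinal hi)).
  by apply: sumr_ge0 => l _; exact: pos.
rewrite big_split /= lerD2l exchange_big /=; apply: ler_sum => i _.
rewrite exchange_big /=; apply: ler_sum => j /andP[_ hij].
have e : n = (i + (j + (n - (i + j))))%N by lia.
rewrite {1}e big_words_cat -mulrA /lang_card {1}/count_words mulr_suml !big_seq.
apply: ler_sum => x /size_words hx; rewrite big_words_cat -mulrA /dense_card /count_words mulr_suml mulr_sumr.
rewrite !big_seq; apply: ler_sum => y /size_words hy.
rewrite /tall_weight !mulr_sumr; apply: ler_sum => z _.
rewrite drop_size_cat // take_size_cat // [in drop _ _]catA drop_size_cat ?size_cat ?hx ?hy //.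
case hl : (lang f (x ++ y ++ z)); last by rewrite mul0r !mulr_ge0 // ?exprn_ge0.
have hyz := lang_catr f_homo f_ge0 hl.
rewrite (lang_catl f_homo f_ge0 hl) (lang_catl f_homo f_ge0 hyz) (lang_catr f_homo f_ge0 hyz) !mul1r /=.
by rewrite mulrA.
Qed.

End Weighted.
End Tall.

(** The strong induction behind the bound on the weighted count: a renewal
    inequality whose kernel has total mass at most 1/2. *)
Lemma renewal_inequality_bounded (R : realType) (F : R) (N0 : nat) (x t a b : nat -> R) :
  (forall n, 0 <= t n) -> (forall n, 0 <= a n) -> (forall n, 0 <= b n) -> 0 < F ->
  (forall n, \sum_(i < n.+1) a i <= F) ->
  (forall n, \sum_(j < n.+1 | (N0 <= j)%N) b j <= (2 * F)^-1) ->
  (forall n, x n <= F) -> (0 < N0)%N ->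
  (forall n, t n <= x n + \sum_(i < n.+1) \sum_(j < n.+1 | (N0 <= j)%N && (i + j <= n)%N)
     a i * b j * t (n - (i + j))%N) ->
  forall n, t n <= 2 * F.
Proof.
move=> t0 a0 b0 F0 ha hb hx N00 ht n.
elim/ltn_ind: n => n IH; apply: le_trans (ht n) _.
suff : \sum_(i < n.+1) \sum_(j < n.+1 | (N0 <= j)%N && (i + j <= n)%N)
     a i * b j * t (n - (i + j))%N <= F by have := hx n; lra.
apply: le_trans (_ : \sum_(i < n.+1) a i * ((2 * F)^-1 * (2 * F)) <= _); last first.
  by rewrite mulVf ?mulr_suml ?mulr1 -?mulr_suml ?mulr1 ?ha //; lra.
apply: ler_sum => i _; rewrite mulrA.
apply: le_trans (_ : \sum_(j < n.+1 | (N0 <= j)%N) a i * b j * (2 * F) <= _); last first.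
  by rewrite -mulr_suml -mulr_sumr ler_wpM2r ?ler_wpM2l //; lra.
rewrite big_mkcondr; apply: ler_sum => j hj.
have ab0 : 0 <= a i * b j by rewrite mulr_ge0.
case: ifP => hij; last by rewrite mulr_ge0 //; lra.
by rewrite ler_wpM2l // IH //; lia.
Qed.

Section TallRare.
Variables (R : realType) (m : nat) (f : nat -> R) (beta : R).
Hypothesis m_gt0 : (0 < m)%N.
Hypothesis f_homo : {homo f : i j / (i <= j)%N >-> i <= j}.
Hypothesis f_ge0 : forall k, 0 <= f k.
Hypothesis beta_gt : \sum_(1 <= i < m.+1) (i%:R / i.+1%:R) < beta.
Local Notation L := (lang_card m f).
Local Notation lam := (growth m f).

(** Dense factors are exponentially rare, and those that start at a tall position
    have length at least [N0]. For [N0] large, the kernel of the renewal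
    inequality for the weighted count is therefore small; a bound on the weighted
    count gives one on the number of words with many tall positions. *)
Lemma tall_rare : exists N0 : nat, exists C q : R,
  [/\ 0 <= C, 0 < q < 1 & forall n,
   count_words m R n (fun u => lang f u && (n <= 4 * tall_count beta (m * N0)%:R u)%N)
     <= C * (lam ^+ n * q ^+ n)].
Proof.
have [delta d0 hd] := high_density_rare m_gt0 beta_gt.
have beta0 : 0 <= beta.
  by apply: le_trans (ltW beta_gt); apply: sumr_ge0 => i _; rewrite divr_ge0.
(* With [w = r ^+ 12], the weight [w ^+ j] of a dense factor of length [j] is
   compensated by its rarity. A word with [n / 4] tall positions has weight
   [r ^+ (3 * n)], which beats the growth [mu = lam * r ^+ 2] allowed below. *)
pose r : R := expR (delta / 12).
have r1 : 1 < r by rewrite expR_gt1 divr_gt0.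
have r0 : 0 < r by exact: lt_trans ltr01 r1.
pose w := r ^+ 12.
have w1 : 1 <= w by rewrite exprn_ege1 // ltW.
have w0 : 0 < w by rewrite exprn_gt0.
have lam0 := growth_gt0 m f.
have dense_le j : dense_card m f beta j * w ^+ j <= L j.
  apply: le_trans (ler_wpM2r (exprn_ge0 _ (ltW w0)) _) _.
  - apply: le_trans (hd j (lang f) (fun u v => @lang_below R f f_homo f_ge0 u v)).
    by apply: le_count_words => u /size_words hs; rewrite /dense hs.
  - rewrite -mulrA ler_piMr ?(ltW (lang_card_gt0 m f_ge0 j)) //.
    rewrite /w /r -!expRM_natr -expRD; apply: le_trans (_ : expR 0 <= _); last by rewrite expR0.
    by rewrite ler_expR; lra.
have [C C0 hC] := lang_card_subexp m f_homo f_ge0 r1.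
pose y := r^-1; have y01 : 0 <= y < 1 by rewrite invr_ge0 ltW //= invf_lt1.
have /andP[y0 y1] := y01.
pose mu := lam * r ^+ 2.
have mu0 : 0 < mu by rewrite mulr_gt0 // exprn_gt0.
have Lmu n : L n / mu ^+ n <= C * y ^+ n.
  rewrite ler_pdivrMr ?exprn_gt0 //; apply: le_trans (hC n) _.
  rewrite -mulrA ler_pM2l // /mu /y exprMn exprVn -exprM mulnC exprM expr2.
  by rewrite mulrCA mulKf // expf_neq0 // gt_eqF.
pose F := C / (1 - y).
have F0 : 0 < F by rewrite divr_gt0 // subr_gt0.
have [N hN] := @geometric_small R y (C / (1 - y)) ((2 * F)^-1) y01
   ltac:(by rewrite invr_gt0 mulr_gt0) (ltW F0).
exists N.+1, (2 * F), y; split; [lra|by rewrite invr_gt0 r0|move=> n].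
pose t k := tall_weight m f beta (m * N.+1)%:R w k / mu ^+ k.
have tF : forall k, t k <= 2 * F.
  apply: (@renewal_inequality_bounded R F N.+1 (fun k => L k / mu ^+ k) t
    (fun k => L k / mu ^+ k) (fun k => dense_card m f beta k * w ^+ k / mu ^+ k)) => //.
  - by move=> k; rewrite divr_ge0 ?tall_weight_ge0 // exprn_ge0 // ltW.
  - by move=> k; rewrite divr_ge0 ?(ltW (lang_card_gt0 _ _ _)) // exprn_ge0 // ltW.
  - by move=> k; rewrite divr_ge0 ?mulr_ge0 ?count_words_ge0 // exprn_ge0 // ltW.
  - move=> k; apply: le_trans (_ : \sum_(i < k.+1) C * y ^+ i <= _).
      by apply: ler_sum => i _; exact: Lmu.
    rewrite -mulr_sumr -(big_mkord xpredT (fun i => y ^+ i)) /F ler_pM2l //.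
    by apply: le_trans (geometric_tail _ _ y01) _; rewrite expr0 mul1r.
  - move=> k; apply: le_trans (_ : \sum_(j < k.+1 | (N.+1 <= j)%N) C * y ^+ j <= _).
      apply: ler_sum => j _; apply: le_trans (Lmu j).
      by rewrite ler_wpM2r // invr_ge0 exprn_ge0 // ltW.
    rewrite -mulr_sumr -(big_mkord (fun j => N.+1 <= j)%N (fun i => y ^+ i)).
    rewrite (_ : \sum_(0 <= i < k.+1 | (N < i)%N) y ^+ i = \sum_(N.+1 <= i < k.+1) y ^+ i); last first.
      by rewrite [RHS](big_nat_widenl _ 0).
    apply: le_trans (ler_wpM2l (ltW C0) (geometric_tail _ _ y01)) _.
    apply: le_trans hN; rewrite mulrCA mulrA [leRHS]mulrAC ler_pM2r ?invr_gt0 ?subr_gt0 //.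
    by rewrite mulrC ler_pM2l // exprS ler_piMl ?exprn_ge0 // ltW.
  - move=> k; apply: le_trans (_ : L k / mu ^+ k <= _).
      exact: lexx.
    apply: le_trans (Lmu k) _; rewrite /F ler_pM2l //.
    by apply: le_trans (_ : 1 <= _); rewrite ?exprn_ile1 ?invf_ge1 ?subr_gt0 ?gerBl // ltW.
  - move=> k; rewrite /t ler_pdivrMr ?exprn_gt0 // mulrDl divfK ?gt_eqF ?exprn_gt0 //.
    apply: le_trans (@tall_weight_rec R m f beta (m * N.+1)%:R N.+1 f_homo f_ge0 beta0 erefl w w1 k) _.
    rewrite lerD2l mulr_suml; apply: ler_sum => i _; rewrite mulr_suml; apply: ler_sum => j /andP[_ hij].
    have -> : mu ^+ k = mu ^+ i * (mu ^+ j * mu ^+ (k - (i + j))).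
      by rewrite -!exprD addnA subnKC.
    set p := mu ^+ i; set q := mu ^+ j; set s := mu ^+ (k - (i + j)).
    have p0 : p != 0 by rewrite gt_eqF // exprn_gt0.
    have q0 : q != 0 by rewrite gt_eqF // exprn_gt0.
    have s0 : s != 0 by rewrite gt_eqF // exprn_gt0.
    by rewrite le_eqVlt; apply/orP; left; apply/eqP; field; rewrite p0 q0 s0.
have hr : count_words m R n (fun u => lang f u && (n <= 4 * tall_count beta (m * N.+1)%:R u)%N)
    * r ^+ (3 * n) <= tall_weight m f beta (m * N.+1)%:R w n.
  rewrite /count_words mulr_suml; apply: ler_sum => u _.
  case: (lang f u); last by rewrite !mul0r.
  case: leqP => h; rewrite /= ?mul0r ?mul1r ?exprn_ge0 ?(ltW w0) ?(ltW r0) //.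
  by rewrite /w -exprM; apply: ler_weXn2l; [exact: ltW|clear -h; lia].
have := tF n; rewrite /t ler_pdivrMr ?exprn_gt0 // => /(le_trans hr).
rewrite -ler_pdivlMr ?exprn_gt0 //; move=> h; apply: le_trans h _.
have e : mu ^+ n = (lam ^+ n * y ^+ n) * r ^+ (3 * n).
  rewrite /mu exprMn -mulrA; congr (_ * _); rewrite /y exprVn -exprM.
  by rewrite (_ : 3 * n = n + 2 * n)%N; [rewrite exprD mulKf // expf_neq0 // gt_eqF|clear; lia].
by rewrite e [_ * (_ * r ^+ _)]mulrA mulfK // expf_neq0 // gt_eqF.
Qed.

End TallRare.

(** * Words without a cut are rare *)

Ltac lia_nat := try match goal with r : realType |- _ =>
  repeat match goal with H : context [r] |- _ => clear H end end; lia.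

Section Erasure.
Implicit Types (d : seq bool) (u v : seq nat).

Fixpoint erase d u : seq nat :=
  match d, u with
  | b :: d', c :: u' => (if b then 0%N else c) :: erase d' u'
  | _, _ => u
  end.

Lemma size_erase d u : size (erase d u) = size u.
Proof. by elim: d u => [|b d IH] [|c u] //=; rewrite IH. Qed.

Lemma erase_below d u : below (erase d u) u.
Proof.
have refl v : below v v by elim: v => //= c v ->; rewrite leqnn.
by elim: d u => [|b d IH] [|c u] //=; [rewrite leqnn refl|rewrite IH; case: b; rewrite ?leqnn].
Qed.

Lemma erase_words m n d u : u \in words m n -> erase d u \in words m n.
Proof.
elim: d n u => [|b d IH] [|n] [|c u] //; rewrite !mem_words /= eqSS => /and3P[hs hc hu].
have := IH n u; rewrite !mem_words hs hu eqSS => /(_ isT) /andP[-> ->].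
by case: b; rewrite ?leq0n ?hc.
Qed.

Lemma nth_erase d u j : nth 0%N (erase d u) j = if nth false d j then 0%N else nth 0%N u j.
Proof.
elim: d u j => [|b d IH] [|c u] [|j] //=; rewrite ?nth_nil //; first by case: b.
by case: ifP.
Qed.

Lemma erase_drop k d u : erase (drop k d) (drop k u) = drop k (erase d u).
Proof. by elim: k d u => [|k IH] [|b d] [|c u] //=; case: drop. Qed.

Lemma erase_take k d u : erase (take k d) (take k u) = take k (erase d u).
Proof. by elim: k d u => [|k IH] [|b d] [|c u] //=; rewrite IH. Qed.

Lemma erase_rcons d u b c : size d = size u ->
  erase (rcons d b) (rcons u c) = rcons (erase d u) (if b then 0%N else c).
Proof. by elim: d u => [|a d IH] [|e u] //= [/IH ->]. Qed.

Lemma erase_rev d u : size d = size u -> erase (rev d) (rev u) = rev (erase d u).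
Proof.
elim: d u => [|b d IH] [|c u] //= [h]; rewrite !rev_cons erase_rcons ?size_rev //.
by rewrite IH.
Qed.

Lemma sumn_erase m d u : all (fun c => c <= m)%N u ->
  (sumn u <= sumn (erase d u) + m * count id d)%N.
Proof.
elim: d u => [|b d IH] [|c u] //=; first by rewrite muln0 addn0.
move=> /andP[hc /IH h]; case: b => /=; last by rewrite -addnA leq_add2l.
by rewrite add0n mulnDr muln1 addnCA leq_add.
Qed.

(** A word is known from its erasure up to the erased letters. *)
Lemma count_erase (R : realType) m d v : size d = size v ->
  \sum_(u <- words m (size v)) (erase d u == v)%:R <= (m.+1%:R ^+ count id d : R).
Proof.
elim: d v => [|b d IH] [|e v] //; first by rewrite big_words0.
case=> h; rewrite big_wordsS [count _ _]/= exprD.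
have e1 c : \sum_(u <- words m (size v)) ((erase (b :: d) (c :: u) == e :: v)%:R : R) =
    ((if b then 0%N else c) == e)%:R * \sum_(u <- words m (size v)) (erase d u == v)%:R.
  by rewrite mulr_sumr; apply: eq_bigr => u _; rewrite /= eqseq_cons -natrM mulnb.
under eq_bigr => c _ do rewrite e1.
rewrite -mulr_suml; apply: ler_pM => //; [exact: sumr_ge0|exact: sumr_ge0| |exact: IH].
case: b {e1} => /=.
  rewrite expr1; apply: le_trans (_ : \sum_(c <- letters m) 1 <= _).
    by apply: ler_sum => c _; rewrite lern1; case: (_ == _).
  by rewrite big_const_seq count_predT iter_addr_0 /letters size_iota.
rewrite expr0; apply: le_trans (_ : (count_mem e (letters m))%:R <= _).
  by rewrite -sum1_count natr_sum [leRHS]big_mkcond /=; apply: ler_sum => c _; case: (_ == _).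
by rewrite lern1 count_uniq_mem ?iota_uniq //; case: (_ \in _).
Qed.

End Erasure.

Section Grid.
Variables (K D : nat).
Hypotheses (K_gt0 : (0 < K)%N) (KD : (K <= D)%N).

(** Among the positions on one side of a grid block, those that lie in other
    blocks of the grid have density at most [K / D] in every initial segment. *)
Definition grid_count l : nat := (\sum_(0 <= t < l) ((t + K) %% D < K))%N.

Lemma grid_countP l : (grid_count l * D <= K * l)%N.
Proof.
have D0 : (0 < D)%N by exact: leq_trans KD.
have small k : (k <= D)%N -> (grid_count k <= k - (D - K))%N.
  elim: k => [|k IH] hk; first by rewrite /grid_count big_geq.
  rewrite /grid_count big_nat_recr //= -/(grid_count k); have := IH (ltnW hk).
  have [h|h] := ltnP (k + K) D; first by rewrite modn_small // (ltnNge _ K) leq_addl /=; lia.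
  by case: (_ < K)%N => /=; lia.
have shift k : (grid_count (D + k) <= K + grid_count k)%N.
  rewrite /grid_count (big_cat_nat _ (n := D)) ?leq_addr //=; apply: leq_add.
    by have := small D (leqnn D); rewrite /grid_count subKn.
  rewrite -{1}[D]add0n big_addn addKn; apply: leq_sum => t _.
  by rewrite addnAC modnDr.
elim/ltn_ind: l => l IH.
have [h|h] := leqP l D; last first.
  rewrite -(subnKC (ltnW h)); apply: leq_trans (leq_mul (shift _) (leqnn D)) _.
  by rewrite mulnDl mulnDr leq_add2l; apply: IH; lia.
apply: leq_trans (leq_mul (small l h) (leqnn D)) _.
have [h'|h'] := leqP (D - K) l; last by rewrite (eqP (ltnW h' : _ - _ == 0)%N).
nia.
Qed.

Variables (n : nat) (I : {set 'I_n}) (i : nat).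
Hypothesis I_grid : forall j : 'I_n, j \in I -> j = i %[mod D].

Definition block_mask (j : nat) := [exists k in I, (k <= j < k + K)%N].

Let mask := mkseq block_mask n.

Lemma block_mask_in (k : 'I_n) j : k \in I -> (k <= j < k + K)%N -> block_mask j.
Proof. by move=> hk hj; apply/existsP; exists k; rewrite hk hj. Qed.

Lemma block_mask_out (j : nat) : (forall k : 'I_n, k \in I -> k <> i :> nat) ->
  (i <= j < i + K)%N -> ~~ block_mask j.
Proof.
move=> hi hj; apply/existsP => -[k /andP[hk hkj]].
have /eqP := I_grid hk; have := hi k hk; case: (ltngtP k i) => // h _; last first.
  by rewrite (eqn_mod_dvd _ (ltnW h)) => /dvdnP[[|q]]; lia.
by rewrite eq_sym (eqn_mod_dvd _ (ltnW h)) => /dvdnP[[|q]]; lia.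
Qed.

Lemma block_mask_right t : block_mask (i + K + t) -> ((t + K) %% D < K)%N.
Proof.
move=> /existsP[k /andP[hk /andP[h1 h2]]].
have hik : (i <= k)%N by lia.
have /eqP := I_grid hk; rewrite (eqn_mod_dvd _ hik) => /dvdnP[q hq].
have -> : (t + K = (i + K + t - k) + q * D)%N by lia.
by rewrite modnMDl_ || rewrite addnC modnMDl modn_small; lia.
Qed.

Lemma block_mask_left t : (t < i)%N -> block_mask (i - t.+1) -> ((t + K) %% D < K)%N.
Proof.
move=> hti /existsP[k /andP[hk /andP[h1 h2]]].
have hik : (k <= i)%N by lia.
have /eqP := I_grid hk; rewrite eq_sym (eqn_mod_dvd _ hik) => /dvdnP[q hq].
have -> : (t + K = q * D + (K - 1 - (i - t.+1 - k)))%N by lia.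
by rewrite modnMDl modn_small; lia.
Qed.

Lemma count_take_le l (s : seq bool) (P : pred nat) :
  (forall t, (t < size s)%N -> nth false s t -> P t) ->
  (count id (take l s) <= (\sum_(0 <= t < l) P t)%N)%N.
Proof.
elim: s l P => [|b s IH] [|l] P h //.
rewrite big_nat_recl // [count _ _]/= leq_add //; last first.
  by apply: (IH l (fun t => P t.+1)) => t; exact: (h t.+1).
by move: (h 0%N isT) => /=; clear h; case: b => // /(_ isT) ->.
Qed.

Lemma mask_right l : (count id (take l (drop (i + K) mask)) * D <= K * l)%N.
Proof.
apply: leq_trans (grid_countP l); rewrite leq_mul2r /grid_count; apply/orP; right.
apply: count_take_le => t; rewrite size_drop size_mkseq nth_drop => ht.
by rewrite nth_mkseq; [exact: block_mask_right|lia].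
Qed.

Lemma mask_left l : (i <= n)%N -> (count id (take l (rev (take i mask))) * D <= K * l)%N.
Proof.
move=> hin; apply: leq_trans (grid_countP l); rewrite leq_mul2r /grid_count; apply/orP; right.
apply: count_take_le => t; rewrite size_rev => ht; rewrite nth_rev //.
move: ht; rewrite size_take_min size_mkseq leq_min => /andP[h1 h2].
rewrite (minn_idPl hin) nth_take; last by lia.
by rewrite nth_mkseq; [exact: block_mask_left|lia].
Qed.

Lemma count_mask : (count id mask <= K * #|I|)%N.
Proof.
rewrite /mask /mkseq count_map -sum1_count big_mkcond /=.
apply: leq_trans (_ : (\sum_(0 <= j < n) \sum_(k in I) (k <= j < k + K))%N <= _)%N.
  rewrite /index_iota subn0.
  apply: leq_sum => j _; case: ifP => // /existsP[k /andP[hk hj]].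
  by rewrite (bigD1 k) //= hj.
rewrite exchange_big /= mulnC -sum_nat_const; apply: leq_sum => k _.
apply: leq_trans (_ : size [seq j <- iota 0 n | (k <= j < k + K)%N] <= _)%N.
  by rewrite size_filter -sum1_count [X in (_ <= X)%N]big_mkcond /index_iota subn0 leq_sum // => j _; case: ifP.
rewrite -[X in (_ <= X)%N](size_iota k); apply: uniq_leq_size; first by rewrite filter_uniq // iota_uniq.
by move=> j; rewrite mem_filter => /andP[h _]; rewrite mem_iota.
Qed.

End Grid.

Section TallCount.
Variables (R : realType) (beta T : R).
Hypothesis T_ge0 : 0 <= T.

Lemma tall_nil : tall beta T [::] = false.
Proof. by rewrite /tall /prefix_bounded /= /line mulr0 add0r T_ge0. Qed.

Lemma tall_countE N u : (size u <= N)%N ->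
  tall_count beta T u = (\sum_(0 <= i < N) tall beta T (drop i u))%N.
Proof.
elim: u N => [|c u IH] N hN.
  by rewrite big1 // => i _; rewrite drop_oversize // tall_nil.
case: N hN => // N hN; rewrite big_nat_recl //=; congr (_ + _)%N.
exact: IH.
Qed.

Lemma tall_count_drop_le k u : (tall_count beta T (drop k u) <= tall_count beta T u)%N.
Proof.
elim: u k => [|c u IH] [|k] //; apply: leq_trans (IH k) _; exact: leq_addl.
Qed.

End TallCount.

Definition nocut (R : realType) (alpha : R) u :=
  all (fun c => ~~ cut alpha u c) (iota 1 (size u).-1).

Lemma sum_subsets (R : realType) n (C : {set 'I_n}) (theta : R) :
  (1 + theta) ^+ #|C| = \sum_(I : {set 'I_n}) (I \subset C)%:R * theta ^+ #|I|.
Proof.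
have -> : (1 + theta) ^+ #|C| = \prod_(i : 'I_n) ((i \in C)%:R * theta + 1).
  rewrite -prodr_const big_mkcond /=; apply: eq_bigr => i _.
  by case: ifP => _; rewrite ?mul1r ?mul0r ?add0r // addrC.
rewrite bigA_distr; apply: eq_big => [I|I _]; first by rewrite ?inE.
have [h|/subsetPn [i hi hiC]] := boolP (I \subset C); last first.
  by rewrite mul0r (bigD1 i) //= hi (negbTE hiC) !mul0r.
rewrite mul1r -prodr_const [RHS]big_mkcond /=; apply: eq_bigr => i _.
by case: ifP => // /(fintype.subsetP h) ->; rewrite mul1r.
Qed.

Section Zeroing.
Variables (R : realType) (m : nat) (f : nat -> R) (alpha beta gamma T : R) (K0 K D : nat).
Hypothesis f_homo : {homo f : i j / (i <= j)%N >-> i <= j}.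
Hypothesis f_ge0 : forall k, 0 <= f k.
Hypothesis beta_ge0 : 0 <= beta.
Hypothesis alphaE : alpha = beta + gamma.
Hypothesis gamma_ge0 : 0 <= gamma.
Hypothesis T_ge0 : 0 <= T.
Hypothesis K0_gt0 : (0 < K0)%N.
Hypothesis T_le : T <= beta * K0%:R.
Hypothesis KE : K = (K0 + K0)%N.
Hypothesis KD : (K <= D)%N.
Hypothesis D_large : m%:R * K%:R <= gamma * D%:R.

Let alpha_ge0 : 0 <= alpha. Proof. by rewrite alphaE addr_ge0. Qed.
Let D_gt0 : (0 < D)%N. Proof. by apply: leq_trans KD; rewrite KE addn_gt0 K0_gt0. Qed.

(** Raising a word on a sparse set of blocks costs only the slope [gamma], and
    half of the zeros of a block absorb the constant [T]. *)
Lemma lgood_zeros_cat (d : seq bool) x : all (fun c => c <= m)%N x ->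
  (forall l, count id (take l d) * D <= K * l)%N ->
  prefix_bounded (line beta T) (erase d x) -> lgood alpha (nseq K0 0%N ++ x).
Proof.
move=> hx hd /(prefix_boundedP _ (line_homo _ beta_ge0)) h.
apply/(lgoodP alpha_ge0) => k; rewrite takeD_cat sumn_cat size_nseq.
have -> : sumn (take k (nseq K0 0%N)) = 0%N.
  by apply/eqP; rewrite -leqn0; apply: leq_trans (sumn_take_le _ _) _; rewrite sumn_nseq.
rewrite add0n; have [hk|hk] := leqP k K0.
  by rewrite (eqP (hk : _ - _ == 0)%N) take0 mulr_ge0.
set l := (k - K0)%N; have := h l; rewrite /line -erase_take => h1.
have ha : all (fun c => c <= m)%N (take l x) by apply/allP => c /mem_take /(allP hx).
have := sumn_erase (take l d) ha; rewrite -(ler_nat R) natrD natrM => h2.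
have h3 : m%:R * (count id (take l d))%:R <= gamma * l%:R.
  rewrite -(ler_pM2r (_ : 0 < D%:R)) ?ltr0n // -mulrA -natrM.
  apply: le_trans (_ : m%:R * (K * l)%:R <= _); first by rewrite ler_wpM2l // ler_nat hd.
  by rewrite natrM mulrA [leRHS]mulrAC ler_wpM2r.
have -> : k%:R = l%:R + K0%:R :> R by rewrite /l natrB ?(ltnW hk) // subrK.
have key (a e c b g t y z : R) : e <= b * y + t -> a <= e + c -> c <= g * y ->
    t <= b * z -> 0 <= g * z -> a <= (b + g) * (y + z) by move=> *; lra.
by rewrite alphaE; apply: key h1 h2 h3 T_le _; rewrite mulr_ge0.
Qed.

(** At a candidate position, a block of zeros creates a cut in its middle. *)
Definition candidate u i :=
  suffix_bounded (line beta T) (take i u) && prefix_bounded (line beta T) (drop (i + K) u).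

Definition zero_block u i := take K (drop i u) == nseq K 0%N.

Lemma candidate_below u v i : below u v -> candidate v i -> candidate u i.
Proof.
move=> h /andP[h1 h2]; apply/andP; split.
  by apply: suffix_bounded_below h1; exact: below_take.
by apply: prefix_bounded_below h2; exact: below_drop.
Qed.

Variables (n o : nat).

Definition grid_candidates u : {set 'I_n} :=
  [set i : 'I_n | [&& (i %% D == o)%N, (i + K <= n)%N & candidate u i]].

Definition zero_candidates u : {set 'I_n} :=
  [set i in grid_candidates u | zero_block u i].

Definition erase_blocks (I : {set 'I_n}) u := erase (mkseq (block_mask K I) n) u.

(** If [u] has no cut, the set of erased blocks can be read off the erased word:
    a candidate block of zeros that was not erased would already be a block of
    zeros of [u], and restoring the other blocks is too sparse a change to
    destroy the cut in its middle. *)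
Lemma zero_candidates_erase u (I : {set 'I_n}) : u \in words m n ->
  (forall c, (0 < c < n)%N -> ~~ cut alpha u c) -> I \subset grid_candidates u ->
  zero_candidates (erase_blocks I u) = I.
Proof.
move=> hu nocut /fintype.subsetP hI.
have su : size u = n := size_words hu.
have sm : size (mkseq (block_mask K I) n) = n by rewrite size_mkseq.
have am : all (fun c => c <= m)%N u by move: hu; rewrite mem_words => /andP[].
have Ig (j : 'I_n) : j \in I -> (j %% D = o)%N by move=> /hI; rewrite inE => /and3P[/eqP].
apply/setP => i; rewrite !inE; apply/andP/idP => [[/and3P[/eqP hio hiK hc] hz]|hiI]; last first.
  have := hI i hiI; rewrite inE => /and3P[h1 h2 h3].
  split; first by rewrite h1 h2 (candidate_below (erase_below _ _) h3).
  apply/eqP; apply: (@eq_from_nth _ 0%N).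
    by rewrite size_takel ?size_nseq // size_drop size_erase su; lia_nat.
  move=> j; rewrite size_takel ?size_drop ?size_erase ?su; last by lia_nat.
  move=> hj; rewrite nth_take // nth_drop nth_erase nth_nseq hj nth_mkseq; last by lia_nat.
  by rewrite (block_mask_in hiI) //; lia_nat.
apply: contraT => hiI.
have IgD (j : 'I_n) : j \in I -> j = i %[mod D] by move=> /Ig ->; rewrite hio.
have hne (k : 'I_n) : k \in I -> k <> i :> nat.
  by move=> hk /val_inj e; rewrite -e hk in hiI.
have hzu : take K (drop i u) = nseq K 0%N.
  apply: (@eq_from_nth _ 0%N); first by rewrite size_takel ?size_nseq // size_drop su; lia_nat.
  move=> j; rewrite size_takel ?size_drop ?su; last by lia_nat.
  move=> hj; have := congr1 (fun s => nth 0%N s j) (eqP hz).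
  rewrite /= !nth_take // !nth_drop nth_erase nth_mkseq; last by lia_nat.
  by rewrite (negbTE (block_mask_out _ KD IgD hne _)) ?KE ?addn_gt0 ?K0_gt0 //; lia_nat.
have hdrop : drop i u = nseq K 0%N ++ drop (i + K) u.
  by rewrite -{1}(cat_take_drop K (drop i u)) hzu drop_drop addnC.
have e1 : drop (i + K0) u = nseq K0 0%N ++ drop (i + K) u.
  by rewrite addnC -drop_drop hdrop KE nseqD -catA drop_size_cat ?size_nseq.
have e2 : take (i + K0) u = take i u ++ nseq K0 0%N.
  by rewrite takeD hdrop KE nseqD -catA take_size_cat ?size_nseq.
have /negP[] := nocut (i + K0)%N ltac:(by apply/andP; split; lia_nat).
rewrite /cut e1 e2; apply/andP; split.
- rewrite -lgood_rev rev_cat rev_nseq.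
  apply: (@lgood_zeros_cat (rev (take i (mkseq (block_mask K I) n)))).
  + by rewrite all_rev; apply/allP => c /mem_take /(allP am).
  + by move=> l; apply: mask_left => //; rewrite ?KE ?addn_gt0 ?K0_gt0 //; exact: ltnW.
  + by rewrite erase_rev ?size_take_min ?sm ?su // erase_take; case/andP: hc.
- apply: (@lgood_zeros_cat (drop (i + K) (mkseq (block_mask K I) n))).
  + by apply/allP => c /mem_drop /(allP am).
  + by move=> l; apply: mask_right => //; rewrite ?KE ?addn_gt0 ?K0_gt0.
  + by rewrite erase_drop; case/andP: hc.
Qed.

Let theta : R := (m.+1%:R ^+ K)^-1.

(** Erasing a set of candidate blocks gives a word of the language from which the
    set and the other letters can be recovered; [theta] pays for the erased
    letters of a block. The sum over all sets of candidates produces the power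
    of [1 + theta]. *)
Lemma weighted_candidates_le :
  \sum_(u <- words m n) (lang f u && nocut alpha u)%:R * (1 + theta) ^+ #|grid_candidates u|
    <= lang_card m f n.
Proof.
have mK : 0 < m.+1%:R ^+ K :> R by rewrite exprn_gt0.
have theta0 : 0 < theta by rewrite invr_gt0.
pose hit (v u : seq nat) (I : {set 'I_n}) : R :=
  (lang f v)%:R * ((I == zero_candidates v)%:R * theta ^+ #|I| * (erase_blocks I u == v)%:R).
apply: le_trans (_ : \sum_(u <- words m n) \sum_(I : {set 'I_n}) \sum_(v <- words m n) hit v u I <= _).
  rewrite !big_seq; apply: ler_sum => u hu.
  have hit0 v I : 0 <= hit v u I by rewrite !mulr_ge0 // exprn_ge0 // ltW.
  case/boolP: (lang f u && nocut alpha u) => [/andP[hl hn]|_]; last first.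
    by rewrite mul0r sumr_ge0 // => I _; rewrite sumr_ge0.
  rewrite mul1r sum_subsets; apply: ler_sum => I _.
  case/boolP: (I \subset _) => hI; last by rewrite mul0r sumr_ge0.
  have hv : erase_blocks I u \in words m n by exact: erase_words.
  rewrite (bigD1_seq _ hv) ?uniq_words //= mul1r ler_wpDr ?sumr_ge0 //.
  rewrite /hit eqxx mulr1 (lang_below f_homo f_ge0 (erase_below _ _) hl) mul1r.
  rewrite zero_candidates_erase ?eqxx ?mul1r // => c /andP[c0 cn].
  by move/allP: hn; apply; rewrite mem_iota (size_words hu); apply/andP; split => //; lia_nat.
under eq_bigr => u _ do rewrite exchange_big /=.
rewrite exchange_big /= /lang_card /count_words !big_seq; apply: ler_sum => v hv.
under eq_bigr => u _ do rewrite -mulr_sumr.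
rewrite -mulr_sumr ler_piMr // (eq_bigr (fun u => theta ^+ #|zero_candidates v| *
    (erase_blocks (zero_candidates v) u == v)%:R)); last first.
  move=> u _; rewrite (bigD1 (zero_candidates v)) //= eqxx mul1r big1 ?addr0 // => I /negbTE ->.
  by rewrite !mul0r.
rewrite -mulr_sumr /theta exprVn -exprM mulrC ler_pdivrMr ?exprn_gt0 // mul1r.
have sv := size_words hv.
apply: le_trans (_ : m.+1%:R ^+ count id (mkseq (block_mask K (zero_candidates v)) n) <= _).
  by rewrite -[X in words m X]sv; apply: count_erase; rewrite size_mkseq sv.
by apply: ler_weXn2l; [rewrite ler1n|exact: count_mask].
Qed.

End Zeroing.

(** A position is a candidate unless a tall position, seen from the left or from
    the right, prevents it. *)
Lemma grid_candidates_many (R : realType) (m : nat) (beta T : R) (K D n : nat) u :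
  0 <= beta -> 0 <= T -> (0 < D)%N -> u \in words m n ->
  (n <= K + tall_count beta T u + tall_count beta T (rev u) +
     \sum_(o < D) #|grid_candidates beta T K D n o u|)%N.
Proof.
move=> b0 T0 D0 hu; have su := size_words hu.
have -> : (\sum_(o < D) #|grid_candidates beta T K D n o u|)%N =
    #|[pred i : 'I_n | (i + K <= n)%N && candidate beta T K u i]|.
  under eq_bigr => o _ do rewrite -sum1_card big_mkcond /=.
  rewrite exchange_big /= -sum1_card [RHS]big_mkcond /=; apply: eq_bigr => i _.
  rewrite (bigD1 (Ordinal (ltn_pmod i D0))) //= big1 => [|o ho].
    by rewrite addn0 /grid_candidates !inE eqxx.
  rewrite /grid_candidates inE; case: eqP => //= e; case/eqP: ho.
  by apply: val_inj; exact: esym e.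
have [hK|hK] := leqP n K; first lia.
have h : (n - K <= \sum_(0 <= i < n - K) (candidate beta T K u i +
    (tall beta T (drop i (drop K u)) + tall beta T (rev (take i u)))))%N.
  rewrite -{1}[(n - K)%N]subn0 -[X in (X <= _)%N]muln1 -sum_nat_const_nat; apply: leq_sum => i _.
  rewrite drop_drop /candidate /tall /suffix_bounded.
  by case: (prefix_bounded _ (rev _)); case: (prefix_bounded _ _).
rewrite !big_split /= in h.
have h1 : (\sum_(0 <= i < n - K) candidate beta T K u i <=
    #|[pred i : 'I_n | (i + K <= n)%N && candidate beta T K u i]|)%N.
  rewrite -sum1_card [X in (_ <= X)%N]big_mkcond /=.
  rewrite -(big_mkord xpredT (fun i => if (i + K <= n)%N && candidate beta T K u i then 1 else 0)%N).
  rewrite [X in (_ <= X)%N](big_cat_nat _ (n := (n - K)%N)) ?leq_subr //=.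
  apply: leq_trans (leq_addr _ _); rewrite !big_nat; apply: leq_sum => i hi.
  have -> : (i + K <= n)%N by lia.
  by case: (candidate _ _ _ _ _).
have h2 : (\sum_(0 <= i < n - K) tall beta T (drop i (drop K u)) <= tall_count beta T u)%N.
  by rewrite -tall_countE ?size_drop ?su //; exact: tall_count_drop_le.
have h3 : (\sum_(0 <= i < n - K) tall beta T (rev (take i u)) <= tall_count beta T (rev u))%N.
  apply: leq_trans (_ : \sum_(0 <= i < n) tall beta T (rev (take i u)) <= _)%N.
    by rewrite [X in (_ <= X)%N](big_cat_nat _ (n := (n - K)%N)) ?leq_subr //= leq_addr.
  apply: leq_trans (tall_count_drop_le beta T 1 (rev u)).
  rewrite (@tall_countE R beta T T0 n) ?size_drop ?size_rev ?su ?leq_subr // big_nat_rev /= !big_nat.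
  apply: leq_sum => i hi; rewrite drop_drop drop_rev su.
  by rewrite (_ : 0 + n - i.+1 = n - (i + 1))%N //; lia.
rewrite -!addnA -leq_subLR; apply: leq_trans h _.
by apply: leq_trans (leq_add h1 (leq_add h2 h3)) _; rewrite addnC -addnA.
Qed.

Section NocutRare.
Variables (R : realType) (m : nat) (f : nat -> R) (alpha : R).
Hypothesis m_gt0 : (0 < m)%N.
Hypothesis f_homo : {homo f : i j / (i <= j)%N >-> i <= j}.
Hypothesis f_ge0 : forall k, 0 <= f k.
Hypothesis alpha_gt : \sum_(1 <= i < m.+1) (i%:R / i.+1%:R) < alpha.
Local Notation L := (lang_card m f).
Local Notation lam := (growth m f).

(** Words with many tall positions are rare. In the other ones, at least half of
    the positions are candidates up to a constant, and one of the [D] grids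
    contains its share of them, so that the weighted count of candidates is
    exponentially large on the words without a cut. *)
Lemma nocut_rare : exists C q : R, [/\ 0 <= C, 0 < q < 1 & forall n,
  count_words m R n (fun u => lang f u && nocut alpha u) <= C * (lam ^+ n * q ^+ n)].
Proof.
pose b0 : R := \sum_(1 <= i < m.+1) (i%:R / i.+1%:R).
have ab : b0 < alpha by exact: alpha_gt.
have b00 : 0 <= b0 by apply: sumr_ge0 => i _; rewrite divr_ge0.
pose beta : R := (b0 + alpha) / 2; pose gamma : R := alpha - beta.
have betab : b0 < beta by rewrite /beta; lra.
have beta0 : 0 < beta by exact: le_lt_trans b00 betab.
have gamma0 : 0 < gamma by rewrite /gamma /beta; lra.
have [N0 [C1 [q1 [C10 /andP[q10 q11] h1]]]] := tall_rare m_gt0 f_homo f_ge0 betab.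
set T : R := (m * N0)%:R in h1.
have T0 : 0 <= T by [].
(* Half a block of zeros absorbs the height [T] of the line, and the blocks are
   far enough apart for restoring them to cost only the slope [gamma]. *)
pose K0 := (Num.truncn (T / beta)).+1.
have hK0 : T <= beta * K0%:R.
  by rewrite mulrC -ler_pdivrMr // ltW // /K0 truncnS_gt.
pose K := (K0 + K0)%N.
pose M := (Num.truncn (m%:R / gamma)).+1.
have hM : m%:R <= gamma * M%:R.
  by rewrite mulrC -ler_pdivrMr // ltW // /M truncnS_gt.
pose D := (K * M)%N.
have K_gt0 : (0 < K)%N by rewrite addn_gt0.
have KD : (K <= D)%N by rewrite leq_pmulr.
have D0 : (0 < D)%N by exact: leq_trans KD.
have hD : m%:R * K%:R <= gamma * D%:R.
  by rewrite /D natrM mulrCA mulrC ler_wpM2l.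
pose theta : R := (m.+1%:R ^+ K)^-1.
have theta0 : 0 < theta by rewrite invr_gt0 exprn_gt0.
pose s : R := expR (ln (1 + theta) / (4 * D%:R)).
have DR : 0 < D%:R :> R by rewrite ltr0n.
have s1 : 1 < s by rewrite expR_gt1 divr_gt0 ?ln_gt0 ?mulr_gt0 //; lra.
have s0 : 0 < s by exact: lt_trans s1.
have sD : s ^+ (4 * D) = 1 + theta.
  rewrite /s -expRM_natr natrM divfK ?lnK ?posrE //; last by rewrite mulf_neq0 // gt_eqF.
  by rewrite ltr_wpDl // ltr01.
have [C2 C20 h2] := lang_card_subexp m f_homo f_ge0 s1.
have lam0 := growth_gt0 m f.
pose q : R := Num.max q1 s^-1.
have q0 : 0 < q by rewrite lt_max q10.
have q1' : q < 1 by rewrite gt_max q11 invf_lt1.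
exists (2 * C1 + D%:R * C2 * s ^+ (4 * K)), q; split.
- by rewrite addr_ge0 ?mulr_ge0 ?exprn_ge0 // ltW.
- by rewrite q0.
move=> n.
pose P1 u := lang f u && (n <= 4 * tall_count beta T u)%N.
pose P2 u := lang f u && (n <= 4 * tall_count beta T (rev u))%N.
pose P3 u := lang f u && nocut alpha u.
pose W u : R := \sum_(o < D) (P3 u)%:R * (1 + theta) ^+ #|grid_candidates beta T K D n o u|.
have W0 u : 0 <= W u by apply: sumr_ge0 => o _; rewrite mulr_ge0 // exprn_ge0 //; lra.
have lamn : 0 <= lam ^+ n by rewrite exprn_ge0 // ltW.
have e1 : count_words m R n P1 <= C1 * (lam ^+ n * q ^+ n).
  apply: le_trans (h1 n) _; rewrite ler_wpM2l // ler_wpM2l //.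
  by apply: lerXn2r; rewrite ?nnegrE ?(ltW q10) ?(ltW q0) // le_max lexx.
have e2 : count_words m R n P2 <= C1 * (lam ^+ n * q ^+ n).
  apply: le_trans e1; rewrite /count_words -[leRHS]big_words_rev; apply: ler_sum => u _.
  by rewrite /P1 /P2 lang_rev.
have e3 : \sum_(u <- words m n) W u <= D%:R * L n.
  rewrite exchange_big /=; apply: le_trans (_ : \sum_(o < D) L n <= _).
    by apply: ler_sum => o _; apply: (weighted_candidates_le (gamma := gamma) (K0 := K0)) => //;
      rewrite ?(ltW beta0) ?(ltW gamma0) // /gamma addrC subrK.
  by rewrite sumr_const card_ord mulr_natl.
have e4 u : u \in words m n ->
    (P3 u)%:R <= (P1 u)%:R + (P2 u)%:R + W u * (s ^+ (4 * K) / s ^+ (2 * n)).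
  move=> hu.
  have pos : 0 <= W u * (s ^+ (4 * K) / s ^+ (2 * n)).
    by rewrite mulr_ge0 // divr_ge0 // exprn_ge0 // ltW.
  have [h3|_] := boolP (P3 u); last by rewrite !addr_ge0.
  have [h1'|n1] := boolP (P1 u); first by rewrite /= -addrA lerDl addr_ge0.
  have [h2'|n2] := boolP (P2 u); first by rewrite /= add0r lerDl.
  rewrite !add0r mulrA ler_pdivlMr ?exprn_gt0 // mul1r.
  have /andP[hl _] := h3.
  move: n1 n2; rewrite /P1 /P2 hl /= -!ltnNge => n1 n2.
  have := grid_candidates_many K (ltW beta0) T0 D0 hu.
  set S := (\sum_(o < D) _)%N => hS.
  have [oo ho] : exists o : 'I_D, (S <= D * #|grid_candidates beta T K D n o u|)%N.
    case: (@arg_maxnP _ (Ordinal D0) xpredT (fun o : 'I_D => #|grid_candidates beta T K D n o u|)) => // o _ ho.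
    exists o; rewrite /S -[X in (X * _)%N]card_ord -sum_nat_const; apply: leq_sum => o' _; exact: ho.
  have e : (2 * n <= 4 * K + 4 * D * #|grid_candidates beta T K D n oo u|)%N.
    have key a b c d e : (n <= a + b + c + d -> d <= e -> 4 * b < n -> 4 * c < n ->
        2 * n <= 4 * a + 4 * e)%N by clear; lia.
    by rewrite -mulnA; exact: key hS ho n1 n2.
  apply: le_trans (ler_weXn2l (ltW s1) e) _.
  rewrite exprD [s ^+ (4 * D * _)]exprM sD mulrC ler_wpM2r ?exprn_ge0 ?(ltW s0) //.
  rewrite /W (bigD1 oo) //= h3 mul1r lerDl sumr_ge0 // => o' _.
  by rewrite mul1r exprn_ge0 // ltW // ltr_pwDr.
apply: le_trans (_ : \sum_(u <- words m n)
    ((P1 u)%:R + (P2 u)%:R + W u * (s ^+ (4 * K) / s ^+ (2 * n))) <= _).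
  by rewrite /count_words !big_seq; apply: ler_sum => u hu; exact: e4.
rewrite !big_split /= -mulr_suml mulrDl; apply: lerD.
  by rewrite mulr_natl mulr2n mulrDl; exact: lerD.
apply: le_trans (ler_wpM2r _ e3) _; first by rewrite divr_ge0 // exprn_ge0 // ltW.
have e5 : L n * (s ^+ (4 * K) / s ^+ (2 * n)) <= C2 * s ^+ (4 * K) * (lam ^+ n * (s^-1) ^+ n).
  apply: le_trans (ler_wpM2r _ (h2 n)) _; first by rewrite divr_ge0 // exprn_ge0 // ltW.
  have sn : s ^+ n != 0 by rewrite expf_neq0 // gt_eqF.
  by rewrite exprVn mul2n -addnn exprD le_eqVlt; apply/orP; left; apply/eqP; field.
rewrite -!mulrA ler_pM2l //; apply: le_trans e5 _.
rewrite -mulrA ler_pM2l // ler_wpM2l ?exprn_ge0 ?(ltW s0) // ler_wpM2l //.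
by apply: lerXn2r; rewrite ?nnegrE ?invr_ge0 ?(ltW s0) ?(ltW q0) // le_max lexx orbT.
Qed.

End NocutRare.

(** * The renewal theorem *)

Section Convolution.
Variable R : realType.
Implicit Types x y : nat -> R.

Definition conv x y n := \sum_(i < n.+1) x i * y (n - i)%N.

Lemma sum_conv_le x y N : (forall n, 0 <= x n) -> (forall n, 0 <= y n) ->
  \sum_(n < N) conv x y n <= (\sum_(i < N) x i) * (\sum_(j < N) y j).
Proof.
move=> x0 y0.
have -> : \sum_(n < N) conv x y n = \sum_(i < N) \sum_(n < N | (i <= n)%N) x i * y (n - i)%N.
  rewrite (exchange_big_dep xpredT) //=; apply: eq_bigr => n _; rewrite /conv.
  by rewrite (big_ord_widen_cond N xpredT (fun i => x i * y (n - i)%N)).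
rewrite mulr_suml; apply: ler_sum => i _; rewrite -mulr_sumr ler_wpM2l //.
rewrite -(big_mkord (fun n => i <= n)%N (fun n => y (n - i)%N)).
rewrite (big_cat_nat _ (n := i)) ?(ltnW (ltn_ord i)) //= big_nat_cond big1 ?add0r; last first.
  by move=> n /andP[/andP[_ h1] h2]; rewrite leqNgt h1 in h2.
rewrite -{1}[nat_of_ord i]add0n big_addn.
rewrite -(big_mkord xpredT y) [leRHS](big_cat_nat _ (n := (N - i)%N)) ?leq_subr //=.
rewrite ler_wpDr ?sumr_ge0 // big_mkcond ler_sum // => n _.
by case: ifP => // _; rewrite addnK.
Qed.

Lemma geometric_bounded x C q : 0 <= C -> 0 < q < 1 -> (forall n, x n <= C * q ^+ n) ->
  forall a b, \sum_(a <= i < b) x i <= C / (1 - q) * q ^+ a.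
Proof.
move=> C0 /andP[q0 q1] hx a b.
apply: le_trans (_ : \sum_(a <= i < b) C * q ^+ i <= _); first by apply: ler_sum => i _.
rewrite -mulr_sumr -mulrA ler_wpM2l // mulrC; apply: geometric_tail.
by rewrite (ltW q0) q1.
Qed.

Section Summable.
Variables (x : nat -> R) (C q : R).
Hypotheses (C0 : 0 <= C) (hq : 0 < q < 1) (hx : forall n, 0 <= x n <= C * q ^+ n).

Let x0 n : 0 <= x n. Proof. by have /andP[] := hx n. Qed.
Let xle n : x n <= C * q ^+ n. Proof. by have /andP[] := hx n. Qed.

Lemma summable_cvg : exists X : R, (fun n => \sum_(i < n) x i) @ \oo --> X.
Proof.
pose S n := \sum_(i < n) x i.
have Smono : nondecreasing_seq S.
  by apply/nondecreasing_seqP => n; rewrite /S big_ord_recr /= lerDl.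
exists (limn S); apply: nondecreasing_is_cvgn => //; exists (C / (1 - q)) => _ [n _ <-].
by have := geometric_bounded C0 hq xle 0 n; rewrite expr0 mulr1 big_mkord.
Qed.

Lemma conv_cvg0 (z : nat -> R) (B : R) : (forall n, 0 <= z n <= B) -> z @ \oo --> 0 ->
  conv x z @ \oo --> 0.
Proof.
move=> hz zc; apply/cvgrPdist_le => /= e e0.
have /andP[q0 q1] := hq.
have z0 n : 0 <= z n by have /andP[] := hz n.
have B0 : 0 <= B by have /andP[] := hz 0%N; exact: le_trans.
have CQ : 0 <= C / (1 - q) by rewrite divr_ge0 // ltW // subr_gt0.
have e2 : 0 < e / 2 by lra.
have [I hI] := @geometric_small R q (B * (C / (1 - q))) (e / 2)
  ltac:(by rewrite (ltW q0) q1) e2 (mulr_ge0 B0 CQ).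
pose e' := e / 2 / (C / (1 - q) + 1).
have d0 : 0 < C / (1 - q) + 1 by rewrite ltr_wpDl.
have e'0 : 0 < e' by rewrite divr_gt0.
have /cvgrPdist_le/(_ e' e'0) [N _ hN] := zc.
exists (I + N)%N => // n; rewrite /= => hn.
rewrite sub0r normrN ger0_norm; last by apply: sumr_ge0 => i _; rewrite mulr_ge0.
apply: le_trans (_ : \sum_(i < n.+1) (x i * e' + (I <= i)%:R * x i * B) <= _).
  apply: ler_sum => i _; have [h|h] := leqP I i.
    have /andP[_ zB] := hz (n - i)%N.
    by rewrite mul1r ler_wpDl ?ler_wpM2l // mulr_ge0 // ltW.
  rewrite !mul0r addr0 ler_wpM2l //.
  have := hN (n - i)%N ltac:(by rewrite /=; move: h hn; clear; lia).
  by rewrite /= sub0r normrN ger0_norm.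
rewrite big_split /= -!mulr_suml [leRHS](splitr e); apply: lerD.
  apply: le_trans (_ : (C / (1 - q)) * e' <= _).
    rewrite ler_wpM2r ?(ltW e'0) //.
    by have := geometric_bounded C0 hq xle 0 n.+1; rewrite expr0 mulr1 big_mkord.
  rewrite /e' mulrCA ler_piMr ?(ltW e2) // ler_pdivrMr // mul1r; lra.
apply: le_trans hI; rewrite mulrC -mulrA ler_wpM2l //.
apply: le_trans (geometric_bounded C0 hq xle I n.+1).
rewrite [leRHS](big_nat_widenl _ 0) //= [leRHS]big_mkcond /= big_mkord.
by apply: ler_sum => i _; case: leqP; rewrite ?mul1r ?mul0r.
Qed.

Lemma conv_cvg (y : nat -> R) (B l X : R) :
  (forall n, `|y n| <= B) -> y @ \oo --> l ->
  (fun n => \sum_(i < n) x i) @ \oo --> X -> conv x y @ \oo --> X * l.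
Proof.
move=> yB yl xX.
pose z n := `|y n - l|.
have zc : conv x z @ \oo --> 0.
  apply: (@conv_cvg0 z (B + `|l|)) => [n|].
    by rewrite normr_ge0 /=; apply: le_trans (ler_normB _ _) _; rewrite lerD2r.
  have -> : (0 : R) = `|l - l| by rewrite subrr normr0.
  apply: cvg_norm; apply: cvgB => //; exact: cvg_cst.
have e1 n : conv x y n = conv x (fun k => y k - l) n + (\sum_(i < n.+1) x i) * l.
  rewrite /conv mulr_suml -big_split /=; apply: eq_bigr => i _; lra.
have c1 : conv x (fun k => y k - l) @ \oo --> 0.
  apply/norm_cvg0P; apply: (squeeze_cvgr (f := fun=> 0) (h := conv x z)) => //; last exact: cvg_cst.
  apply: nearW => n; rewrite normr_ge0 /=; apply: le_trans (ler_norm_sum _ _ _) _.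
  by apply: ler_sum => i _; rewrite normrM (ger0_norm (x0 i)).
rewrite (_ : conv x y = (fun n => conv x (fun k => y k - l) n + (\sum_(i < n.+1) x i) * l)).
  rewrite -[X * l]add0r; apply: cvgD => //; apply: cvgMl.
  by rewrite (cvg_shiftS (fun n => \sum_(i < n) x i)).
exact/funext.
Qed.

End Summable.
End Convolution.

Section LimSup.
Variable R : realType.

Lemma bounded_limsup (x : nat -> R) (B : R) : (forall n, `|x n| <= B) ->
  exists l, [/\ `|l| <= B, forall e, 0 < e -> exists N, forall n, (N <= n)%N -> x n <= l + e
    & forall e, 0 < e -> forall N, exists2 n, (N <= n)%N & l - e <= x n].
Proof.
move=> xB.
pose S := [set b : R | exists N, forall n, (N <= n)%N -> x n <= b].
have lowS b : S b -> - B <= b.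
  by move=> [N /(_ N (leqnn N))]; apply: le_trans; have := xB N; rewrite ler_norml => /andP[].
have Sinf : has_inf S.
  split; last by exists (- B) => b; exact: lowS.
  by exists B, 0%N => n _; apply: le_trans (xB n); exact: ler_norm.
exists (inf S); split.
- rewrite ler_norml; apply/andP; split; first by apply: lb_le_inf Sinf.1 _ => b; exact: lowS.
  apply: ge_inf; first exact: Sinf.2.
  by exists 0%N => n _; apply: le_trans (xB n); exact: ler_norm.
- move=> e e0; have [b [N hN] hb] := inf_adherent e0 Sinf.
  by exists N => n hn; apply: le_trans (hN n hn) (ltW hb).
- move=> e e0 N; apply: contrapT => hno.
  have : inf S <= inf S - e.
    apply: ge_inf; first exact: Sinf.2.
    exists N => n hn; rewrite leNgt; apply/negP => h; apply: hno; exists n => //; exact: ltW.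
  by rewrite lerBrDl gerDr leNgt e0.
Qed.

End LimSup.

Section Renewal.
Variables (R : realType) (p : nat -> R) (C q : R).
Hypotheses (p0 : p 0%N = 0) (p_ge0 : forall k, 0 <= p k) (p1 : 0 < p 1%N).

Definition renewal_tail k := 1 - \sum_(j < k.+1) p j.
Local Notation r := renewal_tail.

Lemma renewal_tailS k : r k.+1 = r k - p k.+1.
Proof. by rewrite /renewal_tail [in LHS]big_ord_recr /= opprD addrA. Qed.

Lemma renewal_tail0 : r 0%N = 1.
Proof. by rewrite /renewal_tail big_ord1 p0 subr0. Qed.

Definition renewal_eq (x : nat -> R) := forall n, x n.+1 = conv (fun i => p i.+1) x n.

(** The tails satisfy [r k.+1 = r k - p k.+1], which is exactly what the renewal
    equation needs for [conv r x] to be constant. *)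
Lemma renewal_identity x : renewal_eq x -> forall n, conv r x n = x 0%N.
Proof.
move=> hx; elim=> [|n IH]; first by rewrite /conv big_ord1 subnn renewal_tail0 mul1r.
rewrite /conv big_ord_recl subn0 renewal_tail0 mul1r.
under eq_bigr => i _ do rewrite lift0 renewal_tailS mulrBl subSS.
by rewrite sumrB -/(conv r x n) IH (hx n) /conv addrCA subrr addr0.
Qed.

Hypothesis tail_small : forall k, 0 <= r k <= C * q ^+ k.
Hypotheses (C0 : 0 <= C) (hq : 0 < q < 1).

Let r_ge0 k : 0 <= r k. Proof. by have /andP[] := tail_small k. Qed.
Let r_le k : r k <= C * q ^+ k. Proof. by have /andP[] := tail_small k. Qed.

Lemma p1_le1 : p 1%N <= 1.
Proof. by have := r_ge0 1; rewrite renewal_tailS renewal_tail0; lra. Qed.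

Let sum_p a b : (a <= b)%N -> \sum_(a <= i < b) p i.+2 = r a.+1 - r b.+1.
Proof.
move=> hab; rewrite -(subnKC hab); elim: (b - a)%N => [|k IH].
  by rewrite addn0 big_geq // subrr.
by rewrite addnS big_nat_recr ?leq_addr //= IH (renewal_tailS (a + k).+1); lra.
Qed.

(** Near an index where a solution of the renewal equation almost reaches its
    upper limit, it almost reaches it on a long stretch of earlier indices: the
    value at [n] is an average of earlier ones, in which the previous one has
    the fixed weight [p 1]. *)
Lemma renewal_stretch x (l : R) : renewal_eq x -> (forall n, `|x n| <= 1) -> `|l| <= 1 ->
  (forall e : R, 0 < e -> exists N, forall n, (N <= n)%N -> x n <= l + e) ->
  (forall e : R, 0 < e -> forall N, exists2 n, (N <= n)%N & l - e <= x n) ->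
  forall i (e : R), 0 < e -> forall N, exists2 n, (N <= n)%N &
    forall j, (j <= i)%N -> l - e <= x (n - j)%N.
Proof.
move=> hx xB lB hup hlow; elim=> [|i IH] e e0 N.
  have [n hn h] := hlow e e0 N; exists n => // j; rewrite leqn0 => /eqP ->.
  by rewrite subn0.
pose d : R := Num.min e (Num.min 1 (p 1%N * e / 5)).
have d0 : 0 < d by rewrite !lt_min e0 ltr01 divr_gt0 // mulr_gt0.
have de : d <= e by rewrite ge_min lexx.
have d1 : d <= 1 by rewrite !ge_min lexx orbT.
have d5 : 5 * d <= p 1%N * e.
  by rewrite mulrC -ler_pdivlMr // !ge_min lexx !orbT.
have [N1 hN1] := hup d d0.
have /andP[q0 q1] := hq.
have [K hK] := @geometric_small R q C d ltac:(by rewrite (ltW q0) q1) d0 C0.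
have rK k : (K <= k)%N -> r k <= d.
  move=> hk; apply: le_trans (r_le k) _; apply: le_trans hK; rewrite ler_wpM2l //.
  by apply: ler_wiXn2l => //; exact: ltW.
have [n hn h] := IH d d0 (N + N1 + K + i + 2)%N.
exists n => [|j]; first by move: hn; clear; lia.
rewrite leq_eqVlt ltnS => /orP[/eqP ->|hj]; last first.
  by apply: le_trans (h j hj); rewrite lerD2l lerN2.
have xle k : x k <= 1 by have := xB k; rewrite ler_norml => /andP[].
have [la lb] : l <= 1 /\ -1 <= l by move: lB; rewrite ler_norml => /andP[? ?]; split.
have {h} := h i (leqnn i).
have [k hk] : exists k, (n - i = k.+1)%N by exists (n - i - 1)%N; move: hn; clear; lia.
rewrite (_ : n - i.+1 = k)%N; last by move: hk; clear; lia.
rewrite hk (hx k) /conv big_ord_recl.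
under eq_bigr => j' _ do rewrite lift0.
rewrite /= subn0 -(big_mkord xpredT (fun j' => p j'.+2 * x (k - j'.+1)%N)) => h.
have h2 : \sum_(0 <= j' < k) p j'.+2 * x (k - j'.+1)%N <= (1 - p 1%N) * (l + d) + 3 * d.
  apply: le_trans (_ : \sum_(0 <= j' < k) (p j'.+2 * (l + d) + (K <= j')%:R * p j'.+2 * 2) <= _).
    rewrite !big_nat; apply: ler_sum => j' hj'; have [h'|h'] := leqP K j'.
      rewrite mul1r -mulrDr ler_wpM2l //; apply: le_trans (xle _) _; lra.
    rewrite !mul0r addr0 ler_wpM2l // hN1 //; move: hn hk h' hj'; clear; lia.
  rewrite big_split /= -!mulr_suml sum_p //.
  have -> : \sum_(0 <= j' < k) (K <= j')%:R * p j'.+2 = \sum_(K <= j' < k) p j'.+2.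
    rewrite [RHS](big_nat_widenl _ 0) // [RHS]big_mkcond /=; apply: eq_bigr => j' _.
    by case: ifP => _; rewrite ?mul1r ?mul0r.
  have hKk : (K <= k)%N by move: hn hk; clear; lia.
  rewrite sum_p // (renewal_tailS 0) renewal_tail0.
  have := rK k.+1 ltac:(by move: hKk; clear; lia); have := rK K.+1 (leqnSn K).
  have := r_ge0 k.+1; move: (r K.+1) (r k.+1) (p 1%N) => a b c; nra.
rewrite -(ler_pM2l p1); move: h h2; set s := \sum_(_ <= _ < _) _ => h h2.
have := p1_le1; have : 0 <= p 1%N * d by rewrite mulr_ge0 // ltW.
by move: (p 1%N) d5 h h2 => c; rewrite mulrDr !mulrBl mul1r mulrBr; lra.
Qed.

Let Rsum k := \sum_(i < k) r i.

Let Rsum_le k : Rsum k <= C / (1 - q).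
Proof.
by have := geometric_bounded C0 hq r_le 0 k; rewrite expr0 mulr1 big_mkord.
Qed.

(** On a long stretch where [x] is close to [l], the constant [conv r x] is close
    to [l] times the sum of the tails, that is, [l] times the mean of [p]. *)
Lemma renewal_upper x (l : R) : renewal_eq x -> (forall n, `|x n| <= 1) -> `|l| <= 1 ->
  (forall e : R, 0 < e -> exists N, forall n, (N <= n)%N -> x n <= l + e) ->
  (forall e : R, 0 < e -> forall N, exists2 n, (N <= n)%N & l - e <= x n) ->
  forall k, l * Rsum k.+1 <= x 0%N + C / (1 - q) * q ^+ k.+1.
Proof.
move=> hx xB lB hup hlow k.
have /andP[q0 q1] := hq.
have CQ : 0 <= C / (1 - q) by rewrite divr_ge0 // ltW // subr_gt0.
apply/ler_addgt0Pr => e e0.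
pose d := e / (C / (1 - q) + 1).
have D0 : 0 < C / (1 - q) + 1 by rewrite ltr_wpDl.
have d0 : 0 < d by rewrite divr_gt0.
have [n hn h] := renewal_stretch hx xB lB hup hlow k d0 k.
rewrite -(renewal_identity hx n) /conv.
rewrite -(big_mkord xpredT (fun i => r i * x (n - i)%N)) (big_cat_nat _ (n := k.+1)) //=.
have h1 : (l - d) * Rsum k.+1 <= \sum_(0 <= i < k.+1) r i * x (n - i)%N.
  rewrite /Rsum -(big_mkord xpredT r) mulr_sumr !big_nat; apply: ler_sum => i hi.
  by rewrite mulrC ler_wpM2l // h //.
have h2 : - (C / (1 - q) * q ^+ k.+1) <= \sum_(k.+1 <= i < n.+1) r i * x (n - i)%N.
  apply: le_trans (_ : - \sum_(k.+1 <= i < n.+1) r i <= _).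
    by rewrite lerN2; exact: geometric_bounded.
  rewrite -sumrN; apply: ler_sum => i _; rewrite -[leLHS]mulrN1 ler_wpM2l //.
  by have := xB (n - i)%N; rewrite ler_norml => /andP[].
have h3 : d * Rsum k.+1 <= e.
  apply: le_trans (ler_wpM2l (ltW d0) (Rsum_le _)) _.
  by rewrite /d mulrAC ler_pdivrMr // ler_wpM2l ?(ltW e0) // lerDl.
by move: h1 h2 h3; rewrite mulrBl; lra.
Qed.

(** Erdos, Feller and Pollard: both the upper limit of [x] and that of its
    opposite are compared with the mean of [p], so that they coincide. *)
Theorem renewal_theorem g : renewal_eq g -> (forall n, 0 <= g n <= 1) -> g 0%N = 1 ->
  exists2 l : R, 0 < l & g @ \oo --> l.
Proof.
move=> hg g01 g0.
have /andP[q0 q1] := hq.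
have CQ : 0 <= C / (1 - q) by rewrite divr_ge0 // ltW // subr_gt0.
have gB n : `|g n| <= 1 by have /andP[h1 h2] := g01 n; rewrite ger0_norm.
have hN : renewal_eq (fun n => - g n).
  by move=> n; rewrite hg /conv -sumrN; apply: eq_bigr => i _; rewrite mulrN.
have NB n : `|- g n| <= 1 by rewrite normrN.
have [l [lB lup llow]] := bounded_limsup gB.
have [l' [l'B l'up l'low]] := bounded_limsup NB.
have U := renewal_upper hg gB lB lup llow.
have V := renewal_upper hN NB l'B l'up l'low.
have R1 k : 1 <= Rsum k.+1.
  by rewrite /Rsum big_ord_recl renewal_tail0 lerDl sumr_ge0.
have small (e : R) : 0 < e -> exists k, C / (1 - q) * q ^+ k.+1 <= e.
  move=> e0; have [k hk] := @geometric_small R q _ e ltac:(by rewrite (ltW q0) q1) e0 CQ.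
  exists k; apply: le_trans hk; rewrite ler_wpM2l // exprS ler_piMl ?exprn_ge0 //; exact: ltW.
have ll' : l + l' <= 0.
  apply/ler_addgt0Pl => e e0; have [k hk] := small (e / 2) ltac:(lra).
  have := U k; have := V k; have := R1 k; rewrite g0 addr0 => a b c.
  rewrite leNgt; apply/negP => h.
  have : e < (l + l') * Rsum k.+1 by nra.
  by rewrite mulrDl; lra.
have l'neg : l' < 0.
  have [k hk] := small (1 / 2) ltac:(lra).
  have := V k; have := R1 k; rewrite g0 => a b; nra.
exists l.
  have : - l' <= l.
    rewrite leNgt; apply/negP => h.
    have [N1 h1] := lup ((- l' - l) / 3) ltac:(lra).
    have [N2 h2] := l'up ((- l' - l) / 3) ltac:(lra).
    by have := h1 (N1 + N2)%N (leq_addr _ _); have := h2 (N1 + N2)%N (leq_addl _ _); lra.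
  lra.
apply/cvgrPdist_le => /= e e0.
have [N1 h1] := lup e e0; have [N2 h2] := l'up e e0.
exists (N1 + N2)%N => // n /= hn; rewrite ler_norml; apply/andP; split.
  by have := h1 n (leq_trans (leq_addr _ _) hn); lra.
by have := h2 n (leq_trans (leq_addl _ _) hn); lra.
Qed.

End Renewal.

(** * Renewal structure of the language *)

Section FirstCut.
Variables (R : realType) (m : nat) (alpha : R).
Hypothesis alpha_ge0 : 0 <= alpha.

Lemma first_hit (Q : pred nat) s l :
  (has Q (iota s l))%:R = \sum_(i < l) (Q (s + i)%N && all (predC Q) (iota s i))%:R :> R.
Proof.
elim: l => [|l IH]; first by rewrite big_ord0.
rewrite -addn1 iotaD has_cat /= orbF addn1 big_ord_recr /= -IH.
by rewrite all_predC; case: has; case: (Q _); rewrite ?addr0 ?add0r ?andbF.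
Qed.

Definition nocut_in s i u := all (fun c => ~~ cut alpha u c) (iota s (i - s)).

Lemma nocut_in_catl s i x y : lgood alpha y -> (i <= size x)%N ->
  nocut_in s i (x ++ y) = nocut_in s i x.
Proof.
move=> hy hi; apply: eq_in_all => c; rewrite mem_iota => hc.
by rewrite cut_catl //; move: hc hi; clear; lia.
Qed.

(** The first cut splits a word into two parts that can be chosen independently. *)
Lemma count_first_cut s n (P Q Q' : pred (seq nat)) : (s <= n)%N ->
  (forall x y, rgood alpha x -> lgood alpha y -> P (x ++ y) = Q x && Q' y) ->
  count_words m R n (fun u => P u && has (cut alpha u) (iota s (n.+1 - s))) =
  \sum_(i < n.+1 - s)
    count_words m R (s + i) (fun x => [&& Q x, rgood alpha x & nocut_in s (s + i) x]) *
    count_words m R (n - (s + i)) (fun y => Q' y && lgood alpha y).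
Proof.
move=> hs hP; rewrite /count_words.
under eq_bigr => u _ do rewrite -mulnb natrM first_hit mulr_sumr.
rewrite exchange_big /=; apply: eq_bigr => i _.
have hi : (s + i <= n)%N by have := ltn_ord i; move: hs; clear; lia.
rewrite -{1}(subnKC hi).
rewrite -/(count_words _ _ _ _) -(@count_words_cat m R _ _ (fun u => P u &&
  (cut alpha u (s + i) && nocut_in s (s + i) u))).
  by apply: eq_bigr => u _; rewrite -natrM mulnb /nocut_in addKn.
move=> x y /size_words hx _; rewrite -{1}hx cut_size.
have [hr|_] := boolP (rgood alpha x); last by rewrite !andbF.
have [hl|_] := boolP (lgood alpha y); last by rewrite !andbF.
by rewrite hP // nocut_in_catl ?hx //; case: (Q x); case: (Q' y); rewrite ?andbT ?andbF.
Qed.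

End FirstCut.

Section RenewalLanguage.
Variables (R : realType) (m : nat) (f : nat -> R) (alpha : R).
Hypothesis m_gt0 : (0 < m)%N.
Hypothesis f_homo : {homo f : i j / (i <= j)%N >-> i <= j}.
Hypothesis f_ge0 : forall k, 0 <= f k.
Hypothesis alpha_gt : \sum_(1 <= i < m.+1) (i%:R / i.+1%:R) < alpha.
Hypothesis alpha_le : forall k, alpha * k%:R <= f k.
Local Notation L := (lang_card m f).
Local Notation lam := (growth m f).

Lemma alpha_ge0 : 0 <= alpha.
Proof.
by apply: le_trans (ltW alpha_gt); apply: sumr_ge0 => i _; rewrite divr_ge0.
Qed.
Let a0 := alpha_ge0.
Let lam0 : 0 < lam := growth_gt0 m f.

Definition good u := [&& lang f u, lgood alpha u & rgood alpha u].
Definition good_card n := count_words m R n good.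
Definition rgood_card n := count_words m R n (fun u => lang f u && rgood alpha u).
Definition block_card n := count_words m R n (fun u => good u && nocut alpha u).
Definition initial_card n :=
  count_words m R n (fun u => [&& lang f u, rgood alpha u & nocut_in alpha 0 n u]).
Definition cutless_card n :=
  count_words m R n (fun u => lang f u && nocut_in alpha 0 n.+1 u).

Lemma lgood_nil : lgood alpha [::].
Proof. by rewrite /lgood /prefix_bounded /= /line mulr0 addr0 lexx. Qed.

Lemma rgood_nil : rgood alpha [::]. Proof. exact: lgood_nil. Qed.

Lemma lang_catE x y : rgood alpha x -> lgood alpha y -> lang f (x ++ y) = lang f x && lang f y.
Proof.
move=> hx hy; apply/idP/andP => [h|[h1 h2]].
  by split; [exact: lang_catl h|exact: lang_catr h].
exact: (lang_cat f_homo f_ge0 a0 alpha_le).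
Qed.

Lemma lgood_card n : count_words m R n (fun u => lang f u && lgood alpha u) = rgood_card n.
Proof.
rewrite /rgood_card /count_words -big_words_rev; apply: eq_bigr => u _.
by rewrite lang_rev // lgood_rev.
Qed.

Lemma has_cut_size s u : (s <= size u)%N -> rgood alpha u ->
  has (cut alpha u) (iota s ((size u).+1 - s)).
Proof.
move=> hs hu; apply/hasP; exists (size u); first by rewrite mem_iota; move: hs; clear; lia.
by rewrite /cut take_size drop_size hu lgood_nil.
Qed.

(** The end of a good word is one of its cuts, so that the first cut after the
    initial position exists; the part before it is a block. *)
Lemma good_cardS n : good_card n.+1 = conv (fun i => block_card i.+1) good_card n.
Proof.
transitivity (count_words m R n.+1 (fun u => good u && has (cut alpha u) (iota 1 (n.+2 - 1)))).
  apply: eq_count_words => u /size_words hu; rewrite /good.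
  case hr : (rgood alpha u); rewrite ?andbF //.
  by have := @has_cut_size 1 u; rewrite hu => -> //; rewrite ?andbT.
rewrite (@count_first_cut R m alpha a0 1 n.+1 good (fun x => lang f x && lgood alpha x) (fun y => lang f y && rgood alpha y)) //.
  rewrite subn1 /=; apply: eq_bigr => i _; rewrite add1n subSS; congr (_ * _).
    apply: eq_count_words => u /size_words hu.
    by rewrite /good /nocut /nocut_in hu subn1 -!andbA.
  by apply: eq_count_words => u _; rewrite /good andbA andbAC -andbA.
move=> x y hx hy; rewrite /good lang_catE // lgood_catE // rgood_catE //.
by case: (lang f x); case: (lang f y); rewrite ?andbF ?andbT.
Qed.

Lemma rgood_cardE n : rgood_card n = conv initial_card good_card n.
Proof.
transitivity (count_words m R n (fun u => (lang f u && rgood alpha u) && has (cut alpha u) (iota 0 (n.+1 - 0)))).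
  apply: eq_count_words => u /size_words hu.
  case hr : (rgood alpha u); rewrite ?andbF //.
  by have := @has_cut_size 0 u; rewrite hu => -> //; rewrite ?andbT.
rewrite (@count_first_cut R m alpha a0 0 n _ (lang f) (fun y => lang f y && rgood alpha y)) //.
  rewrite subn0 /=; apply: eq_bigr => i _; rewrite add0n; congr (_ * _).
  by apply: eq_count_words => u _; rewrite /good andbA andbAC -andbA.
move=> x y hx hy; rewrite lang_catE // rgood_catE //.
by case: (lang f x); case: (lang f y); rewrite ?andbF ?andbT.
Qed.

Lemma lang_cardE n : L n = cutless_card n + conv initial_card rgood_card n.
Proof.
rewrite -[conv _ _ _](_ : count_words m R n (fun u => lang f u && has (cut alpha u) (iota 0 (n.+1 - 0))) = _).
  rewrite /lang_card /cutless_card /count_words -big_split /=; apply: eq_bigr => u _.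
  rewrite /nocut_in all_predC; case: (lang f u) => /=; last by rewrite addr0.
  by case: (_ || _); rewrite ?addr0 ?add0r.
rewrite (@count_first_cut R m alpha a0 0 n _ (lang f) (lang f)) //.
  by rewrite subn0 /=; apply: eq_bigr => i _; rewrite add0n lgood_card.
by move=> x y hx hy; rewrite lang_catE.
Qed.

Lemma good_cardD n k : good_card n * good_card k <= good_card (n + k).
Proof.
rewrite -(@count_words_cat m R n k (fun u => good (take n u) && good (drop n u))).
  apply: le_count_words => u /size_words hu /andP[/and3P[h1 h2 h3] /and3P[h4 h5 h6]].
  rewrite -(cat_take_drop n u) /good lang_catE // h1 h4 /= lgood_catE // h2.
  by rewrite rgood_catE.
by move=> x y /size_words hx _; rewrite take_size_cat // drop_size_cat.
Qed.

Lemma good_nil : good [::].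
Proof. by rewrite /good lgood_nil rgood_nil (lang_nseq0 f_ge0 0). Qed.

Lemma good_card0 : good_card 0 = 1.
Proof. by rewrite /good_card /count_words big_words0 good_nil. Qed.

Lemma block_card1_gt0 : 0 < block_card 1.
Proof.
apply: lt_le_trans ltr01 _.
have h0 : good [:: 0%N] && nocut alpha [:: 0%N].
  rewrite andbT /good (lang_nseq0 f_ge0 1) /=.
  have h : lgood alpha [:: 0%N].
    by apply/(lgoodP a0) => k; case: k => [|[|k]] /=; rewrite mulr_ge0.
  by rewrite h -lgood_rev h.
rewrite /block_card /count_words (bigD1_seq [:: 0%N]) ?uniq_words ?mem_words //.
by rewrite h0 lerDl sumr_ge0.
Qed.

Definition normalized (x : nat -> R) n := x n / lam ^+ n.

Let lamn n : 0 < lam ^+ n. Proof. exact: exprn_gt0. Qed.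

Lemma normalized_conv x y n : normalized (conv x y) n = conv (normalized x) (normalized y) n.
Proof.
rewrite /normalized /conv mulr_suml; apply: eq_bigr => i _.
by rewrite mulf_div -exprD subnKC // -ltnS.
Qed.

Definition block_law n := normalized (fun k => (k != 0%N)%:R * block_card k) n.

Local Notation g := (normalized good_card).
Local Notation p := block_law.
Local Notation A := (normalized initial_card).
Local Notation B := (normalized cutless_card).
Local Notation rg := (normalized rgood_card).
Local Notation a := (normalized L).

Lemma count_normalized_ge0 n P : 0 <= count_words m R n P / lam ^+ n.
Proof. by rewrite divr_ge0 ?count_words_ge0 // ltW. Qed.

Lemma nocut_cards_small : exists C q : R, [/\ 0 <= C, 0 < q < 1 &
  forall n, [/\ 0 <= p n <= C * q ^+ n, 0 <= A n <= C * q ^+ n & 0 <= B n <= C * q ^+ n]].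
Proof.
have [C [q [C0 hq hC]]] := nocut_rare m_gt0 f_homo f_ge0 alpha_gt.
exists C, q; split => // n.
have key (P : pred (seq nat)) : (forall u, u \in words m n -> P u -> lang f u && nocut alpha u) ->
    count_words m R n P / lam ^+ n <= C * q ^+ n.
  move=> h; rewrite ler_pdivrMr // -mulrA [q ^+ n * _]mulrC.
  exact: le_trans (le_count_words R h) (hC n).
have sub u i j : nocut_in alpha 0 i u -> (size u <= i)%N -> nocut alpha u || (j == 0)%N.
  move=> /allP h hi; apply/orP; left; apply/allP => c; rewrite mem_iota => hc.
  by apply: h; rewrite mem_iota; move: hc hi; clear; lia.
split; apply/andP; split; try exact: count_normalized_ge0.
- by rewrite /p /normalized -mulrA mulr_ge0 // count_normalized_ge0.
- apply: le_trans (_ : block_card n / lam ^+ n <= _).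
    rewrite ler_wpM2r ?invr_ge0 ?(ltW (lamn n)) //.
    by case: (n == 0)%N; rewrite /= ?mul0r ?mul1r // count_words_ge0.
  by apply: key => u _ /andP[/and3P[-> _ _] ->].
- apply: key => u /size_words hu /and3P[-> _ h] /=.
  by have := sub u n 1%N h; rewrite hu leqnn orbF; apply.
- apply: key => u /size_words hu /andP[-> h] /=.
  by have := sub u n.+1 1%N h; rewrite hu leqnSn orbF; apply.
Qed.

Lemma lang_norm_ge1 n : 1 <= a n.
Proof. by rewrite ler_pdivlMr // mul1r growth_le. Qed.

(** The good words are closed under concatenation, so that [g] is
    supermultiplicative: a value above 1 would force a larger growth rate. *)
Lemma good_norm_bounds n : 0 <= g n <= 1.
Proof.
rewrite count_normalized_ge0 /= leNgt; apply/negP => h.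
have n0 : (0 < n)%N.
  by case: n h => //; rewrite /normalized good_card0 expr0 divr1 ltxx.
pose t := expR (ln (g n) / (2 * n%:R)).
have nR : 0 < n%:R :> R by rewrite ltr0n.
have t1 : 1 < t by rewrite expR_gt1 divr_gt0 ?ln_gt0 ?mulr_gt0.
have tn : t ^+ n * t ^+ n = g n.
  rewrite -exprD -expRM_natr addnn -mul2n natrM divfK ?lnK ?posrE //; first exact: lt_trans h.
  by rewrite mulf_neq0 ?gt_eqF.
have [C C0 hC] := lang_card_subexp m f_homo f_ge0 t1.
have tn1 : 1 < t ^+ n by rewrite exprn_egt1 // gt_eqF.
have pw k : g n ^+ k <= g (n * k)%N.
  elim: k => [|k IH]; first by rewrite muln0 /normalized good_card0 expr0 divr1.
  rewrite mulnS exprS; apply: le_trans (_ : g n * g (n * k)%N <= _).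
    by rewrite ler_wpM2l // count_normalized_ge0.
  by rewrite /normalized mulf_div -exprD ler_wpM2r ?invr_ge0 ?(ltW (lamn _)) // good_cardD.
have up k : g n ^+ k <= C * (t ^+ n) ^+ k.
  apply: le_trans (pw k) _; rewrite /normalized ler_pdivrMr // -exprM -mulrA [t ^+ _ * _]mulrC.
  by apply: le_trans (hC _); apply: le_count_words => u _ /and3P[].
have tp : 0 < t ^+ n by exact: lt_trans tn1.
have [k hk] := @geometric_small R (t ^+ n)^-1 C (1 / 2)
  ltac:(by rewrite invr_ge0 (ltW tp) invf_lt1) ltac:(lra) (ltW C0).
have := up k; rewrite -tn exprMn => h1.
have pk : 0 < (t ^+ n) ^+ k by exact: exprn_gt0.
move: hk; rewrite exprVn ler_pdivrMr // => h2; move: pk.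
by move: h1 h2; move: ((t ^+ n) ^+ k) => z; nra.
Qed.

Lemma renewal_eq_good : renewal_eq p g.
Proof.
move=> n; rewrite /normalized good_cardS /p /normalized /conv mulr_suml.
apply: eq_bigr => i _; rewrite mul1r mulf_div -exprD; congr (_ / lam ^+ _).
by have := ltn_ord i; clear; lia.
Qed.

(** Since the normalized cardinality of the language is at least 1, its
    decomposition at the first and the last cut makes [g] non summable. *)
Lemma good_norm_unbounded (M : R) : exists Q, M < \sum_(n < Q) g n.
Proof.
have [C [q [C0 hq hC]]] := nocut_cards_small.
apply: contrapT => hno.
have Mle Q : \sum_(n < Q) g n <= M.
  by rewrite leNgt; apply/negP => h; apply: hno; exists Q.
have Ale n : A n <= C * q ^+ n by have [_ /andP[]] := hC n.
have Ble n : B n <= C * q ^+ n by have [_ _ /andP[]] := hC n.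
pose D := C / (1 - q).
have D0 : 0 <= D by case/andP: hq => q0 q1; rewrite divr_ge0 // ltW // subr_gt0.
have sA Q : \sum_(n < Q) A n <= D.
  by have := geometric_bounded C0 hq Ale 0 Q; rewrite expr0 mulr1 big_mkord.
have sB Q : \sum_(n < Q) B n <= D.
  by have := geometric_bounded C0 hq Ble 0 Q; rewrite expr0 mulr1 big_mkord.
have A0 : forall n, 0 <= A n by move=> n; exact: count_normalized_ge0.
have g0 : forall n, 0 <= g n by move=> n; exact: count_normalized_ge0.
have rg0 : forall n, 0 <= rg n by move=> n; exact: count_normalized_ge0.
have M0 : 0 <= M by apply: le_trans (Mle 0%N); rewrite big_ord0.
have rgE n : rg n = conv A g n by rewrite -normalized_conv /normalized rgood_cardE.
have srg Q : \sum_(n < Q) rg n <= D * M.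
  under eq_bigr => n _ do rewrite rgE.
  by apply: le_trans (sum_conv_le _ A0 g0) _; apply: ler_pM => //; apply: sumr_ge0.
have sa Q : \sum_(n < Q) a n <= D + D * (D * M).
  have aE n : a n = B n + conv A rg n by rewrite -normalized_conv /normalized lang_cardE mulrDl.
  under eq_bigr => n _ do rewrite aE.
  rewrite big_split /=; apply: lerD; first exact: sB.
  apply: le_trans (sum_conv_le _ A0 rg0) _.
  by apply: ler_pM => //; apply: sumr_ge0.
pose Q := (Num.truncn (D + D * (D * M))).+1.
have : Q%:R <= \sum_(n < Q) a n.
  rewrite -[X in X%:R]card_ord -sumr_const ler_sum // => i _; exact: lang_norm_ge1.
move=> /le_trans /(_ (sa Q)); rewrite leNgt => /negP; apply.
exact: truncnS_gt.
Qed.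

Lemma block_law0 : p 0%N = 0.
Proof. by rewrite /p /normalized mul0r mul0r. Qed.
Let p0 := block_law0.

(** In the identity [conv r g = 1], a tail bounded away from 0 on the negative side,
    or above the geometric bound, would be multiplied by the divergent sum of
    [g]. The total mass of [p] is thus 1, and its tails are geometric. *)
Lemma renewal_tail_small : exists C q : R, [/\ 0 <= C, 0 < q < 1 &
  forall k, 0 <= renewal_tail p k <= C * q ^+ k].
Proof.
have [C [q [C0 hq hC]]] := nocut_cards_small.
have /andP[q0 q1] := hq.
have ple n : p n <= C * q ^+ n by have [/andP[]] := hC n.
have p_ge0 n : 0 <= p n by have [/andP[]] := hC n.
pose D := C / (1 - q).
have D0 : 0 <= D by rewrite divr_ge0 // ltW // subr_gt0.
have idn := renewal_identity p0 renewal_eq_good.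
have g01 := good_norm_bounds.
have g0 : forall n, 0 <= g n by move=> n; exact: count_normalized_ge0.
have g0E : g 0%N = 1 by rewrite /normalized good_card0 expr0 divr1.
have rmono k l : (k <= l)%N -> renewal_tail p l <= renewal_tail p k.
  move=> h; rewrite -(subnKC h); elim: (l - k)%N => [|j IH]; first by rewrite addn0.
  by rewrite addnS renewal_tailS; apply: le_trans IH; rewrite gerBl.
have rle1 k : renewal_tail p k <= 1.
  by rewrite -(renewal_tail0 p0); exact: rmono.
have splitg k Q : 1 = \sum_(i < k) renewal_tail p i * g (k + Q - i)%N +
    \sum_(j < Q.+1) renewal_tail p (k + (Q - j))%N * g j.
  rewrite -g0E -(idn (k + Q)%N) /conv -addnS big_split_ord /=; congr (_ + _).
  rewrite (reindex_inj rev_ord_inj) /=; apply: eq_bigr => j _.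
  by rewrite subSS subnDl subKn // -ltnS.
have gS Q : \sum_(n < Q) g n <= \sum_(n < Q.+1) g n by rewrite big_ord_recr /= lerDl.
have tail0 k : 0 <= renewal_tail p k.
  rewrite leNgt; apply/negP => h.
  pose e := - renewal_tail p k; have e0 : 0 < e by rewrite oppr_gt0.
  have [Q hQ] := good_norm_unbounded (k%:R / e).
  have h1 : \sum_(i < k) renewal_tail p i * g (k + Q - i)%N <= k%:R.
    rewrite -[X in X%:R]card_ord -sumr_const ler_sum // => i _.
    have /andP[ga gb] := g01 (k + Q - i)%N.
    by apply: le_trans (ler_wpM2r ga (rle1 i)) _; rewrite mul1r.
  have h2 : \sum_(j < Q.+1) renewal_tail p (k + (Q - j))%N * g j <= - (e * \sum_(n < Q.+1) g n).
    rewrite mulr_sumr -sumrN ler_sum // => j _.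
    by rewrite -mulNr ler_wpM2r // /e opprK rmono // leq_addr.
  have := splitg k Q; move: hQ; rewrite ltr_pdivrMr // mulrC => hQ.
  have := ler_wpM2l (ltW e0) (gS Q); lra.
exists D, q; split => // k; rewrite tail0 /= leNgt; apply/negP => h.
pose e := renewal_tail p k - D * q ^+ k; have e0 : 0 < e by rewrite subr_gt0.
have low n : e <= renewal_tail p (k + n)%N.
  have tE j : renewal_tail p (k + j)%N = renewal_tail p k - \sum_(k.+1 <= i < k.+1 + j) p i.
    elim: j => [|j IH]; first by rewrite !addn0 big_geq // subr0.
    have -> : \sum_(k.+1 <= i < k.+1 + j.+1) p i =
        \sum_(k.+1 <= i < k.+1 + j) p i + p (k + j.+1)%N.
      by rewrite addnS big_nat_recr ?leq_addr // addSnnS.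
    by rewrite addnS renewal_tailS IH opprD addrA.
  rewrite tE /e lerD2l lerN2; apply: le_trans (geometric_bounded C0 hq ple _ _) _.
  by rewrite ler_wpM2l // exprS ler_piMl ?exprn_ge0 // ltW.
have [Q hQ] := good_norm_unbounded (1 / e).
have h1 : 0 <= \sum_(i < k) renewal_tail p i * g (k + Q - i)%N.
  by apply: sumr_ge0 => i _; rewrite mulr_ge0.
have h2 : e * \sum_(n < Q.+1) g n <= \sum_(j < Q.+1) renewal_tail p (k + (Q - j))%N * g j.
  by rewrite mulr_sumr ler_sum // => j _; rewrite ler_wpM2r.
have := splitg k Q; move: hQ; rewrite ltr_pdivrMr // mulrC => hQ.
have := ler_wpM2l (ltW e0) (gS Q); lra.
Qed.

(** The renewal theorem applies to the good words, and the other two sequences are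
    obtained from them by convolution with summable sequences. *)
Theorem renewal_limits : exists l r : R,
  [/\ 0 < l, g @ \oo --> l, rg @ \oo --> r & a @ \oo --> r ^+ 2 / l].
Proof.
have [C [q [C0 hq hC]]] := nocut_cards_small.
have [C' [q' [C'0 hq' hC']]] := renewal_tail_small.
have p_ge0 n : 0 <= p n by have [/andP[]] := hC n.
have p1 : 0 < p 1%N by rewrite /p /normalized mul1r divr_gt0 // block_card1_gt0.
have g0E : g 0%N = 1 by rewrite /normalized good_card0 expr0 divr1.
have [l l0 gl] := renewal_theorem p0 p_ge0 p1 hC' C'0 hq' renewal_eq_good good_norm_bounds g0E.
have hA n : 0 <= A n <= C * q ^+ n by have [] := hC n.
have hB n : 0 <= B n <= C * q ^+ n by have [] := hC n.
have [X hX] := summable_cvg C0 hq hA.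
have rgE : rg = conv A g.
  by apply/funext => n; rewrite -normalized_conv /normalized rgood_cardE.
have rgl : rg @ \oo --> X * l.
  rewrite rgE; apply: (conv_cvg C0 hq hA (B := 1)) => // n.
  by have /andP[h1 h2] := good_norm_bounds n; rewrite ger0_norm.
have B0 : B @ \oo --> 0.
  apply: (squeeze_cvgr (f := fun=> 0) (h := fun n => C * q ^+ n)).
  - by apply: nearW.
  - exact: cvg_cst.
  - rewrite -[X in _ --> X](mulr0 C); apply: cvgMr; apply: cvg_expr.
    by case/andP: hq => h1 h2; rewrite ger0_norm // ltW.
have [M hM] : exists M : R, forall n, `|rg n| <= M.
  exists (C / (1 - q)) => n; rewrite ger0_norm ?count_normalized_ge0 // rgE /conv.
  have Ale k : A k <= C * q ^+ k by have /andP[] := hA k.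
  have := geometric_bounded C0 hq Ale 0 n.+1; rewrite expr0 mulr1 big_mkord; apply: le_trans.
  apply: ler_sum => i _; have /andP[h1 h2] := good_norm_bounds (n - i)%N.
  by rewrite ler_piMr // count_normalized_ge0.
exists l, (X * l); split => //.
have -> : a = (fun n => B n + conv A rg n).
  by apply/funext => n; rewrite -normalized_conv /normalized lang_cardE mulrDl.
have -> : (X * l) ^+ 2 / l = 0 + X * (X * l) by field; rewrite gt_eqF.
by apply: cvgD => //; exact: (conv_cvg C0 hq hA (B := M)).
Qed.

Lemma lang_card_le : exists2 C : R, 1 <= C & forall n, L n <= C * lam ^+ n.
Proof.
have [l [r [_ _ _ al]]] := renewal_limits.
have /cvg_seq_bounded[M [_ hM]] : cvgn a by apply/cvg_ex; eexists; exact: al.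
exists (`|M| + 1) => [|n]; first by rewrite lerDr.
rewrite -ler_pdivrMr //; apply: le_trans (ler_norm _) _.
by apply: (hM (`|M| + 1)) => //; rewrite ltr_pwDr // ler_norm.
Qed.

End RenewalLanguage.

(** * Concentration of frequencies *)

Section Limits.

Lemma cvg_nat_infty (phi : nat -> nat) A : (forall S, S - A <= phi S)%N -> phi @ \oo --> \oo.
Proof.
move=> h P [N _ hN]; exists (N + A)%N => // S /= hS; apply: hN => /=.
by apply: leq_trans (h S); move: hS; clear; lia.
Qed.

Lemma cvg_eq_from (R : realType) (x y : nat -> R) (l : R) N :
  (forall n, (N <= n)%N -> x n = y n) -> y @ \oo --> l -> x @ \oo --> l.
Proof.
move=> h /cvgrPdist_le hy; apply/cvgrPdist_le => e e0.
have [M _ hM] := hy e e0; exists (N + M)%N => // n /= hn.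
by rewrite h; [apply: hM => /=|]; move: hn; clear; lia.
Qed.

End Limits.

Section Concentration.
Variables (R : realType) (m : nat) (f : nat -> R) (alpha : R).
Hypothesis m_gt0 : (0 < m)%N.
Hypothesis f_homo : {homo f : i j / (i <= j)%N >-> i <= j}.
Hypothesis f_ge0 : forall k, 0 <= f k.
Hypothesis alpha_gt : \sum_(1 <= i < m.+1) (i%:R / i.+1%:R) < alpha.
Hypothesis alpha_le : forall k, alpha * k%:R <= f k.
Local Notation L := (lang_card m f).
Local Notation lam := (growth m f).
Local Notation cut := (cut alpha).
Local Notation good := (good f alpha).
Local Notation G := (good_card m f alpha).
Local Notation rc := (rgood_card m f alpha).

Let a0 : 0 <= alpha. Proof. exact: (alpha_ge0 alpha_gt). Qed.
Let lam0 : 0 < lam := growth_gt0 m f.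
Let langE x y : rgood alpha x -> lgood alpha y -> lang f (x ++ y) = lang f x && lang f y.
Proof. exact: (lang_catE f_homo f_ge0 alpha_gt alpha_le). Qed.

(** The factor runs from the last cut before the gap to the first one after it, or
    from an end of the word. *)
Lemma nocut_between u i K : (i + K <= size u)%N -> ~~ has (cut u) (iota i K.+1) ->
  exists j e, [/\ (j <= i)%N, (i + K <= e <= size u)%N &
    nocut alpha (take (e - j) (drop j u))].
Proof.
move=> hi /hasPn hno.
have noc c : (i <= c <= i + K)%N -> ~~ cut u c.
  by move=> hc; apply: hno; rewrite mem_iota; move: hc; clear; lia.
pose P c := ((c == 0) || cut u c)%N && (c <= i)%N.
have [|c /andP[_ //]|j /andP[hPj hji] jmax] := @ex_maxnP P i; first by exists 0%N; rewrite /P eqxx leq0n.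
pose Q c := ((c == size u) || cut u c) && (i + K <= c)%N.
have [|e /andP[hQe hie] emin] := @ex_minnP Q; first by exists (size u); rewrite /Q eqxx hi.
have esz : (e <= size u)%N by apply: emin; rewrite /Q eqxx hi.
exists j, e; split => //; first by rewrite hie esz.
have inner c : (j < c < e)%N -> ~~ cut u c.
  move=> /andP[hjc hce]; apply/negP => hc.
  have [h1|h1] := leqP c i.
    by have := jmax c; rewrite /P hc orbT h1 => /(_ isT); rewrite leqNgt hjc.
  have [h2|h2] := leqP (i + K) c.
    by have := emin c; rewrite /Q hc orbT h2 => /(_ isT); rewrite leqNgt hce.
  by have := noc c; rewrite hc (ltnW h1) (ltnW h2) => /(_ isT).
have je : (j <= e)%N by move: hji hie; clear; lia.
have uE : u = take j u ++ (take (e - j) (drop j u) ++ drop e u).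
  by rewrite -{2}(subnK je) -drop_drop !cat_take_drop.
have sj : size (take j u) = j by rewrite size_takel //; exact: leq_trans je esz.
have sw : size (take (e - j) (drop j u)) = (e - j)%N.
  by rewrite size_takel // size_drop leq_sub2r.
have hx : rgood alpha (take j u).
  by case/orP: hPj => [/eqP ->|/andP[//]]; rewrite take0 rgood_nil.
have hy : lgood alpha (drop e u).
  by case/orP: hQe => [/eqP ->|/andP[_ //]]; rewrite drop_size lgood_nil.
apply/allP => c; rewrite mem_iota sw => hc; apply/negP => hcut.
have hc' : (c <= size (take (e - j) (drop j u)))%N by rewrite sw; move: hc; clear; lia.
have : cut (take j u ++ (take (e - j) (drop j u) ++ drop e u)) (size (take j u) + c).
  by rewrite cut_catr // cut_catl.
by rewrite -uE sj; apply/negP; apply: inner; move: hc; clear; lia.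
Qed.

(** The cutless factor around the gap has length at least [K], and summing over its
    two ends gives a product of two geometric series. *)
Lemma gap_rare (eta : R) : 0 < eta -> exists K, forall N i, (i + K <= N)%N ->
  count_words m R N (fun u => lang f u && ~~ has (cut u) (iota i K.+1)) <= eta * lam ^+ N.
Proof.
move=> eta0.
have [C C1 hC] := lang_card_le m_gt0 f_homo f_ge0 alpha_gt alpha_le.
have [D [q [D0 hq hD]]] := nocut_rare m_gt0 f_homo f_ge0 alpha_gt.
have /andP[q0 q1] := hq.
have C0 : 0 <= C by lra.
pose M := C * C * D * ((1 - q)^-1 * (1 - q)^-1).
have q1' : 0 < 1 - q by lra.
have M0 : 0 <= M by rewrite !mulr_ge0 // invr_ge0 ltW.
have [K hK] := @geometric_small R q M eta ltac:(by rewrite (ltW q0) q1) eta0 M0.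
exists K => N i hi.
pose nc w := lang f w && nocut alpha w.
apply: le_trans (_ : \sum_(j < i.+1) \sum_(i + K <= e < N.+1)
   L j * (count_words m R (e - j) nc * L (N - e)) <= _).
  apply: le_trans (_ : \sum_(u <- words m N) \sum_(j < i.+1) \sum_(i + K <= e < N.+1)
     ((lang f (take j u))%:R * ((nc (take (e - j) (drop j u)))%:R * (lang f (drop e u))%:R)) <= _).
    rewrite /count_words !big_seq; apply: ler_sum => u hu; have su := size_words hu.
    have pos j e : 0 <= ((lang f (take j u))%:R * ((nc (take (e - j) (drop j u)))%:R * (lang f (drop e u))%:R)) :> R.
      by rewrite !mulr_ge0.
    have [hl|_] := boolP (lang f u); last by apply: sumr_ge0 => j _; apply: sumr_ge0.
    have [_|hno] := boolP (has (cut u) (iota i K.+1)).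
      by apply: sumr_ge0 => j _; apply: sumr_ge0.
    rewrite mulr1n.
    have [j [e [hj /andP[he1 he2] hn]]] := @nocut_between u i K ltac:(by rewrite su) hno.
    have hj' : (j < i.+1)%N by [].
    rewrite (bigD1 (Ordinal hj')) //= (bigD1_seq e) ?iota_uniq //=; last first.
      by rewrite mem_index_iota he1 ltnS -su.
    rewrite /nc hn !lang_drop ?lang_take ?lang_drop // !mul1r -addrA lerDl addr_ge0 ?sumr_ge0 // => k _.
    by rewrite sumr_ge0.
  rewrite exchange_big /=; apply: ler_sum => j _; rewrite exchange_big /= !big_nat.
  apply: ler_sum => e /andP[he1 he2].
  have hj := ltn_ord j.
  have eN : N = (j + ((e - j) + (N - e)))%N by move: he1 he2 hj; clear; lia.
  rewrite {1}eN big_words_cat /lang_card {1}/count_words mulr_suml !big_seq.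
  apply: ler_sum => x /size_words hx.
  rewrite big_words_cat /count_words mulr_suml mulr_sumr big_seq [leRHS]big_seq; apply: ler_sum => w /size_words hw.
  rewrite !mulr_sumr; apply: ler_sum => y _.
  rewrite take_size_cat // drop_size_cat // take_size_cat //.
  have -> : drop e (x ++ w ++ y) = y; last by [].
  by rewrite catA drop_size_cat // size_cat hx hw; move: he1 hj; clear; lia.
apply: le_trans (_ : \sum_(j < i.+1) \sum_(i + K <= e < N.+1)
    (C * C * D * lam ^+ N) * (q ^+ (i - j) * q ^+ (e - i)) <= _).
  apply: ler_sum => j _; rewrite !big_nat; apply: ler_sum => e /andP[he1 he2].
  have hj := ltn_ord j.
  have eN : (N = j + ((e - j) + (N - e)))%N by move: he1 he2 hj; clear; lia.
  have -> : q ^+ (i - j) * q ^+ (e - i) = q ^+ (e - j).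
    by rewrite -exprD; congr (q ^+ _); move: he1 hj; clear; lia.
  apply: le_trans (_ : (C * lam ^+ j) * ((D * (lam ^+ (e - j) * q ^+ (e - j))) * (C * lam ^+ (N - e))) <= _).
    apply: ler_pM; rewrite ?mulr_ge0 ?count_words_ge0 //.
    by apply: ler_pM; rewrite ?count_words_ge0.
  rewrite [in leRHS]eN !exprD le_eqVlt; apply/orP; left; apply/eqP; ring.
under eq_bigr => j _ do rewrite -mulr_sumr -mulr_sumr.
rewrite -mulr_sumr -mulr_suml.
have s1 : \sum_(j < i.+1) q ^+ (i - j) <= (1 - q)^-1.
  rewrite (reindex_inj rev_ord_inj) /=.
  under eq_bigr => j _ do rewrite subSS subKn -1?ltnS //.
  rewrite -(big_mkord xpredT (fun j => q ^+ j)).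
  by apply: le_trans (geometric_tail _ _ _) _; rewrite ?(ltW q0) ?q1 // expr0 mul1r.
have s2 : \sum_(i + K <= e < N.+1) q ^+ (e - i) <= q ^+ K * (1 - q)^-1.
  rewrite addnC big_addn; under eq_bigr => e _ do rewrite addnK.
  by apply: geometric_tail; rewrite (ltW q0) q1.
apply: le_trans (_ : C * C * D * lam ^+ N * ((1 - q)^-1 * (q ^+ K * (1 - q)^-1)) <= _).
  rewrite ler_wpM2l ?mulr_ge0 ?exprn_ge0 ?(ltW lam0) //.
  by apply: ler_pM => //; apply: sumr_ge0 => j _; rewrite exprn_ge0 // ltW.
apply: le_trans (_ : (M * q ^+ K) * lam ^+ N <= _); last by rewrite ler_wpM2r // exprn_ge0 // ltW.
rewrite /M le_eqVlt; apply/orP; left; apply/eqP; ring.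
Qed.

(** ** Occurrences between two cuts *)

Definition hit i q (T : pred (seq nat)) u :=
  [&& cut u i, cut u (i + q) & T (take q (drop i u))].

Definition pattern_card q (T : pred (seq nat)) := count_words m R q (fun v => good v && T v).

Lemma left_hit_card i q T :
  count_words m R (i + q) (fun u => [&& lang f u, rgood alpha u, cut u i & T (drop i u)]) =
  rc i * pattern_card q T.
Proof.
apply: count_words_cat => x v /size_words hx _; rewrite -hx cut_size drop_size_cat //.
have [hr|_] := boolP (rgood alpha x); last by rewrite !andbF.
rewrite rgood_catE // /good; case hl: (lgood alpha v); last by rewrite !andbF.
by rewrite langE // !andbA; congr (_ && _); case: (lang f x); case: (lang f v); rewrite ?andbT ?andbF.
Qed.

Lemma right_hit_card q e T :
  count_words m R (q + e) (fun w => [&& lang f w, lgood alpha w, cut w q & T (take q w)]) =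
  pattern_card q T * rc e.
Proof.
rewrite -(lgood_card m alpha f_homo f_ge0).
apply: count_words_cat => v y /size_words hv _; rewrite -hv cut_size take_size_cat //.
have [hl|_] := boolP (lgood alpha y); last by rewrite !andbF.
rewrite lgood_catE // /good; case hr: (rgood alpha v); last by rewrite !andbF.
rewrite langE //; case: (lang f v); case: (lang f y); case: (lgood alpha v); rewrite ?andbT ?andbF //.
Qed.

Lemma hit_right i q T x w : size x = i -> rgood alpha x -> lgood alpha w -> (q <= size w)%N ->
  hit i q T (x ++ w) = cut w q && T (take q w).
Proof.
move=> hx hr hl hq; rewrite /hit -hx cut_size hr hl cut_catr //= drop_size_cat //.
Qed.

Lemma middle_hit_card i q e T :
  count_words m R (i + (q + e)) (fun w => [&& lang f w, lgood alpha w & hit i q T w]) =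
  G i * (pattern_card q T * rc e).
Proof.
rewrite -right_hit_card; apply: count_words_cat => x w /size_words hx /size_words hw.
have [/andP[hr hl]|h] := boolP (rgood alpha x && lgood alpha w); last first.
  rewrite {1}/hit -{1}hx cut_size (negbTE h) !andbF /good.
  by move: h; rewrite negb_and => /orP[] /negbTE ->; rewrite ?andbF.
rewrite hit_right ?hw ?leq_addr // langE // lgood_catE // /good hr hl.
by case: (lang f x); case: (lang f w); case: (lgood alpha x); rewrite ?andbT ?andbF.
Qed.

Lemma hit_card i q e T :
  count_words m R (i + (q + e)) (fun w => lang f w && hit i q T w) =
  rc i * (pattern_card q T * rc e).
Proof.
rewrite -right_hit_card; apply: count_words_cat => x w /size_words hx /size_words hw.
have [/andP[hr hl]|h] := boolP (rgood alpha x && lgood alpha w); last first.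
  rewrite {1}/hit -{1}hx cut_size (negbTE h) !andbF.
  by move: h; rewrite negb_and => /orP[] /negbTE ->; rewrite ?andbF.
rewrite hit_right ?hw ?leq_addr // langE // hr hl.
by case: (lang f x); case: (lang f w); rewrite ?andbT ?andbF.
Qed.

(** The four cuts decouple the two patterns, the word between them and the two ends. *)
Lemma two_hits_card i q g q' e T T' :
  count_words m R ((i + q) + (g + (q' + e)))
    (fun u => [&& lang f u, hit i q T u & hit (i + q + g) q' T' u]) =
  (rc i * pattern_card q T) * (G g * (pattern_card q' T' * rc e)).
Proof.
rewrite -left_hit_card -middle_hit_card; apply: count_words_cat => x w /size_words hx /size_words hw.
have [/andP[hr hl]|h] := boolP (rgood alpha x && lgood alpha w); last first.
  rewrite {1}/hit -{1}hx cut_size (negbTE h) !andbF.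
  by move: h; rewrite negb_and => /orP[] /negbTE ->; rewrite ?andbF.
have -> : hit (i + q + g) q' T' (x ++ w) = hit g q' T' w.
  rewrite /hit -hx -(addnA (size x)) !cut_catr //.
  by rewrite [(size x + g)%N]addnC -drop_drop drop_size_cat.
have -> : hit i q T (x ++ w) = cut x i && T (drop i x).
  rewrite /hit -hx cut_size hr hl /= cut_catl //; last by rewrite hx leq_addr.
  rewrite drop_cat hx; case: ltnP => hq.
    by rewrite takel_cat ?take_oversize // size_drop hx addKn.
  have q0 : q = 0%N by move: hq; clear; lia.
  by rewrite q0 take0 drop_oversize // hx q0 addn0.
rewrite langE // hr hl.
by case: (lang f x); case: (lang f w); rewrite ?andbT ?andbF.
Qed.

(** ** A law of large numbers for the uniform distribution *)

Variables (s : seq nat) (K : nat).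
Local Notation k := (size s).

Definition occurs i u := take k (drop i u) == s.

Definition framed i u :=
  [&& occurs i u, has (fun c => cut u (i - c)) (iota 0 K.+1) &
      has (fun c => cut u (i + k + c)) (iota 0 K.+1)].

Definition frame_test (p : 'I_K.+1 * 'I_K.+1) v :=
  [&& occurs p.1 v, all (fun c => ~~ cut v (p.1 - c)) (iota 0 p.1) &
      all (fun c => ~~ cut v (p.1 + k + c)) (iota 0 p.2)].

Definition frame_size (p : 'I_K.+1 * 'I_K.+1) := (p.1 + k + p.2)%N.

(** The nearest cuts on both sides of an occurrence are unique, so that the frames
    are disjoint events. *)
Lemma framedE i u : (K <= i)%N -> (i + k + K <= size u)%N ->
  (framed i u)%:R = \sum_(p : 'I_K.+1 * 'I_K.+1)
     (hit (i - p.1) (frame_size p) (frame_test p) u)%:R :> R.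
Proof.
move=> hi hu; rewrite /framed -mulnb natrM -mulnb natrM.
rewrite (first_hit R (fun c => cut u (i - c)) 0) (first_hit R (fun c => cut u (i + k + c)) 0).
rewrite mulr_suml mulr_sumr.
under eq_bigr => a _ do rewrite !mulr_sumr.
rewrite pair_big /=; apply: eq_bigr => p _; rewrite !add0n.
have h1 := ltn_ord p.1; have h2 := ltn_ord p.2.
rewrite -!natrM !mulnb; congr (_%:R); congr nat_of_bool.
have e1 : (i - p.1 + frame_size p = i + k + p.2)%N.
  by rewrite /frame_size; move: hi h1; clear; lia.
rewrite /hit e1.
have [c1|_] := boolP (cut u (i - p.1)); last by rewrite !andbF.
have [c2|_] := boolP (cut u (i + k + p.2)); last by rewrite !andbF.
rewrite !andTb; set x := take (i - p.1) u; set y := drop (i + k + p.2) u.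
set v := take _ _.
have uE : u = x ++ (v ++ y).
  by rewrite /x /v /y -e1 addnC -drop_drop !cat_take_drop.
have sx : size x = (i - p.1)%N by rewrite size_takel //; move: hu; clear; lia.
have sv : size v = frame_size p.
  have hb : (i - p.1 + frame_size p <= size u)%N by rewrite e1; move: hu h2; clear; lia.
  have hb' : (frame_size p <= size (drop (i - p.1) u))%N.
    by rewrite size_drop; move: hb; clear; move: (i - p.1)%N (frame_size p) (size u) => a b c; lia.
  exact: size_takel.
have hx : rgood alpha x by have /andP[] := c1.
have hy : lgood alpha y by have /andP[] := c2.
have cutE c : (c <= frame_size p)%N -> cut u (i - p.1 + c) = cut v c.
  by move=> hc; rewrite {1}uE -sx cut_catr // cut_catl // sv.
rewrite /frame_test; congr [&& _, _ & _].
- rewrite /occurs /v [take k (drop p.1 _)]take_drop take_takel; last first.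
    by rewrite /frame_size; clear; lia.
  by rewrite -take_drop drop_drop subnKC //; move: h1 hi; clear; lia.
- apply: eq_in_all => c; rewrite mem_iota => hc /=; rewrite -cutE.
    by congr (~~ cut _ _); move: hc h1 hi; clear; lia.
  by rewrite /frame_size; move: hc; clear; lia.
- apply: eq_in_all => c; rewrite mem_iota => hc /=; rewrite -cutE.
    by congr (~~ cut _ _); move: hc h1 hi; clear; lia.
  by rewrite /frame_size; move: hc; clear; lia.
Qed.

Definition pattern_freq (p : 'I_K.+1 * 'I_K.+1) :=
  pattern_card (frame_size p) (frame_test p) / lam ^+ frame_size p.

Let lamn n : lam ^+ n != 0. Proof. by rewrite gt_eqF // exprn_gt0. Qed.

Lemma framed_card i N : (K <= i)%N -> (i + k + K <= N)%N ->
  count_words m R N (fun u => lang f u && framed i u) / lam ^+ N =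
  \sum_(p : 'I_K.+1 * 'I_K.+1) normalized m f rc (i - p.1) * (pattern_freq p * normalized m f rc (N - (i + k + p.2))).
Proof.
move=> hi hN.
have -> : count_words m R N (fun u => lang f u && framed i u) =
    \sum_(p : 'I_K.+1 * 'I_K.+1) count_words m R N (fun u => lang f u && hit (i - p.1) (frame_size p) (frame_test p) u).
  rewrite exchange_big /= /count_words !big_seq; apply: eq_bigr => u /size_words hu.
  rewrite -mulnb natrM framedE ?hu // mulr_sumr.
  by apply: eq_bigr => p _; rewrite -natrM mulnb.
rewrite mulr_suml; apply: eq_bigr => p _.
have h1 := ltn_ord p.1; have h2 := ltn_ord p.2.
have eN : N = (i - p.1 + (frame_size p + (N - (i + k + p.2))))%N.
  by rewrite /frame_size; move: hi hN h1 h2; clear; move: (nat_of_ord p.1) (nat_of_ord p.2) k => a b c; lia.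
rewrite {1 2}eN hit_card (exprD _ (i - p.1)) (exprD _ (frame_size p)) /normalized /pattern_freq.
by field; rewrite !lamn.
Qed.

Lemma two_framed_card i j N : (K <= i)%N -> (i + k + K + K <= j)%N -> (j + k + K <= N)%N ->
  count_words m R N (fun u => [&& lang f u, framed i u & framed j u]) / lam ^+ N =
  \sum_(p : 'I_K.+1 * 'I_K.+1) \sum_(p' : 'I_K.+1 * 'I_K.+1) normalized m f rc (i - p.1) * (pattern_freq p *
     (normalized m f G (j - p'.1 - (i + k + p.2)) *
       (pattern_freq p' * normalized m f rc (N - (j + k + p'.2))))).
Proof.
move=> hi hij hN.
have -> : count_words m R N (fun u => [&& lang f u, framed i u & framed j u]) =
    \sum_(p : 'I_K.+1 * 'I_K.+1) \sum_(p' : 'I_K.+1 * 'I_K.+1) count_words m R N (fun u => [&& lang f u,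
      hit (i - p.1) (frame_size p) (frame_test p) u &
      hit (j - p'.1) (frame_size p') (frame_test p') u]).
  under [RHS]eq_bigr => p _ do rewrite exchange_big /=.
  rewrite exchange_big /= /count_words !big_seq; apply: eq_bigr => u /size_words hu.
  rewrite -mulnb natrM -mulnb natrM !framedE ?hu //; last 2 first.
  - by move: hij hi; clear; lia.
  - by move: hij hN; clear; lia.
  rewrite mulr_suml mulr_sumr; apply: eq_bigr => p _; rewrite !mulr_sumr.
  by apply: eq_bigr => p' _; rewrite -!natrM !mulnb.
rewrite mulr_suml; apply: eq_bigr => p _; rewrite mulr_suml; apply: eq_bigr => p' _.
have h1 := ltn_ord p.1; have h2 := ltn_ord p.2.
have h1' := ltn_ord p'.1; have h2' := ltn_ord p'.2.
set gap := (j - p'.1 - (i + k + p.2))%N.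
have ej : (j - p'.1 = i - p.1 + frame_size p + gap)%N.
  rewrite /gap /frame_size; move: hi hij h1 h2 h1'; clear.
  by move: (nat_of_ord p.1) (nat_of_ord p.2) (nat_of_ord p'.1) k => a b c d; lia.
have eN : N = ((i - p.1 + frame_size p) + (gap + (frame_size p' + (N - (j + k + p'.2)))))%N.
  rewrite addnA -ej /frame_size; move: hi hij hN h1' h2'; clear.
  by move: (nat_of_ord p'.1) (nat_of_ord p'.2) k => a b c; lia.
rewrite {1 2}eN ej two_hits_card (exprD _ (_ + _)%N) (exprD _ gap) (exprD _ (i - p.1)).
rewrite (exprD _ (frame_size p')) /normalized /pattern_freq.
by field; rewrite !lamn.
Qed.

(** At [Q] positions of spacing [S], counts of framed occurrences are products of
    terms of the convergent renewal sequences. Two distinct positions thus become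
    uncorrelated as [S] grows, and only the [Q] diagonal terms contribute to the
    variance. *)
Lemma second_moment_cvg Q : (0 < Q)%N -> exists a c : R, [/\ 0 < a,
  normalized m f L @ \oo --> a &
  (fun S => (\sum_(u <- words m (Q.+1 * S)) (lang f u)%:R *
     (Q%:R^-1 * \sum_(j < Q) (framed (j.+1 * S) u)%:R - c) ^+ 2) / lam ^+ (Q.+1 * S))
    @ \oo --> a * (c - c ^+ 2) / Q%:R].
Proof.
move=> Q0.
have [l [r [l0 gl rl al]]] := renewal_limits m_gt0 f_homo f_ge0 alpha_gt alpha_le.
set a := r ^+ 2 / l in al.
have a0' : 0 < a.
  apply: lt_le_trans ltr01 _; rewrite -(cvg_lim _ al) //.
  apply: limr_ge; first by apply/cvg_ex; exists a.
  by apply: nearW => n; exact: lang_norm_ge1.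
have QR : Q%:R != 0 :> R by rewrite pnatr_eq0 -lt0n.
pose M1 (j : 'I_Q) S := count_words m R (Q.+1 * S) (fun u => lang f u && framed (j.+1 * S) u) / lam ^+ (Q.+1 * S).
pose M2 (j j' : 'I_Q) S := count_words m R (Q.+1 * S) (fun u => [&& lang f u, framed (j.+1 * S) u & framed (j'.+1 * S) u]) / lam ^+ (Q.+1 * S).
have DE (c : R) S : (\sum_(u <- words m (Q.+1 * S)) (lang f u)%:R *
     (Q%:R^-1 * \sum_(j < Q) (framed (j.+1 * S) u)%:R - c) ^+ 2) / lam ^+ (Q.+1 * S) =
   Q%:R^-1 ^+ 2 * \sum_(j < Q) \sum_(j' < Q) M2 j j' S - 2 * c * Q%:R^-1 * \sum_(j < Q) M1 j S
   + c ^+ 2 * normalized m f L (Q.+1 * S).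
  set W := words m _.
  pose X u : R := \sum_(j < Q) (framed (j.+1 * S) u)%:R.
  have e2 : \sum_(j < Q) \sum_(j' < Q) M2 j j' S =
      (\sum_(u <- W) (lang f u)%:R * X u ^+ 2) / lam ^+ (Q.+1 * S).
    rewrite /M2; under eq_bigr => j _ do rewrite -mulr_suml exchange_big /=.
    rewrite -mulr_suml exchange_big /=; congr (_ / _); apply: eq_bigr => u _.
    rewrite expr2 /X mulr_suml mulr_sumr; apply: eq_bigr => j _; rewrite !mulr_sumr.
    by apply: eq_bigr => j' _; rewrite -!natrM !mulnb.
  have e1 : \sum_(j < Q) M1 j S = (\sum_(u <- W) (lang f u)%:R * X u) / lam ^+ (Q.+1 * S).
    rewrite /M1 -mulr_suml exchange_big /=; congr (_ / _); apply: eq_bigr => u _.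
    by rewrite /X mulr_sumr; apply: eq_bigr => j _; rewrite -natrM mulnb.
  rewrite e1 e2 /normalized /lang_card /count_words -/W !mulrA -mulrBl -mulrDl; congr (_ / _).
  rewrite !mulr_sumr -sumrB -big_split /=; apply: eq_bigr => u _; rewrite /X; ring.
pose c := l * \sum_p pattern_freq p.
exists a, c; split => //.
under eq_fun do rewrite DE.
have big S (j : 'I_Q) : (K + k + K + K <= S)%N -> (K <= j.+1 * S)%N /\ (j.+1 * S + k + K <= Q.+1 * S)%N.
  move=> hS; split; first by rewrite mulSn; move: hS; clear; move: (j * S)%N k => x y; lia.
  have := leq_mul (ltn_ord j) (leqnn S); rewrite [(Q.+1 * S)%N]mulSn; move: hS; clear.
  by move: (Q * S)%N (j.+1 * S)%N k => x y z; lia.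
have gap S (j j' : 'I_Q) : (K + k + K + K <= S)%N -> (j < j')%N -> (j.+1 * S + S <= j'.+1 * S)%N.
  by move=> _ hj; rewrite -mulSnr leq_mul2r; apply/orP; right; rewrite ltnS.
have rcv (phi : nat -> nat) : (forall S, S - (K + k + K) <= phi S)%N ->
    (fun S => normalized m f rc (phi S)) @ \oo --> r.
  by move=> h; apply: cvg_comp rl; exact: cvg_nat_infty h.
have last_far (j : 'I_Q) (p : 'I_K.+1 * 'I_K.+1) S :
    (S - (K + k + K) <= Q.+1 * S - (j.+1 * S + k + p.2))%N.
  have := leq_mul (ltn_ord j) (leqnn S); rewrite [(Q.+1 * S)%N]mulSn; have := ltn_ord p.2; clear.
  by move: (Q * S)%N (j.+1 * S)%N k (nat_of_ord p.2) => x y z t; lia.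
have first_far (j : 'I_Q) (p : 'I_K.+1 * 'I_K.+1) S : (S - (K + k + K) <= j.+1 * S - p.1)%N.
  have := ltn_ord p.1; rewrite mulSn; clear.
  by move: (j * S)%N k (nat_of_ord p.1) => x y z; lia.
have M1c j : M1 j @ \oo --> a * c.
  apply: (@cvg_eq_from _ _ (fun S => \sum_(p : 'I_K.+1 * 'I_K.+1)
      normalized m f rc (j.+1 * S - p.1) * (pattern_freq p *
      normalized m f rc (Q.+1 * S - (j.+1 * S + k + p.2)))) _ (K + k + K + K)).
    by move=> S hS; have [h1 h2] := big S j hS; exact: framed_card.
  have -> : a * c = \sum_p r * (pattern_freq p * r).
    by rewrite -mulr_sumr -mulr_suml /a /c; field; rewrite gt_eqF.
  apply: cvg_big => [|p _]; first exact: add_continuous.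
  apply: cvgM; first exact: rcv (first_far j p).
  by apply: cvgMr; exact: rcv (last_far j p).
have M2lt (j j' : 'I_Q) : (j < j')%N -> M2 j j' @ \oo --> a * c ^+ 2.
  move=> hj.
  apply: (@cvg_eq_from _ _ (fun S => \sum_(p : 'I_K.+1 * 'I_K.+1) \sum_(p' : 'I_K.+1 * 'I_K.+1)
      normalized m f rc (j.+1 * S - p.1) * (pattern_freq p *
      (normalized m f G (j'.+1 * S - p'.1 - (j.+1 * S + k + p.2)) * (pattern_freq p' *
      normalized m f rc (Q.+1 * S - (j'.+1 * S + k + p'.2)))))) _ (K + k + K + K)).
    move=> S hS; have [h1 _] := big S j hS; have [_ h2] := big S j' hS.
    apply: two_framed_card => //; apply: leq_trans (gap S j j' hS hj).
    by move: hS; clear; move: (j.+1 * S)%N k => x y; lia.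
  have -> : a * c ^+ 2 = \sum_p \sum_p' r * (pattern_freq p * (l * (pattern_freq p' * r))).
    under [RHS]eq_bigr => p _ do rewrite -!mulr_sumr -mulr_suml.
    by rewrite -mulr_sumr -mulr_suml /a /c; field; rewrite gt_eqF.
  apply: cvg_big => [|p _]; first exact: add_continuous.
  apply: cvg_big => [|p' _]; first exact: add_continuous.
  apply: cvgM; first exact: rcv (first_far j p).
  apply: cvgMr; apply: cvgM; last by apply: cvgMr; exact: rcv (last_far j' p').
  apply: cvg_comp gl; apply: (@cvg_nat_infty _ (K + k + K)) => S.
  have [hS|hS] := leqP (K + k + K) S; last by rewrite (eqP (ltnW hS : _ - _ == 0)%N).
  have : (j.+1 * S + S <= j'.+1 * S)%N by rewrite -mulSnr leq_mul2r; apply/orP; right; rewrite ltnS.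
  have := ltn_ord p.2; have := ltn_ord p'.1; clear.
  by move: (j'.+1 * S)%N (j.+1 * S)%N k (nat_of_ord p.2) (nat_of_ord p'.1) => x y z t w; lia.
have M2c (j j' : 'I_Q) : M2 j j' @ \oo --> a * (c ^+ 2 + (j == j')%:R * (c - c ^+ 2)).
  have [->|] := eqVneq j j'.
    have -> : M2 j' j' = M1 j' by apply/funext => S; rewrite /M2 /M1; congr (_ / _); apply: eq_count_words => u _; rewrite andbb.
    by rewrite mul1r addrC subrK; exact: M1c.
  rewrite mul0r addr0 neq_ltn => /orP[h|h]; first exact: M2lt.
  have -> : M2 j j' = M2 j' j; last exact: M2lt.
  by apply/funext => S; rewrite /M2; congr (_ / _); apply: eq_count_words => u _; congr (_ && _); rewrite andbC.
have -> : a * (c - c ^+ 2) / Q%:R = Q%:R^-1 ^+ 2 * \sum_(j < Q) \sum_(j' < Q) a * (c ^+ 2 + (j == j')%:R * (c - c ^+ 2))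
   - 2 * c * Q%:R^-1 * \sum_(j < Q) a * c + c ^+ 2 * a.
  have e (j : 'I_Q) : \sum_(j' < Q) a * (c ^+ 2 + (j == j')%:R * (c - c ^+ 2)) = a * (c ^+ 2 * Q%:R + (c - c ^+ 2)).
    rewrite -mulr_sumr big_split /= sumr_const card_ord -[c ^+ 2 *+ Q]mulr_natr; congr (_ * (_ + _)).
    by rewrite (bigD1 j) //= eqxx mul1r big1 ?addr0 // => j' /negbTE; rewrite eq_sym => ->; rewrite mul0r.
  under eq_bigr => j _ do rewrite e.
  rewrite !sumr_const !card_ord -!(mulr_natr (a * _)); field; exact: QR.
apply: cvgD; first apply: cvgB.
- apply: cvgMr; apply: cvg_big => [|j _]; first exact: add_continuous.
  apply: cvg_big => [|j' _]; first exact: add_continuous.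
  exact: M2c.
- by apply: cvgMr; apply: cvg_big => [|j _]; [exact: add_continuous|exact: M1c].
- apply: cvgMr; apply: cvg_comp al; apply: (@cvg_nat_infty _ 0) => S.
  by rewrite subn0 leq_pmull.
Qed.

End Concentration.

Section Frequencies.
Variables (R : realType) (m : nat) (f : nat -> R) (alpha : R).
Hypothesis m_gt0 : (0 < m)%N.
Hypothesis f_homo : {homo f : i j / (i <= j)%N >-> i <= j}.
Hypothesis f_ge0 : forall k, 0 <= f k.
Hypothesis alpha_gt : \sum_(1 <= i < m.+1) (i%:R / i.+1%:R) < alpha.
Hypothesis alpha_le : forall k, alpha * k%:R <= f k.
Local Notation L := (lang_card m f).
Local Notation lam := (growth m f).

Definition frequency (s : seq nat) Q (pos : 'I_Q -> nat) u : R :=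
  Q%:R^-1 * \sum_(j < Q) (occurs s (pos j) u)%:R.

(** By the Chebyshev inequality, the frequency of framed occurrences is close to a
    constant; an occurrence that is not framed lies next to a long gap between cuts,
    which is rare. *)
Theorem frequency_concentration (s : seq nat) (e : R) : 0 < e ->
  exists (c : R) N Q (pos : 'I_Q -> nat), [/\ (0 < Q)%N,
    forall j, (pos j + size s <= N)%N &
    count_words m R N (fun u => lang f u && (e < `|frequency s pos u - c|)) <= e * lam ^+ N].
Proof.
move=> e0; set k := size s.
have lam0 : 0 < lam := growth_gt0 m f.
have eta0 : 0 < e ^+ 2 / 8 by rewrite divr_gt0 // exprn_gt0.
have [K hK] := gap_rare m_gt0 f_homo f_ge0 alpha_gt alpha_le eta0.
have [C C1 hC] := lang_card_le m_gt0 f_homo f_ge0 alpha_gt alpha_le.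
pose Q := (Num.truncn (8 * C / e ^+ 3)).+1.
have QR : 0 < Q%:R :> R by rewrite ltr0n.
have hQ : C / (4 * Q%:R) <= e ^+ 3 / 32.
  have : 8 * C / e ^+ 3 < Q%:R by exact: truncnS_gt.
  rewrite ltr_pdivrMr ?exprn_gt0 // => h.
  by rewrite ler_pdivrMr ?mulr_gt0 //; lra.
have [a [c [a0 al hD]]] := second_moment_cvg m_gt0 f_homo f_ge0 alpha_gt alpha_le s K (isT : 0 < Q)%N.
have aC : a <= C.
  rewrite -(cvg_lim _ al) //; apply: limr_le; first by apply/cvg_ex; exists a.
  by apply: nearW => n; rewrite ler_pdivrMr ?exprn_gt0.
have lim_le : a * (c - c ^+ 2) / Q%:R <= e ^+ 3 / 32.
  apply: le_trans hQ; rewrite invfM mulrA ler_wpM2r ?invr_ge0 ?(ltW QR) //.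
  have : c - c ^+ 2 <= 1 / 4 by have := sqr_ge0 (c - 1 / 2); rewrite !expr2; nra.
  move=> h; nra.
have e3 : 0 < e ^+ 3 / 32 by rewrite divr_gt0 // exprn_gt0.
have /cvgrPdist_le/(_ _ e3) [S0 _ hS0] := hD.
pose S := (S0 + K + k + K)%N.
have hS : (S0 <= S)%N by rewrite /S -!addnA leq_addr.
have {hS0} := hS0 S hS; rewrite /= ler_norml => /andP[hDS _].
set N := (Q.+1 * S)%N in hDS.
pose pos (j : 'I_Q) := (j.+1 * S)%N.
have posK j : (K <= pos j)%N.
  by apply: leq_trans (leq_pmull S (ltn0Sn j)); exact: leq_addl.
have posN j : (pos j + k + K <= N)%N.
  rewrite -addnA; apply: leq_trans (_ : pos j + S <= _)%N.
    by rewrite leq_add2l /S -addnA leq_addl.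
  by rewrite /pos /N -mulSnr leq_mul2r ltnS ltn_ord orbT.
exists c, N, Q, pos; split => //.
  by move=> j; apply: leq_trans (posN j); exact: leq_addr.
pose X u : R := Q%:R^-1 * \sum_(j < Q) (framed alpha s K (pos j) u)%:R.
pose g1 (j : 'I_Q) u := lang f u && ~~ has (cut alpha u) (iota (pos j - K) K.+1).
pose g2 (j : 'I_Q) u := lang f u && ~~ has (cut alpha u) (iota (pos j + k) K.+1).
have pt u : (lang f u && (e < `|frequency s pos u - c|))%:R <=
    (4 / e ^+ 2) * ((lang f u)%:R * (X u - c) ^+ 2) +
    (2 / e) * (Q%:R^-1 * \sum_(j < Q) ((g1 j u)%:R + (g2 j u)%:R)) :> R.
  have pos1 : 0 <= (4 / e ^+ 2) * ((lang f u)%:R * (X u - c) ^+ 2).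
    by rewrite mulr_ge0 ?divr_ge0 ?sqr_ge0 // mulr_ge0 // sqr_ge0.
  have pos2 : 0 <= (2 / e) * (Q%:R^-1 * \sum_(j < Q) ((g1 j u)%:R + (g2 j u)%:R)).
    rewrite mulr_ge0 ?divr_ge0 ?(ltW e0) // mulr_ge0 ?invr_ge0 ?(ltW QR) //.
    by apply: sumr_ge0 => j _; rewrite addr_ge0.
  move: pos1 pos2; have [hl|_] := boolP (lang f u) => pos1 pos2; last by rewrite addr_ge0.
  have [hb|_] := boolP (e < _); last by rewrite addr_ge0.
  rewrite mul1r in pos1 *.
  have hXf : `|frequency s pos u - X u| <= Q%:R^-1 * \sum_(j < Q) ((g1 j u)%:R + (g2 j u)%:R).
    rewrite /frequency /X -mulrBr -sumrB normrM ger0_norm ?invr_ge0 ?(ltW QR) //.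
    rewrite ler_wpM2l ?invr_ge0 ?(ltW QR) //; apply: le_trans (ler_norm_sum _ _ _) _.
    apply: ler_sum => j _; rewrite /framed.
    have [ho|_] := boolP (occurs s (pos j) u); last by rewrite subrr normr0 addr_ge0.
    have -> : has (fun d => cut alpha u (pos j - d)) (iota 0 K.+1) = has (cut alpha u) (iota (pos j - K) K.+1).
      have hKj := posK j; apply/hasP/hasP => -[d]; rewrite mem_iota => hd hc.
        exists (pos j - d)%N => //; rewrite mem_iota; move: hd hKj; clear.
        by move: (pos j) => x; lia.
      exists (pos j - d)%N; first by rewrite mem_iota; move: hd hKj; clear; move: (pos j) => x; lia.
      by rewrite subKn //; move: hd hKj; clear; move: (pos j) => x; lia.
    have -> : has (fun d => cut alpha u (pos j + size s + d)) (iota 0 K.+1) = has (cut alpha u) (iota (pos j + k) K.+1).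
      transitivity (has (cut alpha u) (iota (pos j + k + 0) K.+1)); last by rewrite addn0.
      by rewrite iotaDl has_map.
    rewrite /g1 /g2 hl; move: (has (cut alpha u) (iota (pos j - K) K.+1)).
    move: (has (cut alpha u) (iota (pos j + k) K.+1)) => b1 b2; case: b2; case: b1 => /=.
    - by rewrite subrr normr0 addr0.
    - by rewrite subr0 normr1 add0r.
    - by rewrite subr0 normr1 addr0.
    - by rewrite subr0 normr1 lerDl.
  rewrite /= mulr1n.
  have [hX|hX] := lerP (e / 2) `|X u - c|.
    apply: le_trans (_ : (4 / e ^+ 2) * (X u - c) ^+ 2 <= _); last by rewrite lerDl.
    have e1 : 4 / e ^+ 2 * (e / 2) ^+ 2 = 1 by field; rewrite gt_eqF.
    rewrite -[leLHS]e1 -(@real_normK _ (X u - c)) ?num_real //; apply: ler_wpM2l.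
      by rewrite divr_ge0 // sqr_ge0.
    by apply: lerXn2r; rewrite ?nnegrE ?divr_ge0 ?(ltW e0).
  apply: le_trans (_ : (2 / e) * (Q%:R^-1 * \sum_(j < Q) ((g1 j u)%:R + (g2 j u)%:R)) <= _); last by rewrite lerDr.
  have : e / 2 <= Q%:R^-1 * \sum_(j < Q) ((g1 j u)%:R + (g2 j u)%:R).
    apply: le_trans hXf; have := ler_distD (X u) (frequency s pos u) c.
    by move: hb hX; lra.
  by rewrite ler_pdivrMr // => h; rewrite mulrAC ler_pdivlMr // mul1r mulrC.
apply: le_trans (_ : (4 / e ^+ 2) * (\sum_(u <- words m N) (lang f u)%:R * (X u - c) ^+ 2) +
   (2 / e) * (Q%:R^-1 * \sum_(j < Q) (count_words m R N (g1 j) + count_words m R N (g2 j))) <= _).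
  rewrite /count_words; apply: le_trans (ler_sum _ (fun u _ => pt u)) _.
  rewrite big_split /= -!mulr_sumr lerD2l ler_wpM2l ?divr_ge0 ?(ltW e0) //.
  rewrite ler_wpM2l ?invr_ge0 ?(ltW QR) // exchange_big /= ler_sum // => j _.
  by rewrite big_split.
have lamN : 0 < lam ^+ N by rewrite exprn_gt0.
have h1 : \sum_(u <- words m N) (lang f u)%:R * (X u - c) ^+ 2 <= (e ^+ 3 / 16) * lam ^+ N.
  by rewrite -ler_pdivrMr //; lra.
have h2 : Q%:R^-1 * \sum_(j < Q) (count_words m R N (g1 j) + count_words m R N (g2 j)) <=
    (e ^+ 2 / 4) * lam ^+ N.
  rewrite ler_pdivrMl // mulr_natl -[X in _ *+ X]card_ord -sumr_const; apply: ler_sum => j _.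
  have -> : e ^+ 2 / 4 * lam ^+ N = e ^+ 2 / 8 * lam ^+ N + e ^+ 2 / 8 * lam ^+ N by field.
  apply: lerD; apply: hK; first by rewrite subnK // (leq_trans _ (posN j)) // -addnA leq_addr.
  exact: posN.
have e20 : 0 < e ^+ 2 by rewrite exprn_gt0.
have h1' := ler_wpM2l (_ : 0 <= 4 / e ^+ 2) h1; have h2' := ler_wpM2l (_ : 0 <= 2 / e) h2.
apply: le_trans (lerD (h1' _) (h2' _)) _; rewrite ?divr_ge0 ?(ltW e0) ?(ltW e20) //.
have -> : 4 / e ^+ 2 * (e ^+ 3 / 16 * lam ^+ N) + 2 / e * (e ^+ 2 / 4 * lam ^+ N) = 3 / 4 * e * lam ^+ N.
  by field; rewrite gt_eqF.
by rewrite ler_wpM2r ?(ltW lamN) //; lra.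
Qed.

End Frequencies.

(** * Stationary processes and their entropy *)

Section Gibbs.
Variable R : realType.

Lemma gibbs_inequality (I : Type) (r : seq I) (P q : I -> R) :
  (forall i, 0 <= P i) -> (forall i, 0 <= q i) -> (forall i, 0 < P i -> 0 < q i) ->
  \sum_(i <- r) q i <= \sum_(i <- r) P i ->
  - (\sum_(i <- r) P i * ln (P i)) <= - (\sum_(i <- r) P i * ln (q i)).
Proof.
move=> P0 q0 Pq hs; rewrite lerN2 -subr_ge0 -sumrB.
apply: le_trans (_ : \sum_(i <- r) (P i - q i) <= _); first by rewrite sumrB subr_ge0.
apply: ler_sum => i _; have := P0 i; rewrite le_eqVlt => /orP[/eqP <-|Pi].
  by rewrite !mul0r subr0 sub0r oppr_le0.
have qi := Pq i Pi.
have hl : ln (q i) - ln (P i) <= q i / P i - 1.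
  rewrite -ln_div ?posrE //.
  have := expR_ge1Dx (ln (q i / P i)); rewrite lnK ?posrE ?divr_gt0 //; lra.
have := ler_wpM2l (ltW Pi) hl.
have -> : P i * (q i / P i - 1) = q i - P i by field; rewrite gt_eqF.
lra.
Qed.

End Gibbs.

Section Process.
Variables (R : realType) (m : nat) (f : nat -> R).

(** The word probabilities of a shift-invariant measure carried by the shift. *)
Record process (P : seq nat -> R) : Prop := Process {
  process_ge0 : forall u, 0 <= P u;
  process_nil : P [::] = 1;
  process_rcons : forall u, \sum_(c <- letters m) P (rcons u c) = P u;
  process_cons : forall u, \sum_(c <- letters m) P (c :: u) = P u;
  process_words : forall u, P u != 0 -> u \in words m (size u);
  process_lang : forall u, P u != 0 -> lang f u }.

Definition entropy_words (P : seq nat -> R) n := - \sum_(u <- words m n) P u * ln (P u).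

Section Marginals.
Variable P : seq nat -> R.
Hypothesis hP : process P.

Lemma process_catr u n : \sum_(y <- words m n) P (u ++ y) = P u.
Proof.
elim: n => [|n IH]; first by rewrite big_words0 cats0.
rewrite big_words_rcons -[RHS]IH; apply: eq_bigr => y _.
under eq_bigr => c _ do rewrite -rcons_cat.
exact: (process_rcons hP).
Qed.

Lemma process_catl u n : \sum_(x <- words m n) P (x ++ u) = P u.
Proof.
elim: n => [|n IH]; first by rewrite big_words0.
rewrite big_wordsS exchange_big /= -[RHS]IH; apply: eq_bigr => x _.
exact: (process_cons hP (x ++ u)).
Qed.

Lemma process_sum n : \sum_(u <- words m n) P u = 1.
Proof. by rewrite -(process_nil hP) -(process_catr [::] n). Qed.

Lemma process_le1 u : P u <= 1.
Proof.
have [->//|/(process_words hP) hu] := eqVneq (P u) 0.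
rewrite -(process_sum (size u)) (bigD1_seq u) ?uniq_words //= lerDl sumr_ge0 // => v _.
exact: process_ge0.
Qed.

Lemma process_cat_le x y : P (x ++ y) <= P x /\ P (x ++ y) <= P y.
Proof.
have [->|/(process_words hP)] := eqVneq (P (x ++ y)) 0; first by split; apply: process_ge0.
rewrite mem_words eqxx all_cat => /andP[_ /andP[hx hy]].
split; [rewrite -(process_catr x (size y)) (bigD1_seq y)|rewrite -(process_catl y (size x)) (bigD1_seq x)];
  rewrite ?uniq_words ?mem_words ?eqxx //= lerDl sumr_ge0 // => ? _; exact: process_ge0.
Qed.

Lemma entropy_words_ge0 n : 0 <= entropy_words P n.
Proof.
rewrite /entropy_words -sumrN sumr_ge0 // => u _.
rewrite -mulrN mulr_ge0 ?process_ge0 // oppr_ge0 ln_le0 //; exact: process_le1.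
Qed.

(** Gibbs against the product of the two marginals. *)
Lemma entropy_words_subadditive n k :
  entropy_words P (n + k) <= entropy_words P n + entropy_words P k.
Proof.
pose q u := P (take n u) * P (drop n u).
have Pgt x : (0 < P x) = (P x != 0) by rewrite lt0r (process_ge0 hP) andbT.
apply: le_trans (gibbs_inequality (q := q) _ _ _ _) _.
- exact: process_ge0.
- by move=> u; rewrite mulr_ge0 // process_ge0.
- move=> u hu; rewrite mulr_gt0 //.
    by apply: lt_le_trans hu _; rewrite -{1}(cat_take_drop n u); case: (process_cat_le (take n u) (drop n u)).
  by apply: lt_le_trans hu _; rewrite -{1}(cat_take_drop n u); case: (process_cat_le (take n u) (drop n u)).
- rewrite process_sum big_words_cat big_seq.
  under eq_bigr => x /size_words hx.
    under eq_bigr => y _ do rewrite /q take_size_cat // drop_size_cat //.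
    rewrite -mulr_sumr process_sum mulr1; over.
  by rewrite -big_seq process_sum.
have -> : \sum_(u <- words m (n + k)) P u * ln (q u) =
    \sum_(x <- words m n) \sum_(y <- words m k) (P (x ++ y) * ln (P x) + P (x ++ y) * ln (P y)).
  rewrite big_words_cat [LHS]big_seq [RHS]big_seq; apply: eq_bigr => x /size_words hx.
  apply: eq_bigr => y _; rewrite /q take_size_cat // drop_size_cat // -mulrDr.
  have [->|hxy] := eqVneq (P (x ++ y)) 0; first by rewrite !mul0r.
  rewrite lnM ?posrE //; apply: lt_le_trans (_ : P (x ++ y) <= _); rewrite ?Pgt //;
    by case: (process_cat_le x y).
rewrite /entropy_words -opprD lerN2.
under [leRHS]eq_bigr => x _ do rewrite big_split /= -mulr_suml process_catr.
rewrite big_split /= lerD2l exchange_big /= le_eqVlt; apply/orP; left; apply/eqP.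
by apply: eq_bigr => y _; rewrite -mulr_suml process_catl.
Qed.

Lemma process_occurs s j N : (j + size s <= N)%N ->
  \sum_(u <- words m N) (occurs s j u)%:R * P u = P s.
Proof.
move=> hN; rewrite -(subnKC hN) -addnA big_words_cat.
transitivity (\sum_(x <- words m j) \sum_(w <- words m (size s)) (w == s)%:R * P (x ++ w)).
  rewrite [LHS]big_seq [RHS]big_seq; apply: eq_bigr => x /size_words hx.
  rewrite big_words_cat [LHS]big_seq [RHS]big_seq; apply: eq_bigr => w /size_words hw.
  under eq_bigr => y _ do rewrite /occurs drop_size_cat // take_size_cat // catA.
  by rewrite -mulr_sumr process_catr.
rewrite exchange_big /=.
under eq_bigr => w _ do rewrite -mulr_sumr process_catl.
have [hs|hs] := boolP (s \in words m (size s)).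
  rewrite (bigD1_seq s) ?uniq_words //= eqxx mul1r big1 ?addr0 // => w /negPf ->.
  by rewrite mul0r.
have -> : P s = 0 by apply/eqP/negPn/negP => /(process_words hP); rewrite (negPf hs).
rewrite big_seq big1 // => w hw; case: eqP => [hws|_]; last by rewrite mul0r.
by move: hw; rewrite hws (negPf hs).
Qed.

Lemma process_frequency s Q (pos : 'I_Q -> nat) N : (0 < Q)%N ->
  (forall j, pos j + size s <= N)%N ->
  \sum_(u <- words m N) frequency R s pos u * P u = P s.
Proof.
move=> Q0 hN.
under eq_bigr => u _ do rewrite /frequency -mulrA mulr_suml.
rewrite -mulr_sumr exchange_big /=.
under eq_bigr => j _ do rewrite process_occurs //.
rewrite sumr_const card_ord -[P s *+ Q]mulr_natl mulrA mulVf ?mul1r //.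
by rewrite pnatr_eq0 -lt0n.
Qed.

Hypothesis f_homo : {homo f : i j / (i <= j)%N >-> i <= j}.
Hypothesis f_ge0 : forall k, 0 <= f k.
Local Notation L := (lang_card m f).
Local Notation lam := (growth m f).

(** Gibbs against the uniform law on the language. *)
Lemma entropy_words_le n : entropy_words P n <= ln (L n).
Proof.
have L0 := lang_card_gt0 m f_ge0 n.
apply: le_trans (gibbs_inequality (q := fun u => (lang f u)%:R / L n) _ _ _ _) _.
- exact: process_ge0.
- by move=> u; rewrite divr_ge0 ?ler0n // ltW.
- by move=> u; rewrite lt0r => /andP[/(process_lang hP) -> _]; rewrite divr_gt0.
- by rewrite process_sum -mulr_suml divff // gt_eqF.
have -> : ln (L n) = \sum_(u <- words m n) P u * ln (L n) by rewrite -mulr_suml process_sum mul1r.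
rewrite -sumrN; apply: ler_sum => u _.
have [->|hu] := eqVneq (P u) 0; first by rewrite !mul0r oppr0.
by rewrite (process_lang hP hu) mul1r lnV ?posrE // mulrN opprK.
Qed.

(** A process of maximal entropy cannot charge a set of words that is small
    compared with the language: squeezing mass into few words costs entropy. *)
Lemma max_entropy_small N (C kappa : R) (E : pred (seq nat)) :
  1 <= C -> 0 < kappa ->
  N%:R * ln lam <= entropy_words P N -> L N <= C * lam ^+ N ->
  count_words m R N (fun u => lang f u && E u) <= kappa * lam ^+ N ->
  (\sum_(u <- words m N) (E u)%:R * P u) * ln kappa^-1 <= ln 2 + ln C.
Proof.
move=> C1 k0 hH hL hE.
have C0 : 0 < C by apply: lt_le_trans C1.
have lamN : 0 < lam ^+ N by rewrite exprn_gt0 // growth_gt0.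
(* The reference law gives at most half of its mass to [E] and half to the rest
   of the language. *)
pose w (b : bool) := if b then (2 * kappa * lam ^+ N)^-1 else (2 * C * lam ^+ N)^-1.
have w0 b : 0 < w b by rewrite /w; case: b; rewrite invr_gt0 !mulr_gt0.
have := gibbs_inequality (r := words m N) (q := fun u => (lang f u)%:R * w (E u)) (process_ge0 hP).
move=> /(_ _ _ _)/wrap[|||hG].
- by move=> u; rewrite mulr_ge0 ?ler0n // ltW.
- by move=> u; rewrite lt0r => /andP[/(process_lang hP) -> _]; rewrite mul1r.
- rewrite process_sum.
  apply: le_trans (_ : count_words m R N (fun u => lang f u && E u) * w true + L N * w false <= _).
    rewrite /lang_card /count_words !mulr_suml -big_split /=; apply: ler_sum => u _.
    move: (w0 true) (w0 false); case: (lang f u) => /=; case: (E u) => /=;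
      by rewrite ?mul0r ?mul1r ?add0r ?addr0 // => _ /ltW; rewrite lerDl.
  have h1 : count_words m R N (fun u => lang f u && E u) * w true <= 1/2.
    apply: le_trans (ler_wpM2r (ltW (w0 true)) hE) _; rewrite /w le_eqVlt; apply/orP; left; apply/eqP.
    by field; rewrite !gt_eqF.
  have h2 : L N * w false <= 1/2.
    apply: le_trans (ler_wpM2r (ltW (w0 false)) hL) _; rewrite /w le_eqVlt; apply/orP; left; apply/eqP.
    by field; rewrite !gt_eqF.
  lra.
have {hG} := le_trans hH hG.
have -> : - (\sum_(u <- words m N) P u * ln ((lang f u)%:R * w (E u))) =
   \sum_(u <- words m N) (P u * (ln 2 + N%:R * ln lam) + ((E u)%:R * P u * ln kappa + (~~ E u)%:R * P u * ln C)).
  rewrite -sumrN; apply: eq_bigr => u _.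
  have [->|hu] := eqVneq (P u) 0; first by rewrite !(mul0r, mulr0) oppr0 !addr0.
  rewrite (process_lang hP hu) mul1r /w; case: (E u) => /=;
    rewrite lnV ?posrE ?mulr_gt0 // !lnM ?posrE ?mulr_gt0 // lnXn ?growth_gt0 // -mulr_natl; ring.
rewrite !big_split /= -!mulr_suml process_sum mul1r lnV ?posrE //.
have : (\sum_(u <- words m N) (~~ E u)%:R * P u) * ln C <= ln C.
  rewrite ler_piMl ?ln_ge0 // -[leRHS](process_sum N); apply: ler_sum => u _.
  by rewrite ler_piMl ?process_ge0 // lern1 leq_b1.
set x := \sum_(u <- _) _ * P u; set y := \sum_(u <- _) _ * P u; clear -R.
rewrite mulrN; move: (x * _) (y * _) => *; lra.
Qed.

End Marginals.

End Process.

Section Uniqueness.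
Variables (R : realType) (m : nat) (f : nat -> R) (alpha : R).
Hypothesis m_gt0 : (0 < m)%N.
Hypothesis f_homo : {homo f : i j / (i <= j)%N >-> i <= j}.
Hypothesis f_ge0 : forall k, 0 <= f k.
Hypothesis alpha_gt : \sum_(1 <= i < m.+1) (i%:R / i.+1%:R) < alpha.
Hypothesis alpha_le : forall k, alpha * k%:R <= f k.
Local Notation lam := (growth m f).

Definition maximal (P : seq nat -> R) :=
  process m f P /\ forall n, n%:R * ln lam <= entropy_words m P n.

Lemma frequency_bounds s Q (pos : 'I_Q -> nat) u : 0 <= frequency R s pos u <= 1.
Proof.
rewrite /frequency; apply/andP; split; first by rewrite mulr_ge0 ?invr_ge0 ?ler0n // sumr_ge0.
have [Q0|Q0] := posnP Q.
  by rewrite {1}Q0 invr0 mul0r.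
rewrite mulrC ler_pdivrMr ?ltr0n // mul1r.
apply: le_trans (_ : \sum_(j < Q) 1 <= _); last by rewrite sumr_const card_ord.
by apply: ler_sum => j _; rewrite lern1 leq_b1.
Qed.

(** The probability of [s] is its expected frequency, and the words whose frequency
    is far from [c] are too few to be charged by a process of maximal entropy. The
    parameter [t] is the logarithm of the inverse of the precision. *)
Lemma maximal_near s : exists2 A : R, 0 <= A & forall t : R, 0 < t ->
  exists c, forall P, maximal P -> `|P s - c| * t <= 1 + A.
Proof.
have [C C1 hL] := lang_card_le m_gt0 f_homo f_ge0 alpha_gt alpha_le.
exists (ln 2 + ln C); first by rewrite addr_ge0 ?ln_ge0 // ler1n.
move=> t t0; set e := expR (- t); have e0 : 0 < e by exact: expR_gt0.
have [c [N [Q [pos [Q0 hpos hc]]]]] :=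
  frequency_concentration m_gt0 f_homo f_ge0 alpha_gt alpha_le s e0.
pose c' := Num.min (Num.max c 0) 1; exists c' => P [hP hH].
have clamp : [\/ c <= 0 /\ c' = 0, 0 <= c <= 1 /\ c' = c | 1 <= c /\ c' = 1].
  rewrite /c'; case: (leP c 0) => hc0; first by constructor 1; rewrite min_l ?ler01.
  by case: (leP c 1) => hc1; [constructor 2; rewrite (ltW hc0)|constructor 3; rewrite (ltW hc1)].
have key u : `|frequency R s pos u - c'| <= e + (e < `|frequency R s pos u - c|)%R%:R.
  have /andP[x0 x1] := frequency_bounds s pos u; move: (frequency _ _ _ _) x0 x1 => x x0 x1.
  have [h1 h2] : `|x - c'| <= `|x - c| /\ `|x - c'| <= 1.
    have [[hc0 ->]|[hc0 -> //]|[hc0 ->]] := clamp.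
    - by split; last (rewrite ger0_norm; lra); rewrite !ger0_norm; lra.
    - by split => //; rewrite ler_norml; lra.
    - by split; rewrite ler0_norm ?ler0_norm; lra.
  by case: ltP => /= h; [apply: le_trans h2 _; rewrite lerDr ltW|rewrite addr0 (le_trans h1)].
set E := fun u => (e < `|frequency R s pos u - c|)%R.
have hE := max_entropy_small hP C1 e0 (hH N) (hL N) hc.
have le1 : `|P s - c'| <= e + \sum_(u <- words m N) (E u)%:R * P u.
  have sumP x : x = \sum_(u <- words m N) x * P u by rewrite -mulr_sumr (process_sum hP) mulr1.
  rewrite -(process_frequency hP Q0 hpos) [c' in `|_ - c'|]sumP -sumrB.
  apply: le_trans (ler_norm_sum _ _ _) _.
  rewrite [e in leRHS]sumP -big_split /=; apply: ler_sum => u _.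
  by rewrite -mulrBl -mulrDl normrM (ger0_norm (process_ge0 hP u)) ler_wpM2r ?(process_ge0 hP) //; exact: key.
have et : e * t <= 1.
  have := expR_ge1Dx t; rewrite -[e * t]mulrC /e expRN ler_pdivrMr ?expR_gt0 // mul1r; lra.
have := ler_wpM2r (ltW t0) le1; rewrite mulrDl.
rewrite lnV ?posrE // /e expRK opprK in hE.
move=> h; apply: le_trans h _; exact: lerD.
Qed.

Theorem maximal_unique P Q : maximal P -> maximal Q -> P =1 Q.
Proof.
move=> hP hQ s; have [A A0 hA] := maximal_near s.
apply/eqP; rewrite -subr_eq0 -normr_eq0; apply/negPn/negP => hd.
have d0 : 0 < `|P s - Q s| by rewrite lt0r hd normr_ge0.
set d := `|_| in d0; set t := (2 * (1 + A) + 1) / d.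
have t0 : 0 < t by rewrite divr_gt0 //; lra.
have [c hc] := hA t t0.
have := lerD (hc P hP) (hc Q hQ); rewrite -mulrDl.
have : d <= `|P s - c| + `|Q s - c| by rewrite (distrC (Q s)) ler_distD.
move=> /(ler_wpM2r (ltW t0)); rewrite {1}/t mulrCA divff ?gt_eqF // mulr1.
by move: (_ * t) => z; lra.
Qed.

End Uniqueness.

(** * A process of maximal entropy *)

Section Existence.
Variables (R : realType) (m : nat) (f : nat -> R) (alpha : R).
Hypothesis m_gt0 : (0 < m)%N.
Hypothesis f_homo : {homo f : i j / (i <= j)%N >-> i <= j}.
Hypothesis f_ge0 : forall k, 0 <= f k.
Local Notation lam := (growth m f).
Local Notation L := (lang_card m f).

Lemma sum_letters x : (x <= m)%N -> \sum_(c <- letters m) (x == c)%:R = 1 :> R.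
Proof.
move=> hx; rewrite (bigD1_seq x) ?mem_letters ?iota_uniq //= eqxx big1 ?addr0 // => c.
by rewrite eq_sym => /negPf ->.
Qed.

Lemma sum_ord_eq_le1 n a : \sum_(i < n) (val i == a)%:R <= 1 :> R.
Proof.
have [ha|ha] := ltnP a n; last first.
  by rewrite big1 ?ler01 // => i _; rewrite ltn_eqF // (leq_trans _ ha) // ltn_ord.
rewrite (bigD1 (Ordinal ha)) //= eqxx big1 ?addr0 // => i.
by rewrite -val_eqE /= => /negPf ->.
Qed.

Definition occurrences s n u : R := \sum_(i < n) (occurs s i u)%:R.

Lemma sum_occurs_rcons s i n u : u \in words m n -> (i < n)%N ->
  \sum_(c <- letters m) (occurs (rcons s c) i u)%:R =
  (occurs s i u && (i + size s < n)%N)%:R :> R.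
Proof.
rewrite mem_words => /andP[/eqP hu hm] hi.
have hd : size (drop i u) = (n - i)%N by rewrite size_drop hu.
have [hk|hk] := ltnP (i + size s) n; last first.
  rewrite andbF big1 // => c _; rewrite /occurs size_rcons.
  case: eqP => // /(congr1 size); rewrite size_take_min hd size_rcons => /minn_idPl h.
  by exfalso; move: h hk hi; clear; lia.
have hk' : (size s < size (drop i u))%N by rewrite hd ltn_subRL.
under eq_bigr => c _.
  rewrite /occurs size_rcons (take_nth 0%N hk') eqseq_rcons -mulnb natrM; over.
rewrite andbT -mulr_sumr sum_letters ?mulr1 //.
by apply: (allP hm); apply: mem_drop; apply: mem_nth.
Qed.

Lemma sum_occurs_cons s i n u : u \in words m n -> (i < n)%N ->
  \sum_(c <- letters m) (occurs (c :: s) i u)%:R = (occurs s i.+1 u)%:R :> R.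
Proof.
rewrite mem_words => /andP[/eqP hu hm] hi.
under eq_bigr => c _.
  rewrite /occurs (drop_nth 0%N) ?hu // [take _ _]/= eqseq_cons -mulnb natrM; over.
rewrite -mulr_suml sum_letters ?mul1r //.
by apply: (allP hm); apply: mem_nth; rewrite hu.
Qed.

(** Only an occurrence at the end of [u] has no following letter. *)
Lemma occurrences_rcons s n u : u \in words m n ->
  `|occurrences s n u - \sum_(c <- letters m) occurrences (rcons s c) n u| <= 1.
Proof.
move=> hu; rewrite /occurrences exchange_big /=.
under [X in _ - X]eq_bigr => i _ do rewrite (sum_occurs_rcons _ hu) //.
rewrite -sumrB ger0_norm; last first.
  by apply: sumr_ge0 => i _; case: occurs; case: ltnP; rewrite ?subrr ?subr0 ?ler01.
apply: le_trans (sum_ord_eq_le1 n (n - size s)%N); apply: ler_sum => i _.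
have [ho|] := boolP (occurs s i u); last by rewrite subrr ler0n.
case: ltnP => hk /=; first by rewrite subrr ler0n.
suff -> : (val i == n - size s)%N by rewrite subr0.
move/eqP/(congr1 size): ho; rewrite size_take_min size_drop (size_words hu) => /minn_idPl h.
have hi := ltn_ord i; apply/eqP => /=; move: (nat_of_ord i) h hk hi; clear; lia.
Qed.

(** Only an occurrence at the beginning of [u] has no preceding letter. *)
Lemma occurrences_cons s n u : u \in words m n ->
  `|occurrences s n u - \sum_(c <- letters m) occurrences (c :: s) n u| <= 1.
Proof.
move=> hu; rewrite /occurrences exchange_big /=.
under [X in _ - X]eq_bigr => i _ do rewrite (sum_occurs_cons _ hu) //.
have : \sum_(i < n.+1) (occurs s i u)%:R = \sum_(i < n.+1) (occurs s i u)%:R :> R by [].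
rewrite {1}big_ord_recl big_ord_recr /= => h.
have -> : \sum_(i < n) (occurs s i u)%:R - \sum_(i < n) (occurs s i.+1 u)%:R =
    (occurs s 0 u)%:R - (occurs s n u)%:R :> R.
  under [X in _ - X = _]eq_bigr => i _ do rewrite -[i.+1]/(bump 0 i).
  by move: h; lra.
by case: occurs; case: occurs; rewrite ?subrr ?subr0 ?sub0r ?normrN ?normr0 ?normr1.
Qed.

Lemma occurrences_bounds s n u : 0 <= occurrences s n u <= n%:R.
Proof.
rewrite sumr_ge0 //=; apply: le_trans (_ : \sum_(i < n) 1 <= _); last by rewrite sumr_const card_ord.
by apply: ler_sum => i _; rewrite lern1 leq_b1.
Qed.

(** Normalised by the number of pairs of a word of the language and a position, so
    that the average of a number of occurrences is a frequency. *)
Definition average n (F : seq nat -> R) := (n%:R * L n)^-1 * \sum_(u <- words m n) (lang f u)%:R * F u.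

Definition empirical n s := average n (occurrences s n).

Lemma average_sum n (F : nat -> seq nat -> R) :
  \sum_(c <- letters m) average n (F c) = average n (fun u => \sum_(c <- letters m) F c u).
Proof.
rewrite /average -mulr_sumr exchange_big /=; congr (_ * _).
by apply: eq_bigr => u _; rewrite mulr_sumr.
Qed.

Lemma average_le n F G : (forall u, u \in words m n -> F u <= G u) -> average n F <= average n G.
Proof.
move=> h; apply: ler_wpM2l.
  by rewrite invr_ge0 mulr_ge0 // ltW ?lang_card_gt0.
by rewrite !big_seq; apply: ler_sum => u /h hu; rewrite ler_wpM2l.
Qed.

Lemma average_cst n (x : R) : (0 < n)%N -> average n (fun=> x) = n%:R^-1 * x.
Proof.
move=> n0; have L0 := lang_card_gt0 m f_ge0 n.
rewrite /average -mulr_suml -[\sum_(u <- _) _]/(L n).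
by field; rewrite !gt_eqF ?ltr0n.
Qed.

Lemma average_near n F G : (0 < n)%N ->
  (forall u, u \in words m n -> `|F u - G u| <= 1) -> `|average n F - average n G| <= n%:R^-1.
Proof.
move=> n0 h; rewrite -[leRHS]mulr1 -average_cst //.
have -> : average n F - average n G = average n (fun u => F u - G u).
  rewrite /average -mulrBr -sumrB; congr (_ * _); apply: eq_bigr => u _; ring.
rewrite ler_norml; apply/andP; split; last first.
  by apply: average_le => u /h; rewrite ler_norml => /andP[].
rewrite average_cst // -mulrN -average_cst //.
by apply: average_le => u /h; rewrite ler_norml => /andP[].
Qed.

Lemma empirical_ge0 n s : 0 <= empirical n s.
Proof.
have [->|n0] := posnP n; first by rewrite /empirical /average mul0r invr0 mul0r.
rewrite -[leLHS](mulr0 n%:R^-1) -average_cst //; apply: average_le => u _.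
by case/andP: (occurrences_bounds s n u).
Qed.

Lemma empirical_le1 n s : empirical n s <= 1.
Proof.
have [->|n0] := posnP n; first by rewrite /empirical /average mul0r invr0 mul0r ler01.
apply: le_trans (_ : average n (fun=> n%:R) <= _).
  by apply: average_le => u _; case/andP: (occurrences_bounds s n u).
by rewrite average_cst // mulVf // pnatr_eq0 -lt0n.
Qed.

Lemma empirical_nil n : (0 < n)%N -> empirical n [::] = 1.
Proof.
move=> n0; rewrite /empirical.
have -> : occurrences [::] n = fun=> n%:R.
  apply/funext => u; rewrite /occurrences.
  under eq_bigr => i _ do rewrite /occurs take0 eqxx.
  by rewrite sumr_const card_ord.
by rewrite average_cst // mulVf // pnatr_eq0 -lt0n.
Qed.

Lemma empirical_rcons n s : (0 < n)%N ->
  `|empirical n s - \sum_(c <- letters m) empirical n (rcons s c)| <= n%:R^-1.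
Proof. by move=> n0; rewrite average_sum; apply: average_near => // u; apply: occurrences_rcons. Qed.

Lemma empirical_cons n s : (0 < n)%N ->
  `|empirical n s - \sum_(c <- letters m) empirical n (c :: s)| <= n%:R^-1.
Proof. by move=> n0; rewrite average_sum; apply: average_near => // u; apply: occurrences_cons. Qed.

(** A limit of these frequencies is carried by the language. *)
Lemma empirical_factor n s : empirical n s != 0 -> (s \in words m (size s)) && lang f s.
Proof.
apply: contraNT => hs; apply/eqP; rewrite /empirical /average big_seq big1 ?mulr0 // => u.
rewrite mem_words => /andP[_ hu].
have [hl|] := boolP (lang f u); last by rewrite mul0r.
rewrite mul1r /occurrences big1 // => i _; case: (boolP (occurs s i u)) => // /eqP ho.
move: hs; rewrite -ho mem_words eqxx /= lang_take ?lang_drop // andbT.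
by case/negP; apply/allP => c /mem_take /mem_drop; exact: (allP hu).
Qed.

Lemma occurs_card_le n s i C : 1 <= C -> (forall k, L k <= C * lam ^+ k) -> (i < n)%N ->
  count_words m R n (fun u => lang f u && occurs s i u) <= C ^+ 2 * lam ^+ n / lam ^+ size s.
Proof.
move=> C1 hL hi; have l0 := growth_gt0 m f.
have C0 : 0 <= C by apply: le_trans C1.
have [hk|hk] := leqP (i + size s) n; last first.
  apply: le_trans (_ : 0 <= _); last by rewrite divr_ge0 ?mulr_ge0 ?exprn_ge0 // ltW.
  rewrite /count_words big_seq big1 // => u /size_words hu.
  case: (boolP (occurs s i u)) => [/eqP/(congr1 size)|]; last by rewrite andbF.
  rewrite size_take_min size_drop hu => /minn_idPl h.
  by exfalso; move: h hk hi; clear; lia.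
rewrite -(subnKC hk) -addnA; set r := (n - _)%N.
apply: le_trans (@le_count_words_cat m R i (size s + r) _ (lang f)
  (fun w => lang f w && (take (size s) w == s)) _) _.
  move=> x y /size_words hx _ /andP[hl]; rewrite /occurs drop_size_cat // => ->.
  by rewrite (lang_catl f_homo f_ge0 hl) (lang_catr f_homo f_ge0 hl).
have h1 : count_words m R (size s + r) (fun w => lang f w && (take (size s) w == s)) <= 1 * L r.
  apply: le_trans (@le_count_words_cat m R (size s) r _ (pred1 s) (lang f) _) _.
    move=> x y /size_words hx _ /andP[hl]; rewrite take_size_cat // => hs.
    by rewrite /= hs (lang_catr f_homo f_ge0 hl).
  rewrite ler_wpM2r ?(ltW (lang_card_gt0 _ _ _)) // /count_words.
  have [hs|hs] := boolP (s \in words m (size s)).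
    by rewrite (bigD1_seq s) ?uniq_words //= eqxx big1 ?addr0 // => w /negPf ->.
  by rewrite big_seq big1 ?ler01 // => w hw; case: (boolP (pred1 s w)) => // /eqP hws; rewrite hws (negPf hs) in hw.
apply: le_trans (ler_pM _ _ (hL i) h1) _; rewrite ?count_words_ge0 // mul1r.
apply: le_trans (ler_wpM2l _ (hL r)) _; first by rewrite mulr_ge0 // exprn_ge0 // ltW.
rewrite le_eqVlt !exprD; apply/orP; left; apply/eqP; field.
by rewrite gt_eqF // exprn_gt0.
Qed.

(** The parts of a word on both sides of an occurrence are in the language; the
    growth of the language is exactly geometric up to a constant, which leaves a
    bound that does not depend on [n]. *)
Lemma empirical_le n s C : 1 <= C -> (forall k, L k <= C * lam ^+ k) ->
  empirical n s <= C ^+ 2 / lam ^+ size s.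
Proof.
move=> C1 hL; have l0 := growth_gt0 m f; have L0 := lang_card_gt0 m f_ge0 n.
have [->|n0] := posnP n.
  by rewrite /empirical /average mul0r invr0 mul0r divr_ge0 ?exprn_ge0 ?ltW // (lt_le_trans ltr01).
rewrite /empirical /average mulrC ler_pdivrMr ?mulr_gt0 ?ltr0n //.
under eq_bigr => u _ do rewrite /occurrences mulr_sumr.
rewrite exchange_big /=.
apply: le_trans (_ : \sum_(i < n) C ^+ 2 * lam ^+ n / lam ^+ size s <= _).
  apply: ler_sum => i _; apply: le_trans (occurs_card_le s C1 hL (ltn_ord i)).
  by rewrite /count_words; apply: ler_sum => u _; rewrite -natrM mulnb.
rewrite sumr_const card_ord -[leLHS]mulr_natl.
have -> : C ^+ 2 / lam ^+ size s * (n%:R * L n) = n%:R * (C ^+ 2 * L n / lam ^+ size s) by ring.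
rewrite ler_wpM2l // ler_pM2r ?invr_gt0 ?exprn_gt0 // ler_wpM2l ?exprn_ge0 ?(le_trans ler01) //.
exact: growth_le.
Qed.

Hypothesis alpha_gt : \sum_(1 <= i < m.+1) (i%:R / i.+1%:R) < alpha.
Hypothesis alpha_le : forall k, alpha * k%:R <= f k.

(** An ultrafilter provides the limits for all words at once, in place of a diagonal
    extraction. *)
Lemma empirical_limit : exists P : seq nat -> R, exists G : set_system nat,
  [/\ ProperFilter G, \oo `<=` G & forall s, empirical n s @[n --> G] --> P s].
Proof.
have [G [GU hG]] := @ultraFilterLemma nat \oo _.
have GP : ProperFilter G by exact: ultra_proper.
suff h s : exists x : R, empirical n s @[n --> G] --> x.
  by have [P hP] := choice h; exists P, G.
have h01 : (empirical n s @[n --> G]) [set` `[0 : R, 1]].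
  have hT : empirical^~ s @^-1` [set` `[0 : R, 1]] = setT.
    by apply/seteqP; split => // n _; rewrite /= in_itv /= empirical_ge0 empirical_le1.
  have : G (empirical^~ s @^-1` [set` `[0 : R, 1]]) by rewrite hT; exact: filterT.
  by [].
have [x [_ hx]] := segment_compact (fmap_proper_filter _ GP) h01.
exists x => A hA; case: (in_ultra_setVsetC (empirical^~ s @^-1` A) GU) => // hC.
have [y [hy1 hy2]] := hx (~` A) A hC hA.
by case: (hy1 hy2).
Qed.

(** The bound [P s <= C ^+ 2 / lam ^+ size s] passes to the limit, and makes the block
    entropies at least [n * ln lam] up to a constant. Subadditivity along the
    multiples of [n] removes the constant. *)
Theorem maximal_exists : exists P, maximal m f P.
Proof.
have [C C1 hL] := lang_card_le m_gt0 f_homo f_ge0 alpha_gt alpha_le.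
have C0 : 0 < C by apply: lt_le_trans C1.
have l0 := growth_gt0 m f.
have [P [G [GP hG hP]]] := empirical_limit.
have near_gt0 : \forall n \near G, (0 < n)%N by apply: hG; exact: nbhs_infty_gt.
have inv0 : n%:R^-1 @[n --> G] --> (0 : R).
  suff h : n%:R^-1 @[n --> \oo] --> (0 : R) by move=> A /h; apply: hG.
  by rewrite -cvg_shiftS; exact: cvg_harmonic.
have sum_eq s (g : nat -> seq nat) :
    (forall n, (0 < n)%N -> `|empirical n s - \sum_(c <- letters m) empirical n (g c)| <= n%:R^-1) ->
    \sum_(c <- letters m) P (g c) = P s.
  move=> h.
  have h1 : \sum_(c <- letters m) empirical n (g c) @[n --> G] --> \sum_(c <- letters m) P (g c).
    by apply: cvg_big => [|c _]; [exact: add_continuous|exact: hP].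
  have h2 : empirical n s - \sum_(c <- letters m) empirical n (g c) @[n --> G] --> P s - \sum_(c <- letters m) P (g c).
    by apply: cvgB.
  have h3 : empirical n s - \sum_(c <- letters m) empirical n (g c) @[n --> G] --> (0 : R).
    apply/norm_cvg0P; apply: squeeze_cvgr (@cvg_cst R 0 _ G _) (inv0).
    by apply: filterS near_gt0 => n /h ->; rewrite normr_ge0.
  by apply/esym/subr0_eq; exact: (cvg_unique (@Rhausdorff R) h2 h3).
have P_le s : P s <= C ^+ 2 / lam ^+ size s.
  rewrite -(cvg_lim _ (hP s)) //; apply: limr_le; first by apply/cvg_ex; exists (P s).
  by apply: nearW => n; apply: empirical_le.
have hproc : process m f P.
  split.
  - move=> s; rewrite -(cvg_lim _ (hP s)) //; apply: limr_ge; first by apply/cvg_ex; exists (P s).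
    by apply: nearW => n; apply: empirical_ge0.
  - apply: (cvg_unique (@Rhausdorff R) (hP [::])).
    apply: cvg_near_cst; apply: filterS near_gt0 => n; exact: empirical_nil.
  - by move=> s; apply: sum_eq => n; apply: empirical_rcons.
  - by move=> s; apply: sum_eq => n; apply: empirical_cons.
  - move=> s hs; apply/negPn/negP => h; case/negP: hs; apply/eqP.
    apply: (cvg_unique (@Rhausdorff R) (hP s)).
    apply: cvg_near_cst; apply: nearW => n; apply/eqP/negPn/negP => /empirical_factor.
    by rewrite (negPf h).
  - move=> s hs; apply/negPn/negP => h; case/negP: hs; apply/eqP.
    apply: (cvg_unique (@Rhausdorff R) (hP s)).
    apply: cvg_near_cst; apply: nearW => n; apply/eqP/negPn/negP => /empirical_factor.
    by rewrite (negPf h) andbF.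
exists P; split => // n.
have H_ge k : k%:R * ln lam - ln (C ^+ 2) <= entropy_words m P k.
  have -> : k%:R * ln lam - ln (C ^+ 2) = \sum_(u <- words m k) P u * (k%:R * ln lam - ln (C ^+ 2)).
    by rewrite -mulr_suml (process_sum hproc) mul1r.
  rewrite /entropy_words -sumrN !big_seq; apply: ler_sum => u /size_words hu.
  have [->|hu0] := eqVneq (P u) 0; first by rewrite !mul0r oppr0.
  have Pu : 0 < P u by rewrite lt0r hu0 (process_ge0 hproc).
  rewrite -mulrN (ler_wpM2l (ltW Pu)) // -opprB lerN2.
  have := P_le u; rewrite hu -ler_ln ?posrE ?divr_gt0 ?exprn_gt0 //.
  by rewrite ln_div ?posrE ?exprn_gt0 // [ln (lam ^+ k)]lnXn // mulr_natl.
have H_mul k : entropy_words m P (k * n) <= k%:R * entropy_words m P n.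
  elim: k => [|k IH].
    by rewrite mul0n mul0r /entropy_words big_words0 (process_nil hproc) ln1 mulr0 oppr0.
  rewrite mulSn; apply: le_trans (entropy_words_subadditive hproc _ _) _.
  by rewrite -natr1 mulrDl mul1r addrC lerD2r.
rewrite leNgt; apply/negP => hlt.
have [k hk] : exists k : nat, ln (C ^+ 2) < k%:R * (n%:R * ln lam - entropy_words m P n).
  have d0 : 0 < n%:R * ln lam - entropy_words m P n by rewrite subr_gt0.
  exists (Num.bound `|ln (C ^+ 2) / (n%:R * ln lam - entropy_words m P n)|).
  rewrite -ltr_pdivrMr //; exact: le_lt_trans (ler_norm _) (archi_boundP (normr_ge0 _)).
have := le_trans (H_ge (k * n)%N) (H_mul k); rewrite natrM; move: hk; lra.
Qed.

End Existence.

(** * Cylinders and the Borel sets of the configuration space *)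

Definition window (x : config) (i : int) n : seq nat := [seq x (i + j%:Z) | j <- iota 0 n].

Definition cyl (i : int) (u : seq nat) : set borel_config :=
  [set x | window x i (size u) = u].

Lemma size_window x i n : size (window x i n) = n.
Proof. by rewrite size_map size_iota. Qed.

Lemma nth_window x i n j : (j < n)%N -> nth 0%N (window x i n) j = x (i + j%:Z).
Proof. by move=> h; rewrite (nth_map 0%N) ?size_iota // nth_iota. Qed.

Lemma window_cat x i n k : window x i (n + k) = window x i n ++ window x (i + n%:Z) k.
Proof.
rewrite /window iotaD map_cat; congr (_ ++ _).
rewrite add0n -{1}[n]addn0 iotaDl -map_comp; apply: eq_map => j /=.
by rewrite PoszD addrA.
Qed.

Lemma window1 x i : window x i 1 = [:: x i].
Proof. by rewrite /window /= addr0. Qed.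

Lemma window_shift x i n : window (shift_map x) i n = window x (i + 1) n.
Proof. by apply: eq_map => j; rewrite /shift_map addrAC. Qed.

Lemma word_atE x i n : tval (word_at x i n) = window x i n.
Proof.
apply: (@eq_from_nth _ 0%N); first by rewrite size_tuple size_window.
rewrite size_tuple => j hj; rewrite nth_window //.
by rewrite -[j]/(val (Ordinal hj)) -tnth_nth tnth_mktuple.
Qed.

Lemma cylinderE n (w : n.-tuple nat) : cylinder w = cyl 0 (tval w).
Proof.
apply/seteqP; split => x /=; rewrite /cyl /= size_tuple.
  by move=> <-; rewrite word_atE.
by move=> h; rewrite /cylinder /=; apply: val_inj; rewrite /= word_atE.
Qed.

Lemma shift_cyl i u : shift_map @^-1` cyl i u = cyl (i + 1) u.
Proof. by apply/seteqP; split => x; rewrite /cyl /= window_shift. Qed.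

Lemma cyl_nil i : cyl i [::] = setT.
Proof. by apply/seteqP; split. Qed.

Lemma cylP i u x : cyl i u x <-> forall j, (j < size u)%N -> x (i + j%:Z) = nth 0%N u j.
Proof.
split=> [h j hj|h]; first by rewrite -(nth_window x i hj) h.
apply: (@eq_from_nth _ 0%N); rewrite ?size_window // => j hj.
by rewrite nth_window // h.
Qed.

Lemma cyl_cat i u v : cyl i (u ++ v) = cyl i u `&` cyl (i + (size u)%:Z) v.
Proof.
apply/seteqP; split => x; rewrite /cyl /= size_cat window_cat.
  by move/eqP; rewrite eqseq_cat ?size_window // => /andP[/eqP -> /eqP ->].
by move=> [-> ->].
Qed.

Lemma coord_open (i : int) (c : nat) : open [set x : config | x i = c].
Proof.
have h : open ((proj i : config -> nat) @^-1` [set c]).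
  by apply: open_comp; [move=> x _; exact: proj_continuous|exact: discrete_open].
by [].
Qed.

Lemma cyl_open i u : open (cyl i u : set config).
Proof.
elim: u i => [|c u IH] i; first by rewrite cyl_nil; exact: openT.
rewrite -cat1s cyl_cat; apply: openI; last exact: IH.
rewrite (_ : cyl i [:: c] = [set x : config | x i = c]); first exact: coord_open.
by apply/seteqP; split => x; rewrite /cyl /= window1; [case|move=> ->].
Qed.

Lemma measurable_cyl i u : measurable (cyl i u).
Proof. by apply: sub_sigma_algebra; exact: cyl_open. Qed.

(** Cylinders over a symmetric window form a countable base of the topology. *)
Definition box (u : seq nat) : set borel_config := cyl (- (size u)./2%:Z) u.

Lemma box_nbhs (x : config) (U : set config) : nbhs x U ->
  exists n, [set y : config | forall i : int, - n%:Z <= i < n%:Z -> y i = x i] `<=` U.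
Proof.
pose F := filter_from [set: nat]
  (fun n => [set y : config | forall i : int, - n%:Z <= i < n%:Z -> y i = x i]).
have FF : Filter F.
  apply: filter_from_filter; first by exists 0%N.
  move=> i j _ _; exists (maxn i j) => // y hy; split => k /andP[h1 h2]; apply: hy; lia.
suff cF : F --> x by move=> /cF [n _ hn]; exists n.
apply/cvg_sup => i A; rewrite nbhsE => -[B [[W oW <-] /= Wx] sBA].
exists `|i|.+1%N => // y hy; apply: sBA => /=.
rewrite hy //; lia.
Qed.

Lemma open_bigcup_box (U : set config) : open U ->
  U = \bigcup_(u in [set u | ~~ odd (size u) /\ (box u `<=` U)%classic]) box u.
Proof.
move=> oU; apply/seteqP; split => [x Ux|x [u /= [_ hu] hx]]; last exact: hu.
have [n hn] := box_nbhs (open_nbhs_nbhs (conj oU Ux)).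
have hs : size (window x (- n%:Z) (n + n)) = (n + n)%N by rewrite size_window.
have hh : (size (window x (- n%:Z) (n + n)))./2 = n by rewrite hs addnn doubleK.
exists (window x (- n%:Z) (n + n)); last by rewrite /box hh /cyl /= hs.
split; first by rewrite hs addnn odd_double.
move=> y; rewrite /box hh => /cylP hy; apply: hn => i /andP[i1 i2].
have hj : (absz (i + n%:Z)%R < n + n)%N by lia.
have := hy (absz (i + n%:Z)%R); rewrite hs nth_window //.
have -> : - n%:Z + (absz (i + n%:Z)%R)%:Z = i by lia.
exact.
Qed.

Definition boxes : set (set borel_config) :=
  [set A | A = set0 \/ exists2 u, ~~ odd (size u) & A = box u].

Lemma borel_boxes : (@measurable _ borel_config) = <<s boxes >>.
Proof.
apply/seteqP; split.
  apply: smallest_sub => [|U oU]; first exact: smallest_sigma_algebra.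
  rewrite (open_bigcup_box oU) bigcup_mkcond.
  have := @countable_bigcupT_measurable _ (g_sigma_algebraType boxes) (seq nat)
    (fun u => if u \in [set u | ~~ odd (size u) /\ (box u `<=` U)%classic] then box u else set0).
  apply; first exact: countableP.
  move=> u; case: ifPn => [|_]; last exact: measurable0.
  by rewrite inE /= => -[hu _]; apply: sub_sigma_algebra; right; exists u.
apply: smallest_sub; first exact: sigma_algebra_measurable.
move=> A [->|[u _ ->]]; [exact: measurable0|exact: measurable_cyl].
Qed.

Lemma box_sub u v x : (size u <= size v)%N -> box u x -> box v x -> box v `<=` box u.
Proof.
move=> huv /cylP hu /cylP hv y /cylP hy; apply/cylP => j hj.
rewrite -hu //.
pose k := (j + ((size v)./2 - (size u)./2))%N.
have hk : (k < size v)%N.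
  rewrite /k; move: hj huv; clear; lia.
have -> : - (size u)./2%:Z + j%:Z = - (size v)./2%:Z + k%:Z.
  rewrite /k; move: huv; clear; lia.
by rewrite hy // hv.
Qed.

Lemma boxes_setI_closed : setI_closed boxes.
Proof.
move=> A B [->|[u hu ->]]; first by left; rewrite set0I.
move=> [->|[v hv ->]]; first by left; rewrite setI0.
have [->|/set0P[x [xu xv]]] := eqVneq (box u `&` box v) set0; first by left.
right; have [h|/ltnW h] := leqP (size u) (size v).
  by exists v => //; apply/setIidr/(box_sub h xu xv).
by exists u => //; apply/setIidl/(box_sub h xv xu).
Qed.

(** Two boxes are nested or disjoint, so that boxes form a pi-system, and they
    generate the Borel sets. *)
Lemma cyl_measure_unique (R : realType) (mu nu : probability borel_config R) :
  (forall i u, mu (cyl i u) = nu (cyl i u)) ->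
  forall A, measurable A -> mu A = nu A.
Proof.
move=> h A mA.
apply: (measure_unique boxes (fun=> setT)) => //.
- exact: borel_boxes.
- exact: boxes_setI_closed.
- by move=> _; right; exists [::] => //; rewrite /box cyl_nil.
- by rewrite bigcup_const.
- by move=> B [->|[u _ ->]]; [rewrite !measure0|exact: h].
- by move=> _; apply: le_lt_trans (probability_le1 mu measurableT) (ltry _).
Qed.

(** * From invariant measures to processes *)

Section Shift.
Variables (R : realType) (f : nat -> R).
Hypothesis f_homo : {homo f : i j / (i <= j)%N >-> i <= j}.
Hypothesis f_ge0 : forall k, 0 <= f k.
Local Notation X := (bounded_density_shift f).

Lemma sum_window (x : config) i p :
  (\sum_(0 <= r < p) x (i + r%:Z)%R)%R = sumn (window x i p).
Proof. by rewrite sumnE big_map /index_iota subn0. Qed.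

Lemma take_window x i n k : take k (window x i n) = window x i (minn k n).
Proof. by rewrite /window -map_take take_iota. Qed.

Lemma drop_window x i n k : drop k (window x i n) = window x (i + k%:Z) (n - k).
Proof.
have [h|h] := leqP k n.
  by rewrite -{1}(subnKC h) window_cat drop_size_cat // size_window.
by rewrite drop_oversize ?size_window ?(ltnW h) // (eqP (ltnW h : n - k == 0)%N).
Qed.

Lemma shiftP x : X x <-> forall i n, lang f (window x i n).
Proof.
split=> [h i n|h p i p0]; last first.
  have /(langP f_homo f_ge0)/(_ 0%N p) := h i p.
  by rewrite drop0 take_oversize ?size_window // sum_window.
apply/(langP f_homo f_ge0) => j k; rewrite drop_window take_window.
have [->|h0] := posnP (minn k (n - j)); first by rewrite /window /= f_ge0.
have := h _ (i + j%:Z) h0; rewrite sum_window => /le_trans; apply.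
by apply: f_homo; rewrite geq_minl.
Qed.

(** Measurability follows, and a measure for which the words outside of the language
    are null is carried by the shift. *)
Lemma shift_bigcap : X = \bigcap_(iu in [set iu : int * seq nat | ~~ lang f iu.2]) ~` cyl iu.1 iu.2.
Proof.
apply/seteqP; split => x; first by move=> /shiftP h [i u] /= /negP hu hx; apply: hu; rewrite -hx.
move=> h; apply/shiftP => i n; apply/negPn/negP => hl.
by apply: (h (i, window x i n)) => //=; rewrite /cyl /= size_window.
Qed.

Lemma measurable_shift : measurable (X : set borel_config).
Proof.
rewrite shift_bigcap -[bigcap _ _]setCK setC_bigcap; apply: measurableC.
rewrite bigcup_mkcond; apply: countable_bigcupT_measurable; first exact: countableP.
move=> [i u]; case: ifP => _ //=; rewrite setCK; exact: measurable_cyl.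
Qed.

Lemma lang_rcons0 u : lang f u -> lang f (rcons u 0%N).
Proof.
move=> /(langP f_homo f_ge0) h; apply/(langP f_homo f_ge0) => i k.
apply: le_trans (h i k); rewrite ler_nat -cats1 dropD_cat takeD_cat sumn_cat.
rewrite -[leqRHS]addn0 leq_add2l; case: (_ - _)%N => [|j] /=; by case: (_ - _)%N => [|[|?]].
Qed.

Lemma lang_pad a b u : lang f u -> lang f (nseq a 0%N ++ u ++ nseq b 0%N).
Proof.
move=> hu; have {hu} : lang f (u ++ nseq b 0%N).
  elim: b => [|b IH]; first by rewrite cats0.
  by rewrite -addn1 nseqD catA cats1; exact: lang_rcons0.
move: (u ++ _) => v hv; elim: a => [//|a IH].
by rewrite -(lang_rev f_homo f_ge0) /= rev_cons; apply: lang_rcons0; rewrite lang_rev.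
Qed.

(** Zeros add nothing to the sums, so that a word of the language extends to a point
    of the shift. *)
Lemma zero_extend u : lang f u -> exists2 x : config, X x & cyl 0 u x.
Proof.
move=> hu; pose x : config := fun i => if i is Posz j then nth 0%N u j else 0%N.
exists x; last by apply/cylP => j _; rewrite add0r.
apply/shiftP => i n; pose a := absz i.
have hw : window x (- a%:Z) (a + (size u + (n + a))) = nseq a 0%N ++ u ++ nseq (n + a) 0%N.
  rewrite window_cat (window_cat _ _ (size u)); congr (_ ++ (_ ++ _)).
  - apply: (@eq_from_nth _ 0%N); rewrite size_window ?size_nseq // => j hj.
    rewrite nth_window // nth_nseq hj /x.
    by have -> : - a%:Z + j%:Z = Negz (a - j).-1 by move: hj; clear; lia.
  - apply: (@eq_from_nth _ 0%N); rewrite size_window // => j hj.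
    by rewrite nth_window // addNr add0r.
  - apply: (@eq_from_nth _ 0%N); rewrite size_window ?size_nseq // => j hj.
    rewrite nth_window // nth_nseq hj addNr add0r -PoszD /x nth_default //; exact: leq_addr.
have := lang_pad a (n + a) hu; rewrite -hw => hl.
have {hl} := lang_take f_homo f_ge0 n (lang_drop f_homo f_ge0 (absz (i + a%:Z)%R) hl).
rewrite drop_window take_window.
have -> : - a%:Z + (absz (i + a%:Z)%R)%:Z = i by rewrite /a; lia.
by rewrite (minn_idPl _) //; rewrite /a; lia.
Qed.

Lemma languageP n (w : n.-tuple nat) : language X n w <-> lang f w.
Proof.
split=> [[x Xx [i <-]]|/zero_extend [x Xx hx]].
  by rewrite word_atE; move/shiftP: Xx.
by exists x => //; exists 0; apply: val_inj; rewrite /= word_atE -[RHS]hx size_tuple.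
Qed.

Variable m : nat.
Hypothesis X_letters : (X `<=` [set x | forall i, (x i <= m)%N])%classic.

Lemma lang_words u : lang f u -> u \in words m (size u).
Proof.
move=> /zero_extend [x Xx hx]; rewrite mem_words eqxx /= -hx.
by apply/allP => c /mapP[j _ ->]; exact: X_letters.
Qed.

Definition lang_tuples n : seq (n.-tuple nat) := pmap insub [seq u <- words m n | lang f u].

Lemma map_lang_tuples n : map val (lang_tuples n) = [seq u <- words m n | lang f u].
Proof.
rewrite (pmap_filter (insubK _)) -filter_predI; apply: eq_in_filter => u /size_words hu.
by rewrite /= isSome_insub hu eqxx.
Qed.

Lemma uniq_lang_tuples n : uniq (lang_tuples n).
Proof. by rewrite -(map_inj_uniq val_inj) map_lang_tuples filter_uniq // uniq_words. Qed.

Lemma mem_lang_tuples n (w : n.-tuple nat) : (w \in lang_tuples n) = lang f w.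
Proof.
rewrite -(mem_map val_inj) map_lang_tuples mem_filter.
by case: (boolP (lang f w)) => // /lang_words; rewrite size_tuple => ->.
Qed.

Lemma language_tuples n : language X n = [set` lang_tuples n].
Proof.
apply/seteqP; split => w /=; rewrite mem_lang_tuples; first by move/languageP.
by move=> h; apply/languageP.
Qed.

Lemma htopE : htop R X = ln (growth m f).
Proof.
rewrite /growth expRK /htop; congr (limn _); apply/funext => n; congr (ln _ / _).
rewrite /lang_card /count_words (bigID (lang f)) /= [X in _ + X]big1 ?addr0; last by move=> u /negPf ->.
rewrite (eq_bigr (fun=> 1)); last by move=> u ->.
rewrite -big_filter big_const_seq count_predT iter_addr_0.
have hp : perm_eq (finmap.enum_fset (fset_set (language X n))) (lang_tuples n).
  apply: uniq_perm; rewrite ?finmap.fset_uniq ?uniq_lang_tuples // => w.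
  have hfin : finite_set (language X n) by rewrite language_tuples; exact: finite_seq.
  by rewrite in_fset_set // language_tuples mem_setE.
by rewrite (perm_size hp) -(size_map val) map_lang_tuples.
Qed.

Section OfMeasure.
Variable nu : probability borel_config R.
Hypothesis nuX : invariant_measure X nu.

Definition mass (A : set borel_config) : R := fine (nu A).

Lemma massE A : measurable A -> nu A = (mass A)%:E.
Proof. by move=> mA; rewrite fineK // fin_num_measure. Qed.

Lemma mass_ge0 A : 0 <= mass A.
Proof. exact: fine_ge0. Qed.

Lemma massU A B : measurable A -> measurable B -> A `&` B = set0 ->
  mass (A `|` B) = mass A + mass B.
Proof.
move=> mA mB h; apply: EFin_inj; rewrite EFinD -!massE //; last exact: measurableU.
by rewrite measureU.
Qed.

Lemma mass_null (A : set borel_config) : measurable A -> A `&` X = set0 -> mass A = 0.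
Proof.
move=> mA h; have := massU mA measurable_shift h.
have h1 : mass X = 1 by rewrite /mass; case: nuX => ->.
have : mass (A `|` X) <= 1.
  have mAX : measurable (A `|` X) by apply: measurableU => //; exact: measurable_shift.
  by rewrite -lee_fin -massE // probability_le1.
have := mass_ge0 A; lra.
Qed.

(** Letters above [m] do not occur in the shift, and thus carry no mass. *)
Lemma mass_coord A (j : int) : measurable A ->
  mass A = \sum_(c <- letters m) mass (A `&` cyl j [:: c]).
Proof.
move=> mA.
have mC s : measurable [set x : borel_config | x j \in (s : seq nat)].
  elim: s => [|c s IH]; first by rewrite (_ : [set _ | _] = set0) //; apply/seteqP; split.
  rewrite (_ : [set _ | _] = cyl j [:: c] `|` [set x : borel_config | x j \in s]).
    by apply: measurableU => //; exact: measurable_cyl.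
  apply/seteqP; split => x; rewrite /cyl /= window1 inE.
    by move=> /orP[/eqP ->|]; [left|right].
  by case=> [[->]|->]; rewrite ?eqxx ?orbT.
have key (s : seq nat) : uniq s ->
    mass (A `&` [set x | x j \in s]) = \sum_(c <- s) mass (A `&` cyl j [:: c]).
  elim: s => [_|c s IH /= /andP[hc hs]].
    rewrite big_nil (_ : _ `&` _ = set0); first by rewrite /mass measure0.
    by apply/seteqP; split => // x [].
  rewrite big_cons -IH // -massU; first congr mass.
  - rewrite -setIUr; congr (_ `&` _); apply/seteqP; split => x; rewrite /cyl /= window1 inE.
      by move=> /orP[/eqP ->|]; [left|right].
    by case=> [[->]|->]; rewrite ?eqxx ?orbT.
  - by apply: measurableI => //; exact: measurable_cyl.
  - exact: measurableI.
  - apply/seteqP; split => // x [[_]]; rewrite /cyl /= window1 => -[xc] [_] xs.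
    by rewrite xc (negPf hc) in xs.
rewrite -key ?iota_uniq // -{1}(setUIDK A [set x | x j \in letters m]) massU.
- rewrite [X in _ + X]mass_null ?addr0 //; first by apply: measurableD.
  apply/seteqP; split => // x [[_ /= h] /X_letters /(_ j)].
  by rewrite -mem_letters => /h.
- exact: measurableI.
- exact: measurableD.
- by apply/seteqP; split => // x [[_ h] [_]] /(_ h).
Qed.

Lemma mass_cyl i u : mass (cyl i u) = mass (cyl 0 u).
Proof.
have step j : mass (cyl (j + 1) u) = mass (cyl j u).
  by rewrite -shift_cyl /mass (proj2 nuX) //; exact: measurable_cyl.
have neg n : mass (cyl (- n%:Z) u) = mass (cyl 0 u).
  elim: n => [//|n IH]; rewrite -IH -step; congr (mass (cyl _ u)).
  by rewrite -addn1 PoszD opprD addrNK.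
case: i => n; last by rewrite NegzE neg.
by elim: n => [//|n IH]; rewrite -addn1 PoszD step.
Qed.

Lemma measure_process : process m f (fun u => mass (cyl 0 u)).
Proof.
have meets u : mass (cyl 0 u) != 0 -> lang f u.
  apply: contraNT => hu; apply/eqP; apply: mass_null; first exact: measurable_cyl.
  apply/seteqP; split => // x [hx /shiftP /(_ 0 (size u))].
  by rewrite hx (negPf hu).
split.
- by move=> u; exact: mass_ge0.
- by rewrite cyl_nil /mass probability_setT.
- move=> u; rewrite [RHS](mass_coord (0 + (size u)%:Z)); last exact: measurable_cyl.
  by apply: eq_bigr => c _; rewrite -cats1 cyl_cat.
- move=> u; rewrite -(mass_cyl (0 + 1)) [RHS](mass_coord 0); last exact: measurable_cyl.
  by apply: eq_bigr => c _; rewrite -cat1s cyl_cat setIC.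
- by move=> u /meets /lang_words.
- exact: meets.
Qed.

Lemma measure_entropyE : entropy X nu =
  limn (fun n => entropy_words m (fun u => mass (cyl 0 u)) n / n%:R).
Proof.
rewrite /entropy; congr (limn _); apply/funext => n; congr (_ / _).
rewrite language_tuples -fsbig_seq ?uniq_lang_tuples //.
transitivity (\sum_(u <- map val (lang_tuples n)) - (mass (cyl 0 u) * ln (mass (cyl 0 u)))).
  by rewrite big_map; apply: eq_bigr => w _; rewrite cylinderE.
rewrite map_lang_tuples big_filter /entropy_words -sumrN [RHS](bigID (lang f)) /=.
rewrite [X in _ = _ + X]big1 ?addr0 // => u hu.
suff -> : mass (cyl 0 u) = 0 by rewrite mul0r oppr0.
apply/eqP/negPn/negP => /(process_lang measure_process); exact/negP.
Qed.

(** Subadditivity of the block entropies makes the bound hold at every length,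
    and not only in the limit. *)
Lemma mme_maximal : entropy X nu = htop R X -> maximal m f (fun u => mass (cyl 0 u)).
Proof.
move=> h; split=> [|n]; first exact: measure_process.
have [_ /(_ n)] := fekete (entropy_words_ge0 measure_process)
  (entropy_words_subadditive measure_process).
by rewrite -measure_entropyE h htopE mulrC.
Qed.

(** The block entropies are squeezed between [n * ln lam] and the logarithm of the
    number of words. *)
Lemma maximal_mme : maximal m f (fun u => mass (cyl 0 u)) -> is_mme X nu.
Proof.
move=> [hP hH]; split => //; rewrite measure_entropyE htopE.
apply: cvg_lim => //.
have [cv _] := growth_cvg m f_homo f_ge0.
have e : ln (growth m f) = limn (fun n => ln (lang_card m f n) / n%:R) by rewrite /growth expRK.
rewrite -e in cv.
apply: squeeze_cvgr (@cvg_cst R (ln (growth m f)) _ \oo _) (cv).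
near=> n; have n0 : 0 < n%:R :> R by rewrite ltr0n; near: n; exact: nbhs_infty_gt.
rewrite ler_pdivlMr // ler_pM2r ?invr_gt0 // mulrC hH /=.
exact: entropy_words_le.
Unshelve. all: by end_near.
Qed.

End OfMeasure.

End Shift.

(** * A measure realising a process *)

Section Weave.

(** Bi-infinite sequences are read off one-sided ones by alternately writing to
    the right and to the left, so that a growing window gains one letter at a time. *)
Definition unfold (y : nat -> nat) : config :=
  fun i => match i with Posz j => y j.*2 | Negz j => y j.*2.+1 end.

Fixpoint weave (y : nat -> nat) k : seq nat :=
  if k is k'.+1 then if odd k' then y k' :: weave y k' else rcons (weave y k') (y k')
  else [::].

Lemma window_unfold y k : window (unfold y) (- k./2%:Z) k = weave y k.
Proof.
elim: k => [//|k IH]; rewrite [weave _ _]/=; case: ifP => hk.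
  have hk2 := odd_double_half k; rewrite hk add1n in hk2.
  have -> : (k.+1./2 = k./2.+1)%N by rewrite -{1}hk2 /= doubleK.
  rewrite -[X in window _ _ X]add1n window_cat window1 cat1s; congr (_ :: _).
    by rewrite -NegzE /= hk2.
  by rewrite -IH; congr (window _ _ _); rewrite -addn1 PoszD; ring.
have hk2 := odd_double_half k; rewrite hk add0n in hk2.
have -> : (k.+1./2 = k./2)%N by rewrite -{1}hk2 /= uphalf_double.
rewrite -addn1 window_cat window1 -cats1 IH; congr (_ ++ [:: _]).
have -> : - k./2%:Z + k%:Z = k./2%:Z by rewrite -{2}hk2 -addnn PoszD; ring.
by rewrite /= hk2.
Qed.

Definition weave_seq s := weave (nth 0%N s) (size s).

Lemma weave_ext y y' k : (forall j, (j < k)%N -> y j = y' j) -> weave y k = weave y' k.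
Proof.
elim: k => [//|k IH] h /=; rewrite h // IH // => j hj; apply: h; exact: ltnW.
Qed.

Lemma weave_rcons s c :
  weave_seq (rcons s c) = if odd (size s) then c :: weave_seq s else rcons (weave_seq s) c.
Proof.
rewrite /weave_seq size_rcons /= nth_rcons ltnn eqxx.
have -> // : weave (nth 0%N (rcons s c)) (size s) = weave (nth 0%N s) (size s).
by apply: weave_ext => j hj; rewrite nth_rcons hj.
Qed.

Lemma window_weave_seq y n : window (unfold y) (- n%:Z) (n + n) = weave_seq (mkseq y (n + n)).
Proof.
rewrite /weave_seq size_mkseq (weave_ext (y' := y)); last by move=> j hj; rewrite nth_mkseq.
by rewrite -window_unfold addnn doubleK.
Qed.

Lemma sum_weave (R : realType) m k (G : seq nat -> R) :
  \sum_(s <- words m k) G (weave_seq s) = \sum_(w <- words m k) G w.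
Proof.
elim: k G => [|k IH] G; first by rewrite !big_words0.
rewrite big_words_rcons big_seq.
under eq_bigr => s /size_words hs.
  under eq_bigr => c _ do rewrite weave_rcons hs.
  over.
rewrite -big_seq; case: (odd k).
  by rewrite big_wordsS [RHS]exchange_big -[RHS]IH.
by rewrite big_words_rcons -[RHS]IH.
Qed.

End Weave.

Section Intervals.
Variables (R : realType) (m : nat) (Q : seq nat -> R).
Hypothesis Q_ge0 : forall s, 0 <= Q s.
Hypothesis Q_nil : Q [::] = 1.
Hypothesis Q_rcons : forall s, \sum_(c <- letters m) Q (rcons s c) = Q s.

(** Each word gets an interval of length Q, the intervals of its extensions
    being laid side by side inside it: the expansion of a uniformly chosen point
    then has law Q. *)
Definition lower s := \sum_(i < size s) \sum_(0 <= c < nth 0%N s i) Q (rcons (take i s) c).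
Definition slot s : interval R := `[lower s, lower s + Q s[.

Lemma lower_rcons s c : lower (rcons s c) = lower s + \sum_(0 <= c' < c) Q (rcons s c').
Proof.
rewrite /lower size_rcons big_ord_recr /= nth_rcons ltnn eqxx -cats1 take_size_cat //.
congr (_ + _); apply: eq_bigr => i _.
by rewrite nth_cat ltn_ord takel_cat // ltnW.
Qed.

Lemma upper_rcons s c :
  lower (rcons s c) + Q (rcons s c) = lower s + \sum_(0 <= c' < c.+1) Q (rcons s c').
Proof. by rewrite lower_rcons big_nat_recr //= addrA. Qed.

Lemma sum_Q_le s c c' : (c <= c')%N ->
  \sum_(0 <= d < c) Q (rcons s d) <= \sum_(0 <= d < c') Q (rcons s d).
Proof.
by move=> h; rewrite (big_cat_nat _ h) //= lerDl sumr_ge0.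
Qed.

Lemma sum_Q_all s : \sum_(0 <= d < m.+1) Q (rcons s d) = Q s.
Proof. by rewrite -[RHS]Q_rcons /letters /index_iota subn0. Qed.

Lemma slot_rcons_sub s c t : (c <= m)%N -> t \in slot (rcons s c) -> t \in slot s.
Proof.
rewrite /slot !in_itv /= upper_rcons lower_rcons => hc /andP[h1 h2].
have h3 : 0 <= \sum_(0 <= d < c) Q (rcons s d) by apply: sumr_ge0.
have := sum_Q_le s (hc : c.+1 <= m.+1)%N; rewrite sum_Q_all => h4.
by rewrite (le_trans _ h1) ?lerDl ?h3 // (lt_le_trans h2) // lerD2l.
Qed.

Lemma slot_rcons_uniq s c c' t : t \in slot (rcons s c) -> t \in slot (rcons s c') -> c = c'.
Proof.
rewrite /slot !in_itv /= !upper_rcons !lower_rcons => /andP[h1 h2] /andP[h3 h4].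
case: (ltngtP c c') => // /(sum_Q_le s); rewrite -(lerD2l (lower s)) => h.
  by have := lt_le_trans h2 (le_trans h h3); rewrite ltxx.
by have := lt_le_trans h4 (le_trans h h1); rewrite ltxx.
Qed.

Lemma slot_rcons_ex s t : t \in slot s -> exists2 c, (c <= m)%N & t \in slot (rcons s c).
Proof.
rewrite {1}/slot in_itv /= => /andP[h1 h2].
pose p c := t < lower s + \sum_(0 <= d < c) Q (rcons s d).
have exp : exists c, p c by exists m.+1; rewrite /p sum_Q_all.
have [c hc hmin] := ex_minnP exp.
case: c hc hmin => [|c] hc hmin; first by move: hc; rewrite /p big_geq // addr0 ltNge h1.
exists c; first by apply: (hmin m.+1); rewrite /p sum_Q_all.
rewrite /slot in_itv /= upper_rcons lower_rcons; apply/andP; split => //.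
by rewrite leNgt; apply/negP => /hmin; rewrite ltnn.
Qed.

Lemma slot_uniq k s s' t : s \in words m k -> s' \in words m k ->
  t \in slot s -> t \in slot s' -> s = s'.
Proof.
elim: k s s' => [|k IH] s s'; first by rewrite !inE => /eqP -> /eqP ->.
case/lastP: s => [|s c]; first by rewrite mem_words.
case/lastP: s' => [|s' c']; first by rewrite !mem_words.
rewrite !mem_words !size_rcons !all_rcons !eqSS.
move=> /andP[hs /andP[hc hsm]] /andP[hs' /andP[hc' hsm']] h h'.
have e : s = s' by apply: IH (slot_rcons_sub hc h) (slot_rcons_sub hc' h'); rewrite mem_words ?hs ?hs'.
by rewrite e in h *; rewrite (slot_rcons_uniq h h').
Qed.

(** The slots of the extensions of a word cover its slot, so that a letter can be
    chosen at every step. *)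
Lemma expansion t : t \in slot [::] -> exists y : nat -> nat, forall k,
  mkseq y k \in words m k /\ t \in slot (mkseq y k).
Proof.
move=> ht.
have step (s : {s : seq nat | t \in slot s}) :
    exists c, (c <= m)%N /\ t \in slot (rcons (sval s) c).
  by have [c h1 h2] := slot_rcons_ex (svalP s); exists c.
have [next hnext] := choice step.
pose code := fix code k : {s : seq nat | t \in slot s} :=
  if k is k'.+1 then exist _ (rcons (sval (code k')) (next (code k'))) (hnext (code k')).2
  else exist _ [::] ht.
exists (fun k => next (code k)) => k.
have -> : mkseq (fun k => next (code k)) k = sval (code k).
  by elim: k => [//|k IH]; rewrite mkseqS IH.
split; last exact: (svalP (code k)).
elim: k => [//|k IH]; rewrite [sval _]/= mem_words size_rcons all_rcons eqSS.
by move: IH; rewrite mem_words (hnext _).1 => /andP[-> ->].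
Qed.

Lemma lower_nil : lower [::] = 0.
Proof. by rewrite /lower big_ord0. Qed.

Lemma slot_nil t : (t \in slot [::]) = (0 <= t < 1).
Proof. by rewrite /slot in_itv /= lower_nil Q_nil add0r. Qed.

Lemma slot_sub s t : s \in words m (size s) -> t \in slot s -> t \in slot [::].
Proof.
elim/last_ind: s => [//|s c IH]; rewrite mem_words eqxx all_rcons /= => /andP[hc hs] /(slot_rcons_sub hc).
by apply: IH; rewrite mem_words eqxx.
Qed.

Lemma uniform_slot s : s \in words m (size s) ->
  uniform_prob (@ltr01 R) [set` slot s] = (Q s)%:E.
Proof.
move=> hs; rewrite /uniform_prob integral_uniform_pdf setIidl; last first.
  move=> t /= /(slot_sub hs); rewrite slot_nil in_itv /=.
  by move=> /andP[-> /ltW].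
rewrite (eq_integral (fun=> 1%:E)); last first.
  move=> t; rewrite inE /= => /(slot_sub hs); rewrite slot_nil.
  by move=> /andP[h0 /ltW h1]; rewrite /uniform_pdf h0 h1 subr0 invr1.
rewrite integral_cst //= mul1e lebesgue_measure_itv /= lte_fin ltrDl.
have := Q_ge0 s; rewrite le_eqVlt => /orP[/eqP <-|->]; first by rewrite ltxx.
by rewrite -EFinD addrAC subrr add0r.
Qed.

Section Law.
Variable U : probability (measurableTypeR R) R.
Hypothesis U_slot : forall s, s \in words m (size s) -> U [set` slot s] = (Q s)%:E.

Definition slots (r : seq (seq nat)) : set (measurableTypeR R) :=
  [set t | has (fun s => t \in slot s) r].

Lemma slots_cons s r : slots (s :: r) = [set` slot s] `|` slots r.
Proof. by apply/seteqP; split => t; rewrite /slots /=; move=> /orP. Qed.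

Lemma measurable_slots r : measurable (slots r).
Proof.
elim: r => [|s r IH]; first by rewrite (_ : slots _ = set0) //; apply/seteqP; split.
by rewrite slots_cons; apply: measurableU => //; exact: measurable_itv.
Qed.

Lemma prob_slots k r : uniq r -> {subset r <= words m k} ->
  U (slots r) = (\sum_(s <- r) Q s)%:E.
Proof.
elim: r => [_ _|s r IH /= /andP[hs hr] hsub].
  by rewrite big_nil (_ : slots _ = set0) ?measure0 //; apply/seteqP; split.
have hs' : s \in words m k by apply: hsub; rewrite inE eqxx.
rewrite slots_cons measureU; [|exact: measurable_itv|exact: measurable_slots|].
  rewrite [X in (X + _)%E]U_slot ?(size_words hs') //.
  rewrite [X in (_ + X)%E]IH //; first by rewrite -EFinD big_cons.
  by move=> v hv; apply: hsub; rewrite inE hv orbT.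
apply/seteqP; split => // t [/= h1 /hasP[v hv h2]].
have := slot_uniq hs' (hsub v _) h1 h2; rewrite inE hv orbT => /(_ isT) e.
by rewrite e hv in hs.
Qed.

Lemma prob_unit_interval (D : set (measurableTypeR R)) : measurable D ->
  U D = U (D `&` [set` slot [::]]).
Proof.
move=> mD; set I : set (measurableTypeR R) := [set` slot [::]].
have mI : measurable I by exact: measurable_itv.
have h0 : U (~` I) = 0%E.
  have h1 : U I = 1%:E by rewrite U_slot // Q_nil.
  by have := probability_setC U mI; rewrite h1 => ->; rewrite -EFinD subrr.
rewrite -{1}(setUIDK D I); apply: measureU0; [exact: measurableI|exact: measurableD|].
apply/eqP; rewrite eq_le measure_ge0 andbT -h0 setDE; apply: le_measure; rewrite ?inE.
- by apply: measurableI => //; exact: measurableC.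
- exact: measurableC.
- exact: subIsetr.
Qed.

(** A point outside the unit interval gets the expansion of 0, so that the
    expansion is a function on the whole line. *)
Lemma random_sequence : exists y : R -> nat -> nat, forall k (T : pred (seq nat)),
  measurable [set t : measurableTypeR R | T (mkseq (y t) k)] /\
  U [set t | T (mkseq (y t) k)] = (\sum_(s <- words m k) (T s)%:R * Q s)%:E.
Proof.
pose clip t : R := if t \in slot [::] then t else 0.
have hclip t : clip t \in slot [::].
  by rewrite /clip; case: ifP => // _; rewrite slot_nil lexx ltr01.
have [y hy] := choice (fun t => expansion (hclip t)).
exists y => k T; set D := [set t | _]; set I : set (measurableTypeR R) := [set` slot [::]].
pose r := [seq s <- words m k | T s].
have inI t : t \in slot [::] -> T (mkseq (y t) k) = has (fun s => t \in slot s) r.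
  move=> ht; have [h1 h2] := hy t k; rewrite /clip ht in h2.
  apply/idP/hasP => [hT|[s]]; first by exists (mkseq (y t) k) => //; rewrite mem_filter hT.
  by rewrite mem_filter => /andP[hT hs] /(slot_uniq h1 hs h2) ->.
have DI : D `&` I = slots r `&` I.
  by apply/seteqP; split => t [/= h1 h2]; split => //; move: h1; rewrite /D /slots /= inI.
have slotsI : slots r `&` I = slots r.
  apply/setIidPl => t /hasP[s]; rewrite mem_filter => /andP[_ hs]; apply: slot_sub.
  by rewrite (size_words hs).
have mI : measurable I by exact: measurable_itv.
have DC : D `\` I = if T (mkseq (y 0) k) then ~` I else set0.
  have e t : ~ I t -> mkseq (y t) k = mkseq (y 0) k.
    move=> /negP/negPf ht; have [h1 h2] := hy t k; have [h3 h4] := hy 0 k.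
    apply: slot_uniq h1 h3 h2 _; move: h4; rewrite /clip ht.
    by case: ifP.
  case: ifP => hT; apply/seteqP; split => t //=.
  - by case.
  - by move=> hI; split => //; rewrite /D /= e.
  - by case=> hD hI; move: hD; rewrite /D /= e // hT.
have mD : measurable D.
  rewrite -(setUIDK D I) DI; apply: measurableU.
    by apply: measurableI => //; exact: measurable_slots.
  by rewrite DC; case: ifP => _; [exact: measurableC|exact: measurable0].
split=> //; rewrite prob_unit_interval // DI slotsI (@prob_slots k) ?filter_uniq ?uniq_words //.
  congr (_%:E); rewrite big_filter big_mkcond /=; apply: eq_bigr => s _.
  by case: (T s); rewrite ?mul1r ?mul0r.
by move=> s; rewrite mem_filter => /andP[].
Qed.

End Law.

End Intervals.

Lemma cyl_measurable_fun d (T : measurableType d) (phi : T -> borel_config) :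
  (forall i u, measurable (phi @^-1` cyl i u)) -> measurable_fun setT phi.
Proof.
move=> h; apply: (measurability boxes); first exact: borel_boxes.
move=> _ [_ [->|[u _ ->]] <-]; first by rewrite preimage_set0 setI0; exact: measurable0.
by rewrite setTI; exact: h.
Qed.

Section Realisation.
Variables (R : realType) (m : nat) (f : nat -> R) (P : seq nat -> R).
Hypothesis hP : process m f P.

Lemma cyl_occurs i u (x : config) : let n := (absz i + size u)%N in
  cyl i u x <-> occurs u (absz (i + n%:Z)%R) (window x (- n%:Z) (n + n)).
Proof.
move=> n; rewrite /occurs drop_window take_window.
have -> : - n%:Z + (absz (i + n%:Z)%R)%:Z = i by rewrite /n; lia.
have -> : minn (size u) (n + n - absz (i + n%:Z)%R) = size u by rewrite /n; lia.
by split => [->|/eqP].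
Qed.

(** A uniform point of the unit interval is expanded into a random one-sided sequence,
    which is then unfolded on both sides. *)
Theorem process_measure : exists mu : probability borel_config R,
  forall i u, mu (cyl i u) = (P u)%:E.
Proof.
pose Q s := P (weave_seq s).
have Q0 s : 0 <= Q s by exact: process_ge0 hP _.
have Q1 : Q [::] = 1 by rewrite /Q (process_nil hP).
have QS s : \sum_(c <- letters m) Q (rcons s c) = Q s.
  rewrite /Q; under eq_bigr => c _ do rewrite weave_rcons.
  by case: odd; [exact: process_cons hP _|exact: process_rcons hP _].
have [y hy] := random_sequence Q0 Q1 QS (U := uniform_prob (@ltr01 R)) (uniform_slot Q0 Q1 QS).
pose phi (t : measurableTypeR R) : borel_config := unfold (y t).
have key i u : let n := (absz i + size u)%N in phi @^-1` cyl i u =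
    [set t | occurs u (absz (i + n%:Z)%R) (weave_seq (mkseq (y t) (n + n)))].
  by move=> n; apply/seteqP; split => t /=; rewrite cyl_occurs -/n window_weave_seq.
have mphi : measurable_fun setT phi.
  apply: cyl_measurable_fun => i u; rewrite key.
  by case: (hy (absz i + size u + (absz i + size u))%N
    (fun w => occurs u (absz (i + (absz i + size u)%N%:Z)%R) (weave_seq w))).
exists (distribution (uniform_prob (@ltr01 R)) (mfun_Sub (mem_set mphi))) => i u.
rewrite /distribution /pushforward /= key; set n := (absz i + size u)%N.
have [_ ->] := hy (n + n)%N (fun w => occurs u (absz (i + n%:Z)%R) (weave_seq w)).
congr (_%:E); rewrite (sum_weave m (n + n) (fun w => (occurs u (absz (i + n%:Z)%R) w)%:R * P w)).
by apply: (process_occurs hP); rewrite /n; lia.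
Qed.

Hypothesis f_homo : {homo f : i j / (i <= j)%N >-> i <= j}.
Hypothesis f_ge0 : forall k, 0 <= f k.
Local Notation X := (bounded_density_shift f).

(** The complement of the shift is covered by countably many null cylinders, and
    invariance only needs to be checked on cylinders. *)
Lemma process_invariant_measure (mu : probability borel_config R) :
  (forall i u, mu (cyl i u) = (P u)%:E) -> invariant_measure X mu.
Proof.
move=> hmu; split.
  have mX := measurable_shift f_homo f_ge0.
  have h0 : mu (~` X) = 0%E.
    pose F k : set borel_config := if @unpickle (int * seq nat)%type k is Some iu
      then (if lang f iu.2 then set0 else cyl iu.1 iu.2) else set0.
    have mF k : measurable (F k).
      rewrite /F; case: unpickle => [[i u]|]; last exact: measurable0.
      by case: ifP => _; [exact: measurable0|exact: measurable_cyl].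
    have muF k : mu (F k) = 0%E.
      rewrite /F; case: unpickle => [[i u]|]; last exact: measure0.
      case: ifP => [_|hu]; [exact: measure0|rewrite /= hmu].
      suff -> : P u = 0 by [].
      by apply/eqP/negPn/negP => /(process_lang hP) /=; rewrite -/(lang f u) hu.
    have hsub : ~` X `<=` \bigcup_k F k.
      rewrite (shift_bigcap f_homo f_ge0) setC_bigcap => x [[i u] /= hu] /contrapT hx.
      by exists (pickle (i, u)); [exact: Logic.I|rewrite /F pickleK ifN].
    apply/eqP; rewrite eq_le measure_ge0 andbT.
    apply: le_trans (measure_sigma_subadditive mu mF _ hsub) _; first exact: measurableC.
    by rewrite eseries0 // => k _ _; exact: muF.
  have := probability_setC mu (measurableC mX); rewrite setCK h0 => ->.
  by rewrite sube0.
have mshift : measurable_fun setT (shift_map : borel_config -> borel_config).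
  by apply: cyl_measurable_fun => i u; rewrite shift_cyl; exact: measurable_cyl.
move=> A mA.
have agree i u : distribution mu (mfun_Sub (mem_set mshift)) (cyl i u) = mu (cyl i u).
  by rewrite [LHS](_ : _ = mu (shift_map @^-1` cyl i u)) // shift_cyl !hmu.
exact: (cyl_measure_unique agree mA).
Qed.

End Realisation.

(** * Intrinsic ergodicity *)

Theorem theorem1p1 (R : realType) (m : nat) (f : nat -> R) :
  (0 < m)%N ->
  canonical_function f ->
  bounded_density_shift f `<=` [set x | forall i, (x i <= m)%N] ->
  \sum_(1 <= i < m.+1) (i%:R / i.+1%:R) < limiting_gradient f ->
  intrinsically_ergodic R (bounded_density_shift f).
Proof.
move=> m_gt0 [f_ge0 f0 f_S f_D] X_letters alpha_gt.
have f_homo : {homo f : i j / (i <= j)%N >-> i <= j}.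
  exact: (homo_leq (@lexx _ _) (@le_trans _ _) f_S).
have alpha_le k : limiting_gradient f * k%:R <= f k.
  by have [_ /(_ k)] := fekete f_ge0 f_D.
have [P hP] := maximal_exists m_gt0 f_homo f_ge0 alpha_gt alpha_le.
have [mu hmu] := process_measure (proj1 hP).
have muX := process_invariant_measure (proj1 hP) f_homo f_ge0 hmu.
exists mu.
  apply: (maximal_mme f_homo f_ge0 X_letters muX).
  by rewrite (_ : (fun u => _) = P) //; apply/funext => u; rewrite /mass hmu.
move=> nu [nuX nuh]; apply: cyl_measure_unique => i u.
rewrite hmu (massE nu (measurable_cyl i u)) (mass_cyl nuX); congr (_%:E).
have hQ := mme_maximal f_homo f_ge0 X_letters nuX nuh.
exact: (maximal_unique m_gt0 f_homo f_ge0 alpha_gt alpha_le hQ hP u).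
Qed.
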